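(* Let $V$ be a vector superspace over $\mathbb F$ (parity $p$) with an even endomorphism $\partial$, and let $\Pi V$ be $V$ with reversed parity $\bar p=1-p$. Let $W^{\mathrm{ch}}(\Pi V)=\bigoplus_{k\ge -1}W^{\mathrm{ch}}_k(\Pi V)$ be the $\mathbb Z$-graded Lie superalgebra associated to the chiral operad $P^{\mathrm{ch}}(\Pi V)$. To an odd element $X\in W^{\mathrm{ch}}_1(\Pi V)$ associate the linear map $V\otimes V\to V[\lambda]$, $$\int^{\lambda}d\sigma[u_\sigma v]=(-1)^{p(u)}X^{z_1,z_2}_{\lambda,-\lambda-\partial}\Big(u,v;\frac1{z_2-z_1}\Big)$$ (where one uses the isomorphism $V[\lambda_1,\lambda_2]/\langle\partial+\lambda_1+\lambda_2\rangle\simeq V[\lambda]$ given by $\lambda_1=\lambda$, $\lambda_2=-\lambda-\partial$). Then $X\Box X=0$ if and only if this integral $\lambda$-bracket satisfies the integral Jacobi identity (axiom (iv) in the context). Consequently, the odd elements $X\in W^{\mathrm{ch}}_1(\Pi V)$ with $X\Box X=0$ are in bijective correspondence, via the assignment sending $X$ to the integral $\lambda$-bracket $\int^{\lambda}d\sigma[u_\sigma v]=(-1)^{p(u)}X^{z_1,z_2}_{\lambda,-\lambda-\partial}\big(u,v;\frac1{z_2-z_1}\big)$, with the structures of non-unital vertex algebra on the $\mathbb F[\partial]$-module $V$.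
   Context: $\mathbb F$ is a field of characteristic $0$; $\langle\Phi\rangle$ denotes the image of an endomorphism $\Phi$; $z_{ij}=z_i-z_j$; $\mathcal O^{\star T}_n=\mathbb F[z_{ij}^{\pm1}]_{1\le i<j\le n}$ (so it equals $\mathbb F$ for $n=0,1$). **Chiral operad.** For a superspace $U$ with even endomorphism $\partial$, $P^{\mathrm{ch}}(U)(n)$, $n\ge0$, is the superspace of linear maps $X:U^{\otimes n}\otimes\mathcal O^{\star T}_n\to U[\lambda_1,\dots,\lambda_n]/\langle\partial+\lambda_1+\dots+\lambda_n\rangle$, written $X^{z_1,\dots,z_n}_{\lambda_1,\dots,\lambda_n}(v_1,\dots,v_n;f)$, such that for all $i,j$ $X(\dots,(\partial+\lambda_i)v_i,\dots;f)=X(v_1,\dots,v_n;\partial f/\partial z_i)$ and $X(v_1,\dots,v_n;z_{ij}f)=(\partial_{\lambda_j}-\partial_{\lambda_i})X(v_1,\dots,v_n;f)$. $S_n$ acts on the right by $(X^\sigma)_{\lambda_1,\dots,\lambda_n}(v_1,\dots,v_n;f(z_1,\dots,z_n))=\epsilon_v(\sigma)X^{z_1,\dots,z_n}_{\lambda_{i_1},\dots,\lambda_{i_n}}(v_{i_1},\dots,v_{i_n};f(z_{i_1},\dots,z_{i_n}))$, $i_s=\sigma^{-1}(s)$, where $\epsilon_v(\sigma)=\prod_{i<j,\,\sigma(i)>\sigma(j)}(-1)^{\mathrm{par}(v_i)\mathrm{par}(v_j)}$ and $\mathrm{par}$ is the parity of $U$. For $X\in P^{\mathrm{ch}}(n)$,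 $Y\in P^{\mathrm{ch}}(m)$, $h\in\mathcal O^{\star T}_{n+m-1}$, write $h=f(z_1,\dots,z_n)\,g(z_1,\dots,z_{n+m-1})$ with $f\in\mathcal O^{\star T}_n$, $g\in\mathcal O^{\star T}_{n+m-1}$ having no poles at $z_i=z_j$ for $1\le i<j\le n$; then $(Y\circ_1X)_{\lambda_1,\dots,\lambda_{n+m-1}}(v_1,\dots,v_{n+m-1};h)=Y^{z_1,z_{n+1},\dots,z_{n+m-1}}_{\lambda_1+\dots+\lambda_n,\lambda_{n+1},\dots,\lambda_{n+m-1}}\big(X^{z_1,\dots,z_n}_{\lambda_1-\partial_{z_1},\dots,\lambda_n-\partial_{z_n}}(v_1,\dots,v_n;f)_\to,v_{n+1},\dots,v_{n+m-1};g|_{z_1=\dots=z_n}\big)$, where the arrow means that the derivatives $\partial_{z_i}$ are applied to $g$ before setting $z_2=\dots=z_n=z_1$. **Lie superalgebra.** $W^{\mathrm{ch}}_k(U)=P^{\mathrm{ch}}(U)(k+1)^{S_{k+1}}$. For $f\in W_n$, $g\in W_m$: $f\Box g=\sum_{\sigma\in S_{m+1,n}}(f\circ_1g)^{\sigma^{-1}}$, where $S_{m+1,n}\subset S_{m+n+1}$ is the set of $\sigma$ with $\sigma(1)<\dots<\sigma(m+1)$, $\sigma(m+2)<\dots<\sigma(m+n+1)$; the bracket is $[f,g]=f\Box g-(-1)^{\mathrm{par}(f)\mathrm{par}(g)}g\Box f$. **Non-unital vertex algebra.** A $\mathbb Z/2\mathbb Z$-graded $\mathbb F[\partial]$-module $V$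 with an even linear map $V\otimes V\to V[\lambda]$, $u\otimes v\mapsto\int^\lambda d\sigma[u_\sigma v]$; the constant term is denoted $:\!uv\!:$ and the $\lambda$-derivative $[u_\lambda v]$, so $\int^\lambda d\sigma[u_\sigma v]=\,:\!uv\!:+\int_0^\lambda d\sigma[u_\sigma v]$. Axioms: (ii) $\int^\lambda d\sigma[\partial u_\sigma v]=-\int^\lambda d\sigma\,\sigma[u_\sigma v]$ and $\int^\lambda d\sigma[u_\sigma\partial v]=\int^\lambda d\sigma(\partial+\sigma)[u_\sigma v]$, i.e. $[\partial u_\lambda v]=-\lambda[u_\lambda v]$, $[u_\lambda\partial v]=(\partial+\lambda)[u_\lambda v]$, and $\partial:\!uv\!:\,=\,:\!(\partial u)v\!:+:\!u\,\partial v\!:$; (iii) $\int^\lambda d\sigma[v_\sigma u]=(-1)^{p(u)p(v)}\int^{-\lambda-\partial}d\sigma[u_\sigma v]$ (substitute $-\lambda-\partial$ for $\lambda$, $\partial$ acting on coefficients from the left); (iv) $\int^\lambda d\sigma\int^\mu d\tau\big([u_\sigma[v_\tau w]]-(-1)^{p(u)p(v)}[v_\tau[u_\sigma w]]-[[u_\sigma v]_{\sigma+\tau}w]\big)=0$, where the first term means $:\!u:\!vw\!:\,\!:+\int_0^\mu d\tau:\!u[v_\tau w]\!:+\int_0^\lambda d\sigma[u_\sigma:\!vw\!:]+\int_0^\lambda d\sigma\int_0^\mu d\tau[u_\sigma[v_\tau w]]$, the second is interpreted analogously, and the third means $:\!A\,w\!:+\int_0^{\lambda+\mu}d\tau[A_\tau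 w]$ with $A=\int_{-\mu-\partial}^\lambda d\sigma[u_\sigma v]$ ($\partial$ acting on the coefficients of $[u_\sigma v]$).
   Formalization: In the right action of S_n on the chiral operad, f is replaced by f(z_{σ(1)},...,z_{σ(n)}) rather than the displayed f(z_{i_1},...,z_{i_n}), i_s=σ^{-1}(s): the displayed formula is not a right action and breaks sesquilinearity for 3-cycles. *)

(* Defs.v *)
From HB Require Import structures.
From mathcomp Require Import all_boot all_order all_fingroup all_algebra.
From mathcomp Require Import generic_quotient.
From mathcomp Require Import boolp classical_sets functions.
From mathcomp Require Import ring.
From mathcomp Require Import finmap monalg mpoly.

Set Implicit Arguments.
Unset Strict Implicit.
Unset Printing Implicit Defensive.

Import GRing.Theory.
Local Open Scope ring_scope.
Local Open Scope quotient_scope.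
Local Open Scope classical_set_scope.

(* monalg and mpoly both declare this notation. *)
Local Notation "{ 'mpoly' T [ n ] }" := (mpoly n T) : type_scope.
Local Notation "x %:F" := (@FracField.tofrac _ x) : ring_scope.

(* [proj G false v] and [proj G true v] are the even and odd components of v. *)
Record supergrading (F : fieldType) (V : lmodType F) := Supergrading {
  proj :> bool -> {linear V -> V};
  proj_proj : forall b c v, proj b (proj c v) = if b == c then proj c v else 0;
  proj_sum : forall v, proj false v + proj true v = v }.

Section Superspace.
Variables (F : fieldType) (V : lmodType F).
Implicit Types (G : supergrading V) (d : {linear V -> V}).

Definition has_parity G (b : bool) (v : V) : Prop := G b v = v.

Definition even_endo G d : Prop := forall b v, has_parity G b v -> has_parity G b (d v).

Lemma revproj_proj G b c v :
  G (~~ b) (G (~~ c) v) = if b == c then G (~~ c) v else 0.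
Proof. by rewrite proj_proj; case: b; case: c. Qed.

Lemma revproj_sum G v : G (~~ false) v + G (~~ true) v = v.
Proof. by rewrite addrC proj_sum. Qed.

Definition parity_reverse G : supergrading V :=
  @Supergrading F V (fun b => G (~~ b)) (revproj_proj G) (revproj_sum G).

End Superspace.

(* V[lambda_1, ..., lambda_n], the variables being indexed by 'I_n. *)
Definition lpoly (F : fieldType) (V : lmodType F) (n : nat) : Type :=
  malg (multinom n) V.

HB.instance Definition _ (F : fieldType) (V : lmodType F) (n : nat) :=
  GRing.Zmodule.on (lpoly V n).

(* The next three definitions are locked only to stop unification from
   unfolding the underlying finitely supported functions. *)
HB.lock Definition lcoef (F : fieldType) (V : lmodType F) (n : nat)
    (m : 'X_{1..n}) (x : lpoly V n) : V := monalg.mcoeff m x.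

HB.lock Definition lmon (F : fieldType) (V : lmodType F) (n : nat)
    (m : 'X_{1..n}) (v : V) : lpoly V n := mkmalgU m v.

(* \sum_m f m x_m over the monomials m of x = \sum_m x_m lambda^m. *)
HB.lock Definition lsum (F : fieldType) (V : lmodType F) (n : nat)
    (A : nmodType) (f : 'X_{1..n} -> V -> A) (x : lpoly V n) : A :=
  \sum_(m <- monalg.msupp x) f m (lcoef m x).

Section LPolyOps.
Variables (F : fieldType) (V : lmodType F) (n : nat).
Implicit Types (x y : lpoly V n) (m k : 'X_{1..n}).

Lemma lpolyP x y : (forall m, lcoef m x = lcoef m y) -> x = y.
Proof. by move=> h; apply/malgP => m; move: (h m); rewrite lcoef.unlock. Qed.

Lemma lcoefD m x y : lcoef m (x + y) = lcoef m x + lcoef m y.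
Proof. by rewrite lcoef.unlock; apply: monalg.mcoeffD. Qed.

Lemma lcoef_mon k m (v : V) : lcoef k (lmon m v) = v *+ (m == k).
Proof. by rewrite lcoef.unlock lmon.unlock; apply: monalg.mcoeffU. Qed.

Definition lscale (c : F) : lpoly V n -> lpoly V n :=
  lsum (fun m v => lmon m (c *: v)).

Lemma lcoef_scale c x m : lcoef m (lscale c x) = c *: lcoef m x.
Proof.
have lcoef_is_additive : zmod_morphism (@lcoef F V n m).
  move=> y z; rewrite lcoef.unlock; apply: monalg.mcoeffB.
rewrite /lscale lsum.unlock.
have -> (I : Type) (r : seq I) (f : I -> lpoly V n) :
    lcoef m (\sum_(i <- r) f i) = \sum_(i <- r) lcoef m (f i).
  elim: r => [|i r IHr]; last by rewrite !big_cons lcoefD IHr.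
  by rewrite !big_nil -(subrr 0) lcoef_is_additive subrr.
under eq_bigr do rewrite lcoef_mon.
case: (boolP (m \in monalg.msupp x)) => hm.
  rewrite (perm_big _ (perm_to_rem hm)) big_cons eqxx mulr1n.
  rewrite big_seq big1 => [|i]; first exact: addr0.
  by rewrite mem_rem_uniq ?fset_uniq // inE => /andP[/negbTE-> _].
have -> : lcoef m x = 0 by rewrite lcoef.unlock monalg.mcoeff_outdom.
rewrite scaler0 big_seq big1 // => i hi; case: eqP => [e|] //.
by rewrite -e hi in hm.
Qed.

Lemma lscaleA a b x : lscale a (lscale b x) = lscale (a * b) x.
Proof. by apply: lpolyP => m; rewrite !lcoef_scale scalerA. Qed.

Lemma lscale1 : left_id 1 lscale.
Proof. by move=> x; apply: lpolyP => m; rewrite lcoef_scale scale1r. Qed.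

Lemma lscaleDr : right_distributive lscale +%R.
Proof.
by move=> c x y; apply: lpolyP => m; rewrite !(lcoef_scale, lcoefD) scalerDr.
Qed.

Lemma lscaleDl x : {morph lscale^~ x : a b / a + b}.
Proof.
by move=> a b; apply: lpolyP => m; rewrite !(lcoef_scale, lcoefD) scalerDl.
Qed.

HB.instance Definition _ := GRing.Zmodule_isLmodule.Build F (lpoly V n)
  lscaleA lscale1 lscaleDr lscaleDl.

Lemma lcoefZ m c x : lcoef m (c *: x) = c *: lcoef m x.
Proof. exact: lcoef_scale. Qed.

Definition lC (v : V) : lpoly V n := lmon 0%MM v.

Definition lmulm (m : 'X_{1..n}) : lpoly V n -> lpoly V n :=
  lsum (fun k v => lmon (k + m)%MM v).
Definition lX (i : 'I_n) : lpoly V n -> lpoly V n := lmulm U_(i)%MM.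

Definition lder (i : 'I_n) : lpoly V n -> lpoly V n :=
  lsum (fun k v => lmon (k - U_(i))%MM (v *+ k i)).

(* The primitive in lambda_i vanishing at lambda_i = 0. *)
Definition lprim (i : 'I_n) : lpoly V n -> lpoly V n :=
  lsum (fun k v => lmon (k + U_(i))%MM ((k i).+1%:R^-1 *: v)).

End LPolyOps.

Section LPolyEval.
Variables (F : fieldType) (V W : lmodType F) (n : nat).

Definition lmap (f : V -> W) : lpoly V n -> lpoly W n :=
  lsum (fun k v => lmon k (f v)).

(* [leval A phi x] substitutes for each lambda_i the operator A i (these are
   meant to commute with each other):
   \sum_m x_m lambda^m |-> \sum_m (\prod_i (A i) ^ (m i)) (phi x_m). *)
Definition leval (M : nmodType) (A : 'I_n -> M -> M) (phi : V -> M)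
    (x : lpoly V n) : M :=
  lsum (fun k v => foldr (fun i => iter (k i) (A i)) (phi v) (enum 'I_n)) x.

End LPolyEval.

(* Substitution of \sum_(i | tau i = k) lambda_i for the variable Lambda_k;
   for a permutation sigma, this puts lambda_(sigma^-1 k) in place k. *)
Definition lpush (F : fieldType) (V : lmodType F) (n k : nat)
    (tau : 'I_n -> 'I_k) : lpoly V k -> lpoly V n :=
  leval (fun s x => \sum_(i | tau i == s) lX i x) (@lC F V n).

Section LSumLinear.
Variables (F : fieldType) (V : lmodType F) (n : nat).

Lemma lsumEw (A : nmodType) (f : 'X_{1..n} -> V -> A) (D : finSet _)
    (x : lpoly V n) :
  (forall m, f m 0 = 0) -> fsubset (monalg.msupp x) D ->
  lsum f x = \sum_(m <- D) f m (lcoef m x).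
Proof.
move=> f0 sD; rewrite lsum.unlock; symmetry.
rewrite (bigID (fun m => m \in monalg.msupp x)) /= addrC big1 => [|m hm].
  rewrite add0r -big_filter; apply: perm_big; apply: uniq_perm.
  - by rewrite filter_uniq // fset_uniq.
  - by rewrite fset_uniq.
  move=> m; rewrite mem_filter; case: (boolP (m \in monalg.msupp x)) => //= hm.
  by move/fsubsetP: sD; apply.
by rewrite lcoef.unlock monalg.mcoeff_outdom // f0.
Qed.

Lemma lsum_linear (M : lmodType F) (f : 'X_{1..n} -> V -> M) :
  (forall m, linear (f m)) -> linear (lsum f).
Proof.
move=> fL c x y.
have f0 m : f m 0 = 0.
  by have := fL m (-1) 0 0; rewrite scaler0 addr0 scaleN1r addNr.
pose D := fsetU (monalg.msupp x)
  (fsetU (monalg.msupp y) (monalg.msupp (c *: x + y))).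
have hx : fsubset (monalg.msupp x) D by rewrite fsubsetUl.
have hy : fsubset (monalg.msupp y) D.
  by rewrite fsubsetU // fsubsetUl orbT.
have hz : fsubset (monalg.msupp (c *: x + y)) D.
  by rewrite fsubsetU // fsubsetUr orbT.
rewrite (lsumEw f0 hx) (lsumEw f0 hy) (lsumEw f0 hz) scaler_sumr -big_split /=.
by apply: eq_bigr => m _; rewrite lcoefD lcoefZ fL.
Qed.

Lemma lmon_linear m : linear (@lmon F V n m).
Proof.
move=> c x y; apply: lpolyP => k.
by rewrite !(lcoefD, lcoefZ, lcoef_mon) mulrnDl scalerMnr.
Qed.

Lemma lX_linear i : linear (@lX F V n i).
Proof. by apply: lsum_linear => m; apply: lmon_linear. Qed.

Lemma lmap_linear (W : lmodType F) (f : {linear V -> W}) :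
  linear (lmap (n := n) f).
Proof.
apply: lsum_linear => m c x y /=; apply: lpolyP => k.
by rewrite linearP !(lcoefD, lcoefZ, lcoef_mon) mulrnDl scalerMnr.
Qed.

End LSumLinear.

Section LQuot.
Variables (F : fieldType) (V : lmodType F) (d : {linear V -> V}) (n : nat).

Definition ltot (x : lpoly V n) : lpoly V n := lmap d x + \sum_i lX i x.

Lemma ltot_linear : linear ltot.
Proof.
move=> c x y; rewrite /ltot lmap_linear scalerDr addrACA; congr (_ + _).
by rewrite scaler_sumr -big_split; apply: eq_bigr => i _; rewrite lX_linear.
Qed.

Lemma ltot0 : ltot 0 = 0.
Proof. by have := ltot_linear (-1) 0 0; rewrite scaler0 addr0 scaleN1r addNr. Qed.

Definition ltot_image : {pred lpoly V n} := fun x => `[< exists y, x = ltot y >].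

Lemma ltot_imageP c x y :
  x \in ltot_image -> y \in ltot_image -> c *: x + y \in ltot_image.
Proof.
by move=> /asboolP[x' ->] /asboolP[y' ->]; apply/asboolP; exists (c *: x' + y');
  rewrite ltot_linear.
Qed.

Lemma ltot_image0 : 0 \in ltot_image.
Proof. by apply/asboolP; exists 0; rewrite ltot0. Qed.

Lemma ltot_image_zmod_closed : zmod_closed ltot_image.
Proof.
split; first exact: ltot_image0.
by move=> x y hx hy; rewrite addrC -scaleN1r ltot_imageP.
Qed.

HB.instance Definition _ :=
  GRing.isZmodClosed.Build (lpoly V n) ltot_image ltot_image_zmod_closed.

Definition lquot : Type := Quotient.quot ltot_image.

HB.instance Definition _ := Choice.on lquot.
HB.instance Definition _ := GRing.Zmodule.on lquot.

Definition lpi (x : lpoly V n) : lquot := \pi_(Quotient.quot ltot_image) x.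
Definition lrepr (q : lquot) : lpoly V n := repr (q : Quotient.quot ltot_image).

Lemma lreprK q : lpi (lrepr q) = q.
Proof. exact: reprK. Qed.

Lemma lpiP x y : lpi x = lpi y <-> exists z, x - y = ltot z.
Proof.
split=> [e|hz].
  by apply/asboolP; rewrite -[asbool _]/(x - y \in ltot_image)
    Quotient.idealrBE; apply/eqP.
by apply/eqP; rewrite -Quotient.idealrBE; apply/asboolP.
Qed.

Lemma lpiD x y : lpi (x + y) = lpi x + lpi y.
Proof. exact: (raddfD \pi_(Quotient.quot ltot_image)). Qed.

Definition lqscale (c : F) (q : lquot) : lquot := lpi (c *: lrepr q).

Lemma lqscale_pi c x : lqscale c (lpi x) = lpi (c *: x).
Proof.
apply/lpiP; have /lpiP[z e] := lreprK (lpi x).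
exists (c *: z); rewrite -scalerBr e.
by have := ltot_linear c z 0; rewrite ltot0 !addr0 => ->.
Qed.

Lemma lqscaleA a b q : lqscale a (lqscale b q) = lqscale (a * b) q.
Proof. by rewrite -(lreprK q) !lqscale_pi scalerA. Qed.

Lemma lqscale1 : left_id 1 lqscale.
Proof. by move=> q; rewrite -(lreprK q) lqscale_pi scale1r. Qed.

Lemma lqscaleDr : right_distributive lqscale +%R.
Proof.
move=> c q r.
by rewrite -(lreprK q) -(lreprK r) -lpiD !lqscale_pi -lpiD scalerDr.
Qed.

Lemma lqscaleDl q : {morph lqscale^~ q : a b / a + b}.
Proof. by move=> a b; rewrite -(lreprK q) !lqscale_pi -lpiD scalerDl. Qed.

HB.instance Definition _ := GRing.Zmodule_isLmodule.Build F lquot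
  lqscaleA lqscale1 lqscaleDr lqscaleDl.

End LQuot.

Section RationalFunctions.
Variables (F : fieldType) (n : nat).

Local Notation K := {fraction {mpoly F[n]}}.

Lemma fracE (x : K) : x = (\n_(repr x))%:F / (\d_(repr x))%:F.
Proof.
rewrite -[LHS]reprK -[in LHS](Ratio_numden (repr x)).
move: (repr x) => r.
have d0 : \d_r != 0 by apply: denom_ratioP.
apply: (canRL (mulfK _)); first by rewrite tofrac_eq0.
rewrite /FracField.tofrac; unlock.
rewrite -[LHS]/(FracField.mul _ _) !piE; apply/eqmodP => /=.
by rewrite FracField.equivfE /FracField.mulf !numden_Ratio ?mulf_neq0 ?oner_eq0 //
  !mulr1 mulrC.
Qed.

Definition zdiff (i j : 'I_n) : K := ('X_i - 'X_j)%:F.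

(* The subalgebra of F(z_1, ..., z_n) generated by the z_ij and their inverses. *)
Inductive OstarT : K -> Prop :=
  | OTconst c : OstarT (c%:MP)%:F
  | OTz (i j : 'I_n) : (i < j)%N -> OstarT (zdiff i j)
  | OTzinv (i j : 'I_n) : (i < j)%N -> OstarT (zdiff i j)^-1
  | OTadd f g : OstarT f -> OstarT g ->
      OstarT (f + g)
  | OTmul f g : OstarT f -> OstarT g ->
      OstarT (f * g).

Definition OTpred : {pred K} := fun f => `[< OstarT f >].

Lemma OTpredP f : reflect (OstarT f) (f \in OTpred).
Proof. exact: asboolP. Qed.

Lemma OT_opp f : OstarT f -> OstarT (- f).
Proof.
move=> hf; rewrite -mulN1r; apply: OTmul => //.
by have := OTconst (-1); rewrite mpolyCN mpolyC1 tofracN tofrac1.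
Qed.

Lemma OT_subring : subring_closed OTpred.
Proof.
split=> [|f g /OTpredP hf /OTpredP hg|f g /OTpredP hf /OTpredP hg]; apply/OTpredP.
- by have := OTconst 1; rewrite mpolyC1 tofrac1.
- by apply: OTadd => //; apply: OT_opp.
- exact: OTmul.
Qed.

HB.instance Definition _ := GRing.isSubringClosed.Build K OTpred OT_subring.

Lemma OT_zdiff (i j : 'I_n) : zdiff i j \in OTpred.
Proof.
apply/OTpredP; case: (ltngtP i j) => [|ij|/val_inj->]; first exact: OTz.
  by rewrite /zdiff -opprB tofracN; apply: OT_opp; apply: OTz.
by rewrite /zdiff subrr -(mpolyC0 n F); apply: OTconst.
Qed.

Lemma OT_zinv (i j : 'I_n) : (zdiff i j)^-1 \in OTpred.
Proof.
apply/OTpredP; case: (ltngtP i j) => [|ij|/val_inj->]; first exact: OTzinv.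
  by rewrite /zdiff -opprB tofracN invrN; apply: OT_opp; apply: OTzinv.
by rewrite /zdiff subrr tofrac0 invr0 -tofrac0 -(mpolyC0 n F); apply: OTconst.
Qed.

Lemma fracD (p q r s : {mpoly F[n]}) : q != 0 -> s != 0 ->
  p%:F / q%:F + r%:F / s%:F = (p * s + r * q)%:F / (q * s)%:F :> K.
Proof.
move=> q0 s0; rewrite addf_div ?tofrac_eq0 //.
by rewrite (tofracD (p * s)) (tofracM p) (tofracM r) (tofracM q).
Qed.

Lemma fracM (p q r s : {mpoly F[n]}) :
  p%:F / q%:F * (r%:F / s%:F) = (p * r)%:F / (q * s)%:F :> K.
Proof. by rewrite mulf_div (tofracM p) (tofracM q). Qed.

Lemma frac_eq (p q r s : {mpoly F[n]}) : q != 0 -> s != 0 ->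
  (p%:F / q%:F = r%:F / s%:F :> K) <-> p * s = r * q.
Proof.
move=> q0 s0; split=> [/eqP|e].
  rewrite eqr_div ?tofrac_eq0 // -(tofracM p) -(tofracM r) tofrac_eq.
  by move/eqP.
apply/eqP; rewrite eqr_div ?tofrac_eq0 // -(tofracM p) -(tofracM r).
by rewrite tofrac_eq e.
Qed.

Definition fderiv (i : 'I_n) (x : K) : K :=
  let p := \n_(repr x) in let q := \d_(repr x) in
  (p^`M(i) * q - p * q^`M(i))%:F / (q ^+ 2)%:F.

Lemma fderivE i (p q : {mpoly F[n]}) : q != 0 ->
  fderiv i (p%:F / q%:F) = (p^`M(i) * q - p * q^`M(i))%:F / (q ^+ 2)%:F.
Proof.
move=> q0; set x := p%:F / q%:F; rewrite /fderiv.
have := fracE x; have: \d_(repr x) != 0 by apply: denom_ratioP.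
move: (\n_(repr x)) (\d_(repr x)) => r s s0 e.
have e1 : p * s = r * q.
  exact/(frac_eq p r q0 s0).
apply/frac_eq; rewrite ?expf_neq0 //.
have e2 : p^`M(i) * s + p * s^`M(i) = r^`M(i) * q + r * q^`M(i).
  by rewrite -!mderivM e1.
have e3 : (r^`M(i) * s - r * s^`M(i)) * q ^+ 2 -
    (p^`M(i) * q - p * q^`M(i)) * s ^+ 2 =
    s * q * (r^`M(i) * q + r * q^`M(i) - (p^`M(i) * s + p * s^`M(i))) +
    (s^`M(i) * q + s * q^`M(i)) * (p * s - r * q) by ring.
by apply/eqP; rewrite -subr_eq0 e3 e2 e1 !subrr !mulr0 addr0.
Qed.

Lemma fderivD i (x y : K) : fderiv i (x + y) = fderiv i x + fderiv i y.
Proof.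
rewrite (fracE x) (fracE y).
move: (\n_(repr x)) (\d_(repr x)) (denom_ratioP (repr x)) => p q q0.
move: (\n_(repr y)) (\d_(repr y)) (denom_ratioP (repr y)) => r s s0.
have qs0 : q * s != 0 by rewrite mulf_neq0.
rewrite fracD // (fderivE i _ qs0) (fderivE i p q0) (fderivE i r s0).
rewrite fracD ?expf_neq0 //; apply/frac_eq; rewrite ?mulf_neq0 ?expf_neq0 //.
by rewrite mderivD !mderivM; ring.
Qed.

Lemma fderivM i (x y : K) :
  fderiv i (x * y) = fderiv i x * y + x * fderiv i y.
Proof.
rewrite (fracE x) (fracE y).
move: (\n_(repr x)) (\d_(repr x)) (denom_ratioP (repr x)) => p q q0.
move: (\n_(repr y)) (\d_(repr y)) (denom_ratioP (repr y)) => r s s0.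
have qs0 : q * s != 0 by rewrite mulf_neq0.
rewrite fracM (fderivE i _ qs0) (fderivE i p q0) (fderivE i r s0) !fracM.
rewrite fracD; [|by rewrite mulf_neq0 ?expf_neq0..].
apply/frac_eq; [by rewrite !(mulf_neq0, expf_neq0)..|].
by rewrite !mderivM; ring.
Qed.

Lemma fderiv_poly i (p : {mpoly F[n]}) : fderiv i p%:F = (p^`M(i))%:F.
Proof.
rewrite -[p%:F]divr1 -tofrac1 fderivE ?oner_eq0 //.
by rewrite -mpolyC1 mderivC mpolyC1 mulr1 mulr0 subr0 expr1n tofrac1 divr1.
Qed.

Lemma OT_fderiv i x : x \in OTpred -> fderiv i x \in OTpred.
Proof.
have OTC c : (c%:MP)%:F \in OTpred by apply/OTpredP; apply: OTconst.
have derivX j : exists c, 'X_j^`M(i) = c%:MP :> {mpoly F[n]}.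
  rewrite mderivX mnm1E; case: eqP => [->|_]; last first.
    by exists 0; rewrite scale0r mpolyC0.
  exists 1; rewrite scale1r mpolyC1 -mpolyX0; congr 'X_[_].
  by apply/mnmP => k; rewrite mnmBE mnm0E subnn.
have derivz j k : exists c, ('X_j - 'X_k)^`M(i) = c%:MP :> {mpoly F[n]}.
  have [c ec] := derivX j; have [e ee] := derivX k; exists (c - e).
  by rewrite mderivB ec ee mpolyCB.
move/OTpredP; elim=> {x} [c|j k _|j k jk|f g hf Df hg Dg|f g hf Df hg Dg].
- by rewrite fderiv_poly mderivC -(mpolyC0 n F).
- by rewrite fderiv_poly; have [c ->] := derivz j k.
- have [z0|z0] := eqVneq ('X_j - 'X_k : {mpoly F[n]}) 0.
    by rewrite /zdiff z0 tofrac0 invr0 -tofrac0 fderiv_poly mderiv0 rpred0.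
  rewrite /zdiff -[X in fderiv i X]mul1r -tofrac1 fderivE //.
  rewrite -mpolyC1 mderivC mul0r sub0r mpolyC1 mul1r tofracN tofracXn mulNr.
  rewrite rpredN exprS expr1 invfM; have [c ->] := derivz j k.
  by apply: rpredM; [exact: OTC | apply: rpredM; exact: OT_zinv].
- by rewrite fderivD rpredD.
by rewrite fderivM rpredD // rpredM //; apply/OTpredP.
Qed.

Record rfun := Rfun { rval :> K; rvalP : rval \in OTpred }.

HB.instance Definition _ := [isSub for rval].
HB.instance Definition _ := [Choice of rfun by <:].
HB.instance Definition _ := [SubChoice_isSubComNzRing of rfun by <:].

Lemma OT_const (c : F) : (c%:MP)%:F \in OTpred.
Proof. by apply/OTpredP; apply: OTconst. Qed.

Definition rconst (c : F) : rfun := Rfun (OT_const c).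
Definition rz (i j : 'I_n) : rfun := Rfun (OT_zdiff i j).
Definition rzinv (i j : 'I_n) : rfun := Rfun (OT_zinv i j).
Definition rderiv (i : 'I_n) (f : rfun) : rfun := Rfun (OT_fderiv i (rvalP f)).

Definition rscale (c : F) (f : rfun) : rfun := rconst c * f.

Lemma rscaleA a b f : rscale a (rscale b f) = rscale (a * b) f.
Proof. by apply: val_inj; rewrite /= mulrA mpolyCM tofracM. Qed.
Lemma rscale1 : left_id 1 rscale.
Proof. by move=> f; apply: val_inj; rewrite /= mpolyC1 tofrac1 mul1r. Qed.
Lemma rscaleDr : right_distributive rscale +%R.
Proof. by move=> c f g; apply: mulrDr. Qed.
Lemma rscaleDl f : {morph rscale^~ f : a b / a + b}.
Proof. by move=> a b; apply: val_inj; rewrite /= mpolyCD tofracD mulrDl. Qed.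

HB.instance Definition _ := GRing.Zmodule_isLmodule.Build F rfun
  rscaleA rscale1 rscaleDr rscaleDl.

End RationalFunctions.

Definition psubst (F : fieldType) (n k : nat) (tau : 'I_n -> 'I_k)
    (p : {mpoly F[n]}) : {mpoly F[k]} :=
  p \mPo [tuple 'X_(tau i) | i < n].

(* f(z_(tau 0), ..., z_(tau (n - 1))), for f whose denominator (in some
   expression p / q) does not vanish identically under the substitution; by
   rsubstE the result does not depend on p and q. *)
Definition rsubst (F : fieldType) (n k : nat) (tau : 'I_n -> 'I_k)
    (f : rfun F n) : rfun F k :=
  xget 0 [set g : rfun F k | exists p q : {mpoly F[n]},
    [/\ psubst tau q != 0, rval f = p%:F / q%:F
      & rval g = (psubst tau p)%:F / (psubst tau q)%:F]].

Lemma rsubstE (F : fieldType) (n k : nat) (tau : 'I_n -> 'I_k)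
    (f : rfun F n) (g : rfun F k) (p q : {mpoly F[n]}) :
  psubst tau q != 0 -> rval f = p%:F / q%:F ->
  rval g = (psubst tau p)%:F / (psubst tau q)%:F -> rsubst tau f = g.
Proof.
move=> q0 ef eg; rewrite /rsubst; case: xgetP => [g' _ [r [s [s0 ef' eg']]]|h].
  apply: val_inj; rewrite /= eg' eg; apply/frac_eq => //; rewrite /psubst -!rmorphM /=.
  have nz (t : {mpoly F[n]}) : psubst tau t != 0 -> t != 0.
    by apply: contra_neq => ->; rewrite /psubst rmorph0.
  by move: ef'; rewrite ef => /frac_eq-> //; apply: nz.
by exfalso; apply: (h g); exists p, q.
Qed.

Definition no_pole (F : fieldType) (n : nat) (i j : 'I_n) (g : rfun F n) : Prop :=
  exists p q : {mpoly F[n]},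
    psubst (fun k => if k == j then i else k) q != 0 /\ rval g = p%:F / q%:F.

Section ChiralOperad.
Variables (F : fieldType) (V : lmodType F) (d : {linear V -> V}).

(* The operations below are induced by operations on representatives in
   V[lambda_1, ..., lambda_n] that preserve the image of [ltot d]. *)
Definition lqmulm n (m : 'X_{1..n}) (q : lquot d n) : lquot d n :=
  lpi d (lmulm m (lrepr q)).

Definition lqderB n (j i : 'I_n) (q : lquot d n) : lquot d n :=
  lpi d (lder j (lrepr q) - lder i (lrepr q)).

Definition lqpush n k (tau : 'I_n -> 'I_k) (q : lquot d k) : lquot d n :=
  lpi d (lpush tau (lrepr q)).

Definition lqparity (G : supergrading V) n (b : bool) (q : lquot d n) : Prop :=
  exists2 x, forall m, has_parity G b (lcoef m x) & q = lpi d x.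

(* Linear maps on V^{(x) n} (x) F[z_ij^{+-1}] are seen as maps which are
   linear in each of the n + 1 arguments. *)
Definition chmap n : Type := ('I_n -> V) -> rfun F n -> lquot d n.

Definition upd n (v : 'I_n -> V) (i : 'I_n) (u : V) : 'I_n -> V :=
  fun j => if j == i then u else v j.

Record chiral n (X : chmap n) : Prop := Chiral {
  chiral_linear : forall v i f, linear (fun u => X (upd v i u) f);
  chiral_linear_fun : forall v, linear (X v);
  chiral_sesquilinear : forall v i f,
    X (upd v i (d (v i))) f + lqmulm U_(i)%MM (X v f) = X v (rderiv i f);
  chiral_mulz : forall v i j f, X v (rz F i j * f) = lqderB j i (X v f) }.

Definition chparity (G : supergrading V) n (b : bool) (X : chmap n) : Prop :=
  forall (p : 'I_n -> bool) v f, (forall i, has_parity G (p i) (v i)) ->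
    lqparity G (b (+) \big[addb/false]_(i < n) p i) (X v f).

(* The exponent of epsilon_v(sigma), for v_i of parity p i. *)
Definition inv_parity n (p : 'I_n -> bool) (sigma : 'S_n) : nat :=
  \sum_(i < n) \sum_(j < n | (i < j)%N && (sigma j < sigma i)%N) (p i && p j).

(* X^sigma, extended from homogeneous v by multilinearity.  Slot s of X
   receives v_(i_s), lambda_(i_s) and, as its variable z_s, the variable
   z_(i_s) of f, where i_s = sigma^-1 s; so z_i is replaced by z_(sigma i). *)
Definition symact (G : supergrading V) n (sigma : 'S_n) (X : chmap n) : chmap n :=
  fun v f => \sum_(p : {ffun 'I_n -> bool})
    (-1) ^+ inv_parity p sigma *:
    lqpush sigma
      (X (fun s => let i := sigma^-1%g s in G (p i) (v i)) (rsubst sigma f)).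

(* z_1, ..., z_m are identified with the first of the n + 1 variables. *)
Definition collapse m n (i : 'I_(m + n)) : 'I_n.+1 :=
  if fintype.split i is inr j then lift ord0 j else ord0.

(* A choice of (f, g) such that h = f(z_1, ..., z_m) g(z_1, ..., z_(m+n)) and g
   has no pole along z_i = z_j for i < j <= m; Y o_1 X below does not depend on
   it for Y and X in the operad. *)
Definition factor m n (h : rfun F (m + n)) : rfun F m * rfun F (m + n) :=
  xget (0, 0) [set fg : rfun F m * rfun F (m + n) |
    h = rsubst (lshift n) fg.1 * fg.2 /\
    forall i j : 'I_m, (i < j)%N -> no_pole (lshift n i) (lshift n j) fg.2].

(* (\prod_(i <= m) (lambda_i - d/dz_i) ^ (a i)) g *)
Definition arrow m n (a : 'X_{1..m}) (g : rfun F (m + n)) :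
    lpoly (rfun F (m + n)) (m + n) :=
  foldr (fun i => iter (a i)
      (fun P => lX (lshift n i) P - lmap (rderiv (lshift n i)) P))
    (lC (m + n) g) (enum 'I_m).

(* Y o_1 X: if X(v_1, ..., v_m; f) is the class of \sum_a u_a lambda^a, and
   arrow a g = \sum_k g_k lambda^k, then (Y o_1 X)(v; f g) is
   \sum_a \sum_k lambda^k Y(u_a, v_(m+1), ..., v_(m+n); g_k | z_1 = ... = z_m)
   where Y has indices lambda_1 + ... + lambda_m, lambda_(m+1), ... *)
Definition comp1 m n (Y : chmap n.+1) (X : chmap m) : chmap (m + n) :=
  fun v h => let: (f, g) := factor h in
    lsum (fun a u =>
        lsum (fun k gk => lqmulm k (lqpush (@collapse m n)
              (Y (fun s => if unlift ord0 s is Some j then v (rshift m j) else u)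
                 (rsubst (@collapse m n) gk))))
          (arrow a g))
      (lrepr (X (fun i => v (lshift n i)) f)).

(* [Wch G n] is W^ch_(n-1). *)
Definition Wch (G : supergrading V) n : set (chmap n) :=
  [set X | chiral X /\ forall sigma v f, symact G sigma X v f = X v f].

Definition shuffle m n (sigma : 'S_(m + n)) : bool :=
  [forall i : 'I_m, forall j : 'I_m,
     (i < j)%N ==> (sigma (lshift n i) < sigma (lshift n j))%N] &&
  [forall i : 'I_n, forall j : 'I_n,
     (i < j)%N ==> (sigma (rshift m i) < sigma (rshift m j))%N].

(* X box Y for X in W_n and Y in W_(m-1). *)
Definition box (G : supergrading V) m n (X : chmap n.+1) (Y : chmap m) :
    chmap (m + n) :=
  fun v h => \sum_(sigma : 'S_(m + n) | @shuffle m n sigma)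
    symact G sigma^-1%g (comp1 X Y) v h.

(* The isomorphism V[lambda_1, lambda_2] / <d + lambda_1 + lambda_2> ~ V[lambda],
   lambda_1 = lambda, lambda_2 = - lambda - d. *)
Definition lquot2_lpoly (q : lquot d 2) : lpoly V 1 :=
  leval (fun i x => if i == ord0 then lX ord0 x else - lX ord0 x - lmap d x)
    (lC 1) (lrepr q).

(* G is the grading of V, X a map for V with the reversed grading. *)
Definition int_bracket (G : supergrading V) (X : chmap 2) (u v : V) : lpoly V 1 :=
  \sum_(p : bool) (-1) ^+ p *:
    lquot2_lpoly (X (fun i => [:: G p u; v]`_i) (rzinv F ord_max ord0)).

End ChiralOperad.

Section VertexAlgebra.
Variables (F : fieldType) (V : lmodType F).
Variables (G : supergrading V) (d : {linear V -> V}) (I : V -> V -> lpoly V 1).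

(* :uv: *)
Definition nop (u v : V) : V := lcoef 0%MM (I u v).

(* [u_lambda v] *)
Definition lbr (u v : V) : lpoly V 1 := lder ord0 (I u v).

(* Substitution of an operator A for lambda in P; with P the primitive of Q
   vanishing at 0, this gives the integral of Q from 0 to A. *)
Definition lat n (A : lpoly V n -> lpoly V n) (P : lpoly V 1) : lpoly V n :=
  leval (fun=> A) (lC n) P.

Definition lint0 n (A : lpoly V n -> lpoly V n) (Q : lpoly V 1) : lpoly V n :=
  lat A (lprim ord0 Q).

(* In V[lambda, mu], lambda and mu are the variables of index 0 and 1 of 'I_2.
   For variables i and j (lambda and mu, or mu and lambda):
   :u:vw:: + \int_0^j :u[v_tau w]: + \int_0^i [u_sigma :vw:]
     + \int_0^i \int_0^j [u_sigma [v_tau w]]. *)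
Definition nested_int (i j : 'I_2) (u v w : V) : lpoly V 2 :=
  lC 2 (nop u (nop v w)) +
  lint0 (@lX F V 2 j) (lmap (nop u) (lbr v w)) +
  lint0 (@lX F V 2 i) (lbr u (nop v w)) +
  lprim i (lprim j (leval (fun=> lX j) (fun c => lat (@lX F V 2 i) (lbr u c))
                     (lbr v w))).

(* The integral of [u_sigma v] from - mu - d to lambda. *)
Definition bracket_int (u v : V) : lpoly V 2 :=
  lint0 (lX ord0) (lbr u v) - lint0 (fun x => - lX ord_max x - lmap d x) (lbr u v).

(* :Aw: + \int_0^(lambda + mu) [A_tau w], A = bracket_int u v *)
Definition bracket_nested_int (u v w : V) : lpoly V 2 :=
  lmap (nop^~ w) (bracket_int u v) +
  leval (@lX F V 2)
    (fun a => lint0 (fun x => lX ord0 x + lX ord_max x) (lbr a w))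
    (bracket_int u v).

Definition integral_jacobi : Prop :=
  forall p q u v w, has_parity G p u -> has_parity G q v ->
    nested_int ord0 ord_max u v w - (-1) ^+ (p && q) *: nested_int ord_max ord0 v u w
      - bracket_nested_int u v w = 0.

Record nonunital_vertex_algebra : Prop := NonunitalVertexAlgebra {
  nuva_linearl : forall v, linear (I^~ v);
  nuva_linearr : forall u, linear (I u);
  nuva_even : forall p q u v m, has_parity G p u -> has_parity G q v ->
    has_parity G (p (+) q) (lcoef m (I u v));
  nuva_dl : forall u v, lbr (d u) v = - lX ord0 (lbr u v);
  nuva_dr : forall u v, lbr u (d v) = lmap d (lbr u v) + lX ord0 (lbr u v);
  nuva_dnop : forall u v, d (nop u v) = nop (d u) v + nop u (d v);
  nuva_skew : forall p q u v, has_parity G p u -> has_parity G q v ->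
    I v u = (-1) ^+ (p && q) *: lat (fun x => - lX ord0 x - lmap d x) (I u v);
  nuva_jacobi : integral_jacobi }.

End VertexAlgebra.

(* Main.v *)
(* The function 1/z_21 (with z_21 = z_2 - z_1) generates F[z_12^{+-1}] under
   multiplication by z_12, differentiation and linear combinations, so a chiral
   map of two arguments is determined by its value there.  Conversely, write
   D = d/dlambda and let T act on brackets by replacing u with (d + lambda) u:
   then [D, T] = 1, and T D I = 0 for a bracket I satisfying axiom (ii), so
   that P(z_21) / z_21^(a+1) |-> P(D) T^a I / a! is well defined and chiral.

   For three arguments, partial fractions show that 1/(z_31 z_32) generates
   F[z_ij^{+-1}] together with its permutations; as X box X is chiral and
   symmetric, it vanishes if and only if it does at 1/(z_31 z_32).  There two of
   its three terms are nested integrals.  In the third one,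
   1/(z_31 z_32) = 1/z_21 (1/z_32 - 1/z_31), where 1/z_32 is killed by d/dz_1 and
   1/z_31 by d/dz_2; so the two summands substitute lambda and - mu - d in the
   integral of [u_sigma v], and yield its integral from - mu - d to lambda. *)

Require Import Defs.
From HB Require Import structures.
From mathcomp Require Import all_boot all_order all_fingroup all_algebra.
From mathcomp Require Import boolp classical_sets functions.
From mathcomp Require Import ring zify.
From mathcomp Require Import finmap monalg mpoly.

Set Implicit Arguments.
Unset Strict Implicit.
Unset Printing Implicit Defensive.

Import GRing.Theory.
Local Open Scope ring_scope.

Local Notation "{ 'mpoly' T [ n ] }" := (mpoly n T) : type_scope.
Local Notation "x %:F" := (@FracField.tofrac _ x) : ring_scope.

(** * Polynomials in the lambdas and their quotient *)

(** [comp1] rests on two choices, a factorization h = f g and a representative of a class modulo d +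
    lambda_1 + ... + lambda_n, and [rsubst] is meaningful only where no denominator vanishes. The
    remedy is to work with the functions regular along z_1 = z_2, on which setting z_2 = z_1 is a
    ring morphism. For a regular g, [ThetaQ] evaluates the composite, ignores the representative,
    and lets polynomial factors pass between f and g, so that the factorization is irrelevant too.
    Parities are fixed early. On homogeneous arguments a single term of the sum in [symact]
    survives, and for each parity vector p the map [boxp p] is chiral on all arguments, because its
    signs depend on p alone. Of the symmetry of X box X only the exchange of the last two arguments
    is used: it swaps 1/(z_31 z_32) and 1/(z_21 z_23), and these two generate everything. The sign
    (-1)^p(u) is precomposition with an involution, [parity_sign], so nothing is lost between a
    chiral map and its bracket. *)

Section LinearProp.
Variables (F : fieldType) (U W : lmodType F) (f : U -> W).
Hypothesis fL : linear f.

(** The records [chiral] and [nonunital_vertex_algebra] supply linearity as a proposition about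
    anonymous functions; these lemmas use it without bundling. *)
Lemma linpD : {morph f : x y / x + y}.
Proof. by move=> x y; have := fL 1 x y; rewrite !scale1r. Qed.

Lemma linp0 : f 0 = 0.
Proof. by apply: (addrI (f 0)); rewrite -linpD !addr0. Qed.

Lemma linpZ c : {morph f : x / c *: x}.
Proof. by move=> x; have := fL c x 0; rewrite linp0 !addr0. Qed.

Lemma linpN : {morph f : x / - x}.
Proof. by move=> x; rewrite -!scaleN1r linpZ. Qed.

Lemma linpB : {morph f : x y / x - y}.
Proof. by move=> x y; rewrite linpD linpN. Qed.

Lemma linp_sum (I : Type) (r : seq I) (P : pred I) (E : I -> U) :
  f (\sum_(i <- r | P i) E i) = \sum_(i <- r | P i) f (E i).
Proof. exact: (big_morph f linpD linp0). Qed.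

End LinearProp.

Section LPolyTheory.
Variables (F : fieldType) (V : lmodType F) (n : nat).
Implicit Types (x y : lpoly V n) (m k : 'X_{1..n}).

Lemma lcoef_is_linear m : linear (@lcoef F V n m).
Proof. by move=> c x y; rewrite lcoefD lcoefZ. Qed.
HB.instance Definition _ m :=
  GRing.isLinear.Build F (lpoly V n) V _ (@lcoef F V n m) (lcoef_is_linear m).
HB.instance Definition _ m :=
  GRing.isLinear.Build F V (lpoly V n) _ (@lmon F V n m) (@lmon_linear F V n m).
HB.instance Definition _ :=
  GRing.isLinear.Build F V (lpoly V n) _ (@lC F V n) (@lmon_linear F V n 0%MM).
HB.instance Definition _ i :=
  GRing.isLinear.Build F (lpoly V n) (lpoly V n) _ (@lX F V n i)
    (@lX_linear F V n i).
HB.instance Definition _ (W : lmodType F) (f : {linear V -> W}) :=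
  GRing.isLinear.Build F (lpoly V n) (lpoly W n) _ (lmap f) (@lmap_linear F V n W f).

Lemma lmulm_is_linear m : linear (@lmulm F V n m).
Proof. by apply: lsum_linear => k; apply: lmon_linear. Qed.
HB.instance Definition _ m :=
  GRing.isLinear.Build F (lpoly V n) (lpoly V n) _ (@lmulm F V n m)
    (lmulm_is_linear m).

Lemma lder_is_linear i : linear (@lder F V n i).
Proof.
apply: lsum_linear => m c x y.
by rewrite mulrnDl linearD /= scalerMnr linearZ.
Qed.
HB.instance Definition _ i :=
  GRing.isLinear.Build F (lpoly V n) (lpoly V n) _ (@lder F V n i)
    (lder_is_linear i).

Lemma lprim_is_linear i : linear (@lprim F V n i).
Proof.
apply: lsum_linear => m c x y.
by rewrite scalerDr linearD /= !scalerA mulrC -scalerA linearZ.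
Qed.
HB.instance Definition _ i :=
  GRing.isLinear.Build F (lpoly V n) (lpoly V n) _ (@lprim F V n i)
    (lprim_is_linear i).

Lemma lsum_mon (A : nmodType) (f : 'X_{1..n} -> V -> A) m v :
  (forall k, f k 0 = 0) -> lsum f (lmon m v) = f m v.
Proof.
move=> f0.
rewrite (@lsumEw _ _ _ _ _ [fset m]%fset) // ?big_seq_fset1; last first.
  by rewrite lmon.unlock; apply: monalg.msuppU_le.
by rewrite lcoef_mon eqxx.
Qed.

Lemma lpolyE x : x = lsum (fun m v => lmon m v) x.
Proof.
apply: lpolyP => m; rewrite lsum.unlock linear_sum /=.
under eq_bigr do rewrite lcoef_mon.
have [hm|hm] := boolP (m \in monalg.msupp x).
  rewrite (perm_big _ (perm_to_rem hm)) big_cons eqxx mulr1n.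
  rewrite big_seq big1 => [|i]; first exact/esym/addr0.
  by rewrite mem_rem_uniq ?fset_uniq // inE => /andP[/negbTE-> _].
rewrite big_seq big1 => [|i hi].
  by rewrite lcoef.unlock monalg.mcoeff_outdom.
by case: eqP => // e; rewrite -e hi in hm.
Qed.

Lemma lpoly_ind (P : lpoly V n -> Prop) :
  (forall x y, P x -> P y -> P (x + y)) -> (forall m v, P (lmon m v)) ->
  forall x, P x.
Proof.
move=> PD Pm x; rewrite (lpolyE x) lsum.unlock.
apply: (big_ind P) => [|y z hy hz|m _]; last exact: Pm.
  by rewrite -(linear0 (lmon 0%MM)); apply: Pm.
exact: PD.
Qed.

Lemma lX_mon i m (v : V) : lX i (lmon m v) = lmon (m + U_(i))%MM v.
Proof. by rewrite /lX /lmulm lsum_mon // => k; rewrite linear0. Qed.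

Lemma lmulm_mon k m (v : V) : lmulm k (lmon m v) = lmon (m + k)%MM v.
Proof. by rewrite /lmulm lsum_mon // => ?; rewrite linear0. Qed.

Lemma lder_mon i m (v : V) : lder i (lmon m v) = lmon (m - U_(i))%MM (v *+ m i).
Proof. by rewrite /lder lsum_mon // => ?; rewrite mul0rn linear0. Qed.

Lemma lprim_mon i m (v : V) :
  lprim i (lmon m v) = lmon (m + U_(i))%MM ((m i).+1%:R^-1 *: v).
Proof. by rewrite /lprim lsum_mon // => ?; rewrite scaler0 linear0. Qed.

Lemma lmap_mon (W : lmodType F) (f : {linear V -> W}) m v :
  lmap f (lmon m v) = lmon m (f v).
Proof. by rewrite /lmap lsum_mon // => k; rewrite linear0 (linp0 (@lmon_linear _ _ _ _)). Qed.

(** Operators on polynomials are mostly known by their values on constants and their commutation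
    with each lambda_i. The proof strips one variable from a monomial, by induction on the
    degree. *)
Lemma lpoly_indX (P : lpoly V n -> Prop) :
  (forall x y, P x -> P y -> P (x + y)) -> (forall v, P (lC n v)) ->
  (forall i x, P x -> P (lX i x)) -> forall x, P x.
Proof.
move=> PD PC PX; apply: lpoly_ind => // m.
move: {2}(mdeg m) (erefl (mdeg m)) => N; elim: N m => [|N IH] m hm v.
  by move/eqP: hm; rewrite mdeg_eq0 => /eqP->; apply: PC.
have [i hi] : exists i, (0 < m i)%N.
  apply: contrapT => /forallNP h; suff : mdeg m = 0%N by rewrite hm.
  rewrite mdegE big1 // => i _; move: (h i); case: (m i) => // k [] //.
have e : m = ((m - U_(i)) + U_(i))%MM.
  apply/mnmP => j; rewrite mnmDE mnmBE mnm1E; case: eqP => [<-|_] /=; lia.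
rewrite e -lX_mon; apply: PX; apply: IH.
by apply/eqP; rewrite -eqSS -hm {2}e mdegD mdeg1 addn1.
Qed.

Lemma lX_comm i j x : lX i (lX j x) = lX j (lX i x).
Proof.
elim/lpoly_ind: x => [x y hx hy|m v]; first by rewrite !linearD /= hx hy.
by rewrite !lX_mon -!addmA (addmC U_(j)%MM).
Qed.

Lemma lder_C i (v : V) : lder i (lC n v) = 0.
Proof. by rewrite lder_mon mnm0E mulr0n linear0. Qed.

(** The Weyl relation between d/d lambda_i and lambda_j; together with [lpoly_indX] it replaces
    computations with exponents. *)
Lemma lder_X i j x : lder i (lX j x) = lX j (lder i x) + x *+ (i == j).
Proof.
elim/lpoly_ind: x => [x y hx hy|m v].
  by rewrite !linearD /= hx hy mulrnDl addrACA.
rewrite lX_mon !lder_mon lX_mon mnmDE mnm1E [j == i]eq_sym.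
have [<-|ne] := eqVneq i j; last first.
  rewrite addr0 addn0; congr lmon.
  apply/mnmP => l; rewrite !(mnmDE, mnmBE, mnm1E).
  case: (eqVneq i l) => [<-|_] /=; last lia.
  by rewrite [j == i]eq_sym (negbTE ne) /=; lia.
rewrite addn1 mulrSr linearD /=; congr (_ + _).
  case E: (m i) => [|k]; first by rewrite !linear0.
  congr lmon; apply/mnmP => l; rewrite !(mnmDE, mnmBE, mnm1E).
  by case: eqP => [<-|_] /=; lia.
congr lmon; apply/mnmP => l; rewrite !(mnmDE, mnmBE, mnm1E).
by case: eqP => [<-|_] /=; lia.
Qed.

Lemma lder_comm i j x : lder i (lder j x) = lder j (lder i x).
Proof.
elim/lpoly_indX: x => [x y hx hy|v|k x hx]; first by rewrite !linearD /= hx hy.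
  by rewrite !lder_C !linear0.
by rewrite !lder_X !linearD /= !linearMn /= !lder_X hx addrAC.
Qed.

Lemma lmulmE m x : lmulm m x = foldr (fun i => iter (m i) (@lX F V n i)) x (enum 'I_n).
Proof.
have iterX i (e : nat) y : iter e (lX i) y = lmulm (U_(i) *+ e)%MM y.
  elim/lpoly_ind: y => [y z hy hz|l v].
    rewrite linearD /= -hy -hz; elim: e {hy hz} => //= e ->; exact: linearD.
  rewrite lmulm_mon; elim: e => [|e IH] /=; first by rewrite mulm0n addm0.
  by rewrite IH lX_mon -addmA mulmSr addmC.
have Hs s y : foldr (fun i => iter (m i) (@lX F V n i)) y s =
    lmulm (\sum_(i <- s) (U_(i) *+ m i))%MM y.
  elim: s => [|i s IH] /=.
    rewrite big_nil; elim/lpoly_ind: y => [y z hy hz|l v].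
      by rewrite linearD /= -hy -hz.
    by rewrite lmulm_mon addm0.
  rewrite IH iterX big_cons; elim/lpoly_ind: {IH} y => [y z hy hz|l v].
    by rewrite !linearD /= hy hz.
  by rewrite !lmulm_mon -addmA [X in (l + X)%MM]addmC.
rewrite Hs; congr lmulm; rewrite big_enum /=.
by rewrite -multinomUE_id.
Qed.

End LPolyTheory.

(** * Substitution of commuting operators for the lambdas *)

Section LevalTheory.
Variables (F : fieldType) (V M : lmodType F) (n : nat).
Variables (A : 'I_n -> M -> M) (phi : V -> M).
Hypothesis AL : forall i, linear (A i).
Hypothesis AC : forall i j x, A i (A j x) = A j (A i x).
Hypothesis phiL : linear phi.

Lemma linear_iter i k : linear (iter k (A i)).
Proof. by elim: k => [|k IH] c x y //=; rewrite IH AL. Qed.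

Lemma linear_foldr (m : 'X_{1..n}) s :
  linear (fun x => foldr (fun i => iter (m i) (A i)) x s).
Proof. by elim: s => [|i s IH] c x y //=; rewrite IH linear_iter. Qed.

Lemma leval_linear : linear (leval A phi : lpoly V n -> M).
Proof. by apply: lsum_linear => m c x y; rewrite phiL linear_foldr. Qed.

Lemma leval_mon m v :
  leval A phi (lmon m v) = foldr (fun i => iter (m i) (A i)) (phi v) (enum 'I_n).
Proof.
by rewrite /leval lsum_mon // => k; rewrite (linp0 phiL) (linp0 (linear_foldr _ _)).
Qed.

Lemma leval_C v : leval A phi (lC n v) = phi v.
Proof.
by rewrite leval_mon; elim: (enum 'I_n) => //= i s ->; rewrite mnm0E.
Qed.

(** [leval] applies the operators in the order of the enumeration, so A i reaches its place only by
    commuting past the others. *)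
Lemma leval_X i x : leval A phi (lX i x) = A i (leval A phi x).
Proof.
elim/lpoly_ind: x => [x y hx hy|m v].
  by rewrite linearD !(linpD leval_linear) hx hy (linpD (AL i)).
rewrite lX_mon !leval_mon.
have iterC j k x : A i (iter k (A j) x) = iter k (A j) (A i x).
  by elim: k => //= k <-; rewrite AC.
suff h s : foldr (fun j => iter ((m + U_(i))%MM j) (A j)) (phi v) s =
    iter (count_mem i s) (A i) (foldr (fun j => iter (m j) (A j)) (phi v) s).
  by rewrite h count_uniq_mem ?enum_uniq // mem_enum.
elim: s => //= j s ->; rewrite mnmDE mnm1E [i == j]eq_sym addnC iterD.
have iterCC k l x : iter k (A j) (iter l (A i) x) = iter l (A i) (iter k (A j) x).
  by elim: l => //= l IH; rewrite -iterC IH.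
by rewrite iterD iterCC; case: eqP => [->|].
Qed.

(** Universal property of V[lambda_1, ..., lambda_n] among modules with n commuting operators. *)
Lemma leval_unique (f : lpoly V n -> M) : linear f ->
  (forall v, f (lC n v) = phi v) -> (forall i x, f (lX i x) = A i (f x)) ->
  forall x, f x = leval A phi x.
Proof.
move=> fL fC fX; elim/lpoly_indX => [x y hx hy|v|i x hx].
- by rewrite (linpD fL) (linpD leval_linear) hx hy.
- by rewrite fC leval_C.
by rewrite fX leval_X hx.
Qed.

End LevalTheory.

(** The two maps need only agree on the coefficients of x, whose parity may be known when that of a
    general vector is not: this is where parity-dependent signs come out. *)
Lemma eq_leval_coef (F : fieldType) (V M : lmodType F) (n : nat)
    (A B : 'I_n -> M -> M) (phi psi : V -> M) (x : lpoly V n) :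
  (forall i y, A i y = B i y) -> (forall m, phi (lcoef m x) = psi (lcoef m x)) ->
  leval A phi x = leval B psi x.
Proof.
move=> AB h; rewrite /leval lsum.unlock; apply: eq_bigr => m _; rewrite h.
by elim: (enum 'I_n) => //= i s ->; elim: (m i) => //= k ->; rewrite AB.
Qed.

Lemma linear_comp (F : fieldType) (U V W : lmodType F) (f : V -> W) (g : U -> V) :
  linear f -> linear g -> linear (fun x => f (g x)).
Proof. by move=> fL gL c x y; rewrite gL fL. Qed.

Arguments lpi {F V} d {n} x.
Arguments ltot {F V} d {n} x.

(** * Operations on the quotient by d + lambda_1 + ... + lambda_n *)

Section LQuotTheory.
Variables (F : fieldType) (V : lmodType F) (d : {linear V -> V}) (n : nat).
Local Notation lX := (@lX F V n).
Implicit Types (x y : lpoly V n) (q r : lquot d n).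

Lemma lpi_is_linear : linear (@lpi F V d n).
Proof. by move=> c x y; rewrite lpiD -lqscale_pi. Qed.
HB.instance Definition _ :=
  GRing.isLinear.Build F (lpoly V n) (lquot d n) _ (@lpi F V d n) lpi_is_linear.

HB.instance Definition _ :=
  GRing.isLinear.Build F (lpoly V n) (lpoly V n) _ (@ltot F V d n)
    (@ltot_linear F V d n).

Lemma lpi_ltot x : lpi d (ltot d x) = 0.
Proof. by rewrite -(linear0 (lpi d)); apply/lpiP; exists x; rewrite subr0. Qed.

(** Operations on the quotient are defined through [lrepr]; a map that kills the image of [ltot]
    does not see which representative was chosen. *)
Lemma lrepr_pi (W : zmodType) (f : lpoly V n -> W) x :
  {morph f : x y / x - y} -> (forall y, f (ltot d y) = 0) ->
  f (lrepr (lpi d x)) = f x.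
Proof.
move=> fB f0; have /lpiP[z e] := lreprK (lpi d x).
by apply/eqP; rewrite -subr_eq0 -fB e f0.
Qed.

Lemma lpi_eq_out (f : lpoly V n -> lpoly V n) :
  linear f -> (forall y, lpi d (f (ltot d y)) = 0) ->
  forall x, lpi d (f (lrepr (lpi d x))) = lpi d (f x).
Proof.
move=> fL f0 x; apply: (lrepr_pi (f := fun y => lpi d (f y))) => // y z.
by rewrite (linpB fL) linearB.
Qed.

Lemma lmap_C (W : lmodType F) (f : {linear V -> W}) v :
  lmap f (lC n v) = lC n (f v).
Proof. exact: lmap_mon. Qed.

Lemma lmap_X (W : lmodType F) (f : {linear V -> W}) i x :
  lmap f (lX i x) = Defs.lX i (lmap f x).
Proof.
elim/lpoly_ind: x => [x y hx hy|m v]; first by rewrite !linearD /= hx hy.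
by rewrite lX_mon !lmap_mon lX_mon.
Qed.

Lemma lmap_lder (W : lmodType F) (f : {linear V -> W}) i x :
  lmap f (lder i x) = lder i (lmap f x).
Proof.
elim/lpoly_ind: x => [x y hx hy|m v]; first by rewrite !linearD /= hx hy.
by rewrite lder_mon !lmap_mon lder_mon linearMn.
Qed.

Lemma ltot_X i x : ltot d (lX i x) = lX i (ltot d x).
Proof.
rewrite /ltot lmap_X linearD /= linear_sum /=; congr (_ + _).
by apply: eq_bigr => j _; rewrite lX_comm.
Qed.

(** The correction x is the same for every i. A single partial derivative therefore does not descend
    to the quotient, but the difference of two does, as in the z_ij-axiom of chiral maps. *)
Lemma ltot_lder i x : lder i (ltot d x) = ltot d (lder i x) + x.
Proof.
rewrite /ltot linearD /= lmap_lder linear_sum /= -addrA; congr (_ + _).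
under eq_bigr do rewrite lder_X.
rewrite big_split /=; congr (_ + _).
rewrite (bigD1 i) //= eqxx big1 ?addr0 // => j /negbTE.
by rewrite eq_sym => ->.
Qed.

Lemma ltot_lmulm m x : ltot d (lmulm m x) = lmulm m (ltot d x).
Proof.
rewrite !lmulmE; elim: (enum 'I_n) => //= i s <-.
by elim: (m i) => //= k <-; rewrite ltot_X.
Qed.

Lemma lqmulm_pi m x : lqmulm m (lpi d x) = lpi d (lmulm m x).
Proof.
apply: (lpi_eq_out (f := lmulm m)) => [|y]; first exact: linearP.
by rewrite -ltot_lmulm lpi_ltot.
Qed.

Lemma lqmulm_is_linear m : linear (@lqmulm F V d n m).
Proof.
move=> c q r; rewrite -(lreprK q) -(lreprK r) -linearP !lqmulm_pi.
by rewrite -!linearP /= linearP.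
Qed.
HB.instance Definition _ m :=
  GRing.isLinear.Build F (lquot d n) (lquot d n) _ (@lqmulm F V d n m)
    (lqmulm_is_linear m).

Definition lqX (i : 'I_n) : lquot d n -> lquot d n := lqmulm U_(i)%MM.
HB.instance Definition _ i := GRing.Linear.on (lqX i).

Lemma lqX_pi i x : lqX i (lpi d x) = lpi d (lX i x).
Proof. exact: lqmulm_pi. Qed.

Definition lqC (v : V) : lquot d n := lpi d (lC n v).
Lemma lqC_is_linear : linear lqC.
Proof. by move=> c u v; rewrite /lqC !linearP. Qed.
HB.instance Definition _ :=
  GRing.isLinear.Build F V (lquot d n) _ lqC lqC_is_linear.

Lemma lquot_indX (P : lquot d n -> Prop) :
  (forall q r, P q -> P r -> P (q + r)) -> (forall v, P (lqC v)) ->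
  (forall i q, P q -> P (lqX i q)) -> forall q, P q.
Proof.
move=> PD PC PX q; rewrite -(lreprK q).
elim/lpoly_indX: (lrepr q) => [x y hx hy|v|i x hx].
- by rewrite linearD; apply: PD.
- exact: PC.
by rewrite -lqX_pi; apply: PX.
Qed.

Lemma lqX_comm i j q : lqX i (lqX j q) = lqX j (lqX i q).
Proof. by rewrite -(lreprK q) !lqX_pi lX_comm. Qed.

Lemma lmulm0 x : lmulm 0%MM x = x.
Proof.
elim/lpoly_ind: x => [x y hx hy|k v]; first by rewrite !linearD /= hx hy.
by rewrite lmulm_mon addm0.
Qed.

Lemma lqmulm0 q : lqmulm 0%MM q = q.
Proof. by rewrite -(lreprK q) lqmulm_pi lmulm0. Qed.

Lemma lmulmD m i x : lmulm (m + U_(i))%MM x = lX i (lmulm m x).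
Proof.
elim/lpoly_ind: x => [x y hx hy|k v]; first by rewrite !linearD /= hx hy.
by rewrite !lmulm_mon lX_mon addmA.
Qed.

Lemma lqmulmD m i q : lqmulm (m + U_(i))%MM q = lqX i (lqmulm m q).
Proof. by rewrite -(lreprK q) /lqX !lqmulm_pi lmulmD. Qed.

Lemma lqmulm_lqX m i q : lqmulm m (lqX i q) = lqX i (lqmulm m q).
Proof.
rewrite -(lreprK q) !(lqX_pi, lqmulm_pi); congr lpi.
elim/lpoly_ind: (lrepr q) => [x y hx hy|k v]; first by rewrite !linearD /= hx hy.
by rewrite !(lX_mon, lmulm_mon) -!addmA (addmC m).
Qed.

Lemma lqderB_pi j i x : lqderB j i (lpi d x) = lpi d (lder j x - lder i x).
Proof.
apply: (lpi_eq_out (f := fun y => lder j y - lder i y)) => [c y z|y].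
  by rewrite !lder_is_linear scalerBr opprD addrACA.
by rewrite !ltot_lder opprD addrACA subrr addr0 -linearB /= lpi_ltot.
Qed.

Lemma lqderB_is_linear j i : linear (@lqderB F V d n j i).
Proof.
move=> c q r; rewrite -(lreprK q) -(lreprK r) -linearP !lqderB_pi.
by rewrite -linearP !lder_is_linear scalerBr opprD addrACA.
Qed.
HB.instance Definition _ j i :=
  GRing.isLinear.Build F (lquot d n) (lquot d n) _ (@lqderB F V d n j i)
    (lqderB_is_linear j i).

Lemma lqderB_C j i v : lqderB j i (lqC v) = 0.
Proof. by rewrite lqderB_pi !lder_C subrr linear0. Qed.

Lemma lqderB_X j i k q :
  lqderB j i (lqX k q) = lqX k (lqderB j i q) + q *+ (j == k) - q *+ (i == k).
Proof.
rewrite -(lreprK q) lqX_pi !lqderB_pi lqX_pi !lder_X -!linearMn -linearD -linearB /=.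
congr lpi; rewrite (linearB (lX k)) /= -!addrA; congr (_ + _).
by rewrite addrCA opprD.
Qed.

Lemma lqC_d v : lqC (d v) = - \sum_i lqX i (lqC v).
Proof.
apply/eqP; rewrite -addr_eq0; apply/eqP.
under eq_bigr do rewrite lqX_pi.
by rewrite /lqC -(linear_sum (lpi d)) -(linearD (lpi d)) /= -lmap_C lpi_ltot.
Qed.

End LQuotTheory.

Arguments lqC {F V} d n v.

(** * Change of the lambda variables along a map of indices *)

Section Push.
Variables (F : fieldType) (V : lmodType F) (d : {linear V -> V}).

Section PushOne.
Variables (n k : nat) (tau : 'I_n -> 'I_k).

Let sumX_linear s : linear (fun x : lpoly V n => \sum_(i | tau i == s) lX i x).
Proof.
move=> c x y; rewrite scaler_sumr -big_split /=.
by apply: eq_bigr => i _; rewrite linearP.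
Qed.

Let sumX_comm s t (x : lpoly V n) :
  \sum_(i | tau i == s) lX i (\sum_(j | tau j == t) lX j x) =
  \sum_(j | tau j == t) lX j (\sum_(i | tau i == s) lX i x).
Proof.
under eq_bigr do rewrite linear_sum /=.
rewrite exchange_big /=; apply: eq_bigr => j _; rewrite linear_sum /=.
by apply: eq_bigr => i _; rewrite lX_comm.
Qed.

Lemma lpush_is_linear : linear (lpush tau : lpoly V k -> lpoly V n).
Proof. by apply: leval_linear => [s|]; [exact: sumX_linear | exact: linearP]. Qed.
HB.instance Definition _ :=
  GRing.isLinear.Build F (lpoly V k) (lpoly V n) _ (@lpush F V n k tau)
    lpush_is_linear.

Lemma lpush_C (v : V) : lpush tau (lC k v) = lC n v.
Proof. by apply: leval_C => [s|]; [exact: sumX_linear | exact: linearP]. Qed.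

Lemma lpush_X s (x : lpoly V k) :
  lpush tau (lX s x) = \sum_(i | tau i == s) lX i (lpush tau x).
Proof.
apply: (@leval_X _ _ _ _ (fun s x => \sum_(i | tau i == s) lX i x)) => //.
exact: linearP.
Qed.

Lemma lpush_lmap (x : lpoly V k) : lpush tau (lmap d x) = lmap d (lpush tau x).
Proof.
elim/lpoly_indX: x => [x y hx hy|v|i x hx]; first by rewrite !linearD /= hx hy.
  by rewrite lmap_C !lpush_C lmap_C.
rewrite lmap_X !lpush_X linear_sum /=; apply: eq_bigr => j _.
by rewrite lmap_X hx.
Qed.

Lemma lpush_lder i (x : lpoly V k) : lder i (lpush tau x) = lpush tau (lder (tau i) x).
Proof.
elim/lpoly_indX: x => [x y hx hy|v|j x hx]; first by rewrite !linearD /= hx hy.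
  by rewrite lpush_C !lder_C linear0.
rewrite lder_X linearD /= !lpush_X !linear_sum /=.
under eq_bigr do rewrite lder_X hx.
rewrite big_split /=; congr (_ + _); rewrite linearMn /=.
rewrite big_mkcond /= (bigD1 i) //= big1 => [|l /negbTE].
  by rewrite eqxx addr0; case: eqP.
by rewrite eq_sym => ->; rewrite if_same.
Qed.

(** The fibres of [tau] partition the indices, so the sum of all variables goes to the sum of all
    variables; hence the substitution descends to the quotients. *)
Lemma lpush_ltot (x : lpoly V k) : lpush tau (ltot d x) = ltot d (lpush tau x).
Proof.
rewrite /ltot linearD linear_sum /= lpush_lmap; congr (_ + _).
rewrite (partition_big tau xpredT) //=.
by apply: eq_bigr => s _; rewrite lpush_X.
Qed.

Lemma lqpush_pi (x : lpoly V k) : lqpush tau (lpi d x) = lpi d (lpush tau x).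
Proof.
apply: (lrepr_pi (f := fun y => lpi d (lpush tau y))) => [y z|y].
  by rewrite !linearB.
by rewrite lpush_ltot lpi_ltot.
Qed.

Lemma lqpush_is_linear : linear (lqpush tau : lquot d k -> lquot d n).
Proof.
by move=> c q r; rewrite -(lreprK q) -(lreprK r) -linearP !lqpush_pi !linearP.
Qed.
HB.instance Definition _ :=
  GRing.isLinear.Build F (lquot d k) (lquot d n) _ (@lqpush F V d n k tau)
    lqpush_is_linear.

Lemma lqpush_C v : lqpush tau (lqC d k v) = lqC d n v.
Proof. by rewrite lqpush_pi lpush_C. Qed.

Lemma lqpush_X s (q : lquot d k) :
  lqpush tau (lqX s q) = \sum_(i | tau i == s) lqX i (lqpush tau q).
Proof.
rewrite -(lreprK q) lqX_pi !lqpush_pi lpush_X linear_sum /=.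
by apply: eq_bigr => i _; rewrite lqX_pi.
Qed.

Lemma lqderB_push j i (q : lquot d k) :
  lqderB j i (lqpush tau q) = lqpush tau (lqderB (tau j) (tau i) q).
Proof.
rewrite -(lreprK q) !(lqpush_pi, lqderB_pi) !lpush_lder.
by rewrite (linearB (lpush tau)).
Qed.

End PushOne.

Lemma lqpush_comp n m k (tau : 'I_n -> 'I_m) (rho : 'I_m -> 'I_k) (q : lquot d k) :
  lqpush tau (lqpush rho q) = lqpush (rho \o tau) q.
Proof.
elim/lquot_indX: q => [q r hq hr|v|s q hq]; first by rewrite !linearD /= hq hr.
  by rewrite !lqpush_C.
rewrite !lqpush_X linear_sum /=.
under eq_bigr do rewrite lqpush_X hq.
rewrite [RHS](partition_big tau (fun j => rho j == s)) //=.
apply: eq_bigr => j /eqP hj; apply: eq_bigl => i.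
by case: eqP => [->|]; rewrite ?andbF // hj eqxx.
Qed.

Lemma lqpush_id n (tau : 'I_n -> 'I_n) (q : lquot d n) :
  tau =1 id -> lqpush tau q = q.
Proof.
move=> h; elim/lquot_indX: q => [q r hq hr|v|s q hq]; first by rewrite linearD /= hq hr.
  by rewrite lqpush_C.
rewrite lqpush_X (eq_bigl (pred1 s)) ?big_pred1_eq ?hq // => i.
by rewrite h.
Qed.

Lemma lqpush_bij n (tau rho : 'I_n -> 'I_n) s (q : lquot d n) :
  cancel rho tau -> lqpush tau (lqX s q) = lqX (rho s) (lqpush tau q).
Proof.
move=> c; rewrite lqpush_X (eq_bigl (pred1 (rho s))) ?big_pred1_eq // => i /=.
have c' : cancel tau rho.
  by apply: canF_sym c.
by rewrite -[in RHS](inj_eq (can_inj c')) c.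
Qed.

End Push.

Lemma lXd_linear (F : fieldType) (V : lmodType F) (d : {linear V -> V}) n (i : 'I_n) :
  linear (fun x : lpoly V n => - lX i x - lmap d x).
Proof.
move=> c x y; rewrite (linearP (lX i)) (linearP (lmap d)) /= !opprD.
by rewrite [LHS]addrACA scalerBr scalerN.
Qed.

(** * Normal form in the quotient *)

Section NormalForm.
Variables (F : fieldType) (V : lmodType F) (d : {linear V -> V}) (n : nat).

(* The isomorphism V[lambda_1, ..., lambda_n] ~ V[lambda_1, ..., lambda_(n+1)] / <d + sum>,
   with inverse [lqnorm]. *)
Definition lqlift (x : lpoly V n) : lquot d n.+1 :=
  leval (fun i => lqX (lift ord_max i)) (lqC d n.+1) x.

Let lqXL i : linear (@lqX F V d n.+1 (lift ord_max i)). Proof. exact: linearP. Qed.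
Let lqCL : linear (lqC d n.+1). Proof. exact: linearP. Qed.
Let lqXC i j (q : lquot d n.+1) :
  lqX (lift ord_max i) (lqX (lift ord_max j) q) =
  lqX (lift ord_max j) (lqX (lift ord_max i) q).
Proof. exact: lqX_comm. Qed.

Lemma lqlift_is_linear : linear lqlift.
Proof. exact: leval_linear. Qed.
HB.instance Definition _ :=
  GRing.isLinear.Build F (lpoly V n) (lquot d n.+1) _ lqlift lqlift_is_linear.

Lemma lqlift_C (v : V) : lqlift (lC n v) = lqC d n.+1 v.
Proof. exact: leval_C. Qed.

Lemma lqlift_X i x : lqlift (lX i x) = lqX (lift ord_max i) (lqlift x).
Proof. exact: (@leval_X _ _ _ _ (fun i => lqX (lift ord_max i))). Qed.

Lemma lqlift_d x : lqlift (lmap d x) = - \sum_i lqX i (lqlift x).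
Proof.
elim/lpoly_indX: x => [x y hx hy|v|i x hx].
- rewrite !linearD /= hx hy -opprD -big_split /=; congr (- _).
  by apply: eq_bigr => i _; rewrite linearD.
- by rewrite lmap_C !lqlift_C lqC_d.
rewrite lmap_X !lqlift_X hx linearN linear_sum /=; congr (- _).
by apply: eq_bigr => j _; rewrite lqX_comm.
Qed.

(** The last variable does not occur in a lifted polynomial, so subtracting the derivative along it
    changes nothing. *)
Lemma lqlift_lder i x : lqlift (lder i x) = lqderB (lift ord_max i) ord_max (lqlift x).
Proof.
elim/lpoly_indX: x => [x y hx hy|v|j x hx]; first by rewrite !linearD /= hx hy.
  by rewrite lder_C lqlift_C lqderB_C linear0.
rewrite lder_X lqlift_X linearD linearMn /= lqlift_X hx lqderB_X.
by rewrite (inj_eq lift_inj) (negbTE (neq_lift _ _)) subr0.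
Qed.

(** Elimination of the last variable, which equals minus d minus the sum of the others in the
    quotient. *)
Let A (i : 'I_n.+1) (x : lpoly V n) : lpoly V n :=
  if unlift ord_max i is Some j then lX j x else - \sum_j lX j x - lmap d x.

Let AL i : linear (A i).
Proof.
rewrite /A; case: unliftP => [j _|_] c x y; first exact: linearP.
under eq_bigr do rewrite linearP.
by rewrite big_split /= -scaler_sumr (linearP (lmap d)) /= !opprD [LHS]addrACA scalerBr scalerN.
Qed.

Let Alift j x : A (lift ord_max j) x = lX j x.
Proof. by rewrite /A liftK. Qed.

Let Amax x : A ord_max x = - \sum_j lX j x - lmap d x.
Proof. by rewrite /A unlift_none. Qed.

Let AX i j x : A i (lX j x) = lX j (A i x).
Proof.
rewrite /A; case: unliftP => [k _|_]; first exact: lX_comm.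
rewrite (linearB (lX j)) (linearN (lX j)) (linear_sum (lX j)) /= lmap_X; congr (- _ - _).
by apply: eq_bigr => k _; rewrite lX_comm.
Qed.

Let Ad i x : A i (lmap d x) = lmap d (A i x).
Proof.
rewrite /A; case: unliftP => [k _|_]; first by rewrite lmap_X.
rewrite (linearB (lmap d)) (linearN (lmap d)) (linear_sum (lmap d)) /=; congr (- _ - _).
by apply: eq_bigr => k _; rewrite lmap_X.
Qed.

Let AC i j x : A i (A j x) = A j (A i x).
Proof.
rewrite {2 3}/A; case: unliftP => [k _|_]; first exact: AX.
rewrite (linpB (AL i)) (linpN (AL i)) (linp_sum (AL i)) Ad; congr (- _ - _).
by apply: eq_bigr => k _; rewrite AX.
Qed.

Definition lqnorm (q : lquot d n.+1) : lpoly V n := leval A (@lC F V n) (lrepr q).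

Let CL : linear (@lC F V n). Proof. exact: linearP. Qed.

Lemma lqnorm_pi x : lqnorm (lpi d x) = leval A (@lC F V n) x.
Proof.
have evL := leval_linear AL CL; have evX := leval_X AL AC CL.
apply: (lrepr_pi (f := leval A (@lC F V n))) => [y z|y]; first exact: linpB.
have evd z : leval A (@lC F V n) (lmap d z) = lmap d (leval A (@lC F V n) z).
  elim/lpoly_indX: z => [z t hz ht|v|i z hz].
  - by rewrite !(linearD, linpD evL) hz ht.
  - by rewrite lmap_C !(leval_C AL CL) lmap_C.
  by rewrite lmap_X !evX hz Ad.
rewrite /ltot (linpD evL) (linp_sum evL) evd.
under eq_bigr do rewrite evX.
rewrite (bigD1_ord ord_max) //= Amax.
under eq_bigr do rewrite Alift.
by rewrite addrA addrCA subrr addr0 addNr.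
Qed.

Lemma lqnorm_is_linear : linear lqnorm.
Proof.
move=> c q r; rewrite -(lreprK q) -(lreprK r) -linearP !lqnorm_pi.
exact: leval_linear.
Qed.
HB.instance Definition _ :=
  GRing.isLinear.Build F (lquot d n.+1) (lpoly V n) _ lqnorm lqnorm_is_linear.

Lemma lqnorm_C (v : V) : lqnorm (lqC d n.+1 v) = lC n v.
Proof. by rewrite lqnorm_pi leval_C. Qed.

Lemma lqnorm_X i q : lqnorm (lqX (lift ord_max i) q) = lX i (lqnorm q).
Proof.
by rewrite -(lreprK q) lqX_pi !lqnorm_pi (leval_X AL AC CL) Alift.
Qed.

Lemma lqnorm_Xmax q : lqnorm (lqX ord_max q) = - \sum_j lX j (lqnorm q) - lmap d (lqnorm q).
Proof. by rewrite -(lreprK q) lqX_pi !lqnorm_pi (leval_X AL AC CL) Amax. Qed.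

Lemma lqliftK : cancel lqlift lqnorm.
Proof.
elim/lpoly_indX => [x y hx hy|v|i x hx]; first by rewrite !linearD /= hx hy.
  by rewrite lqlift_C lqnorm_C.
by rewrite lqlift_X lqnorm_X hx.
Qed.

Lemma lqnormK : cancel lqnorm lqlift.
Proof.
elim/lquot_indX => [q r hq hr|v|i q hq]; first by rewrite !linearD /= hq hr.
  by rewrite lqnorm_C lqlift_C.
case: (unliftP ord_max i) => [j ->|->]; first by rewrite lqnorm_X lqlift_X hq.
rewrite lqnorm_Xmax (linearB lqlift) (linearN lqlift) /= lqlift_d (linear_sum lqlift) /= opprK hq.
rewrite (bigD1_ord ord_max) //= addrCA.
under eq_bigr do rewrite lqlift_X hq.
by rewrite addNr addr0.
Qed.

End NormalForm.

Lemma lquot2_lpolyE (F : fieldType) (V : lmodType F) (d : {linear V -> V})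
    (q : lquot d 2) : lquot2_lpoly q = lqnorm q.
Proof.
apply: eq_leval_coef => // i y; case: unliftP => [j ->|->].
  by rewrite (ord1 j).
by rewrite big_ord1.
Qed.

(** * Rational functions and substitutions *)

(** With v = 1/z and c, e the constant first derivatives of z, the two sides are, up to sign, the
    mixed second derivatives of v in the two orders. *)
Lemma deriv_inv_id (R : comNzRingType) (c e v : R) :
  c * (- (e * (v * v)) * v + v * - (e * (v * v))) =
  e * (- (c * (v * v)) * v + v * - (c * (v * v))).
Proof. by ring. Qed.

(** * Localizations of the ring generated by the z_ij *)

Section RationalGenerators.
Variables (F : fieldType) (n : nat).
Implicit Types (f g : rfun F n) (i j k : 'I_n).

Lemma zdiff_neq0 i j : i != j -> zdiff F i j != 0 :> {fraction {mpoly F[n]}}.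
Proof.
move=> ij; rewrite tofrac_eq0 subr_eq0.
apply/eqP => /(congr1 (fun p : {mpoly F[n]} => p@_U_(i)%MM)).
rewrite !mcoeffX eqxx; case: eqP => [/mnmP/(_ i)|_ /eqP]; last by rewrite oner_eq0.
by rewrite !mnm1E eqxx eq_sym (negbTE ij).
Qed.

(** Induction on the generators: the derivatives of z_ij are constants, which settles z_ij and,
    through [deriv_inv_id], its inverse. *)
Lemma fderiv_comm i j (x : {fraction {mpoly F[n]}}) :
  x \in @OTpred F n -> fderiv i (fderiv j x) = fderiv j (fderiv i x).
Proof.
have d0 (k : 'I_n) : fderiv k 0 = 0 :> {fraction {mpoly F[n]}}.
  by rewrite -tofrac0 fderiv_poly mderiv0.
have dz (k l m : 'I_n) : exists c, fderiv k (zdiff F l m) = (c%:MP)%:F.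
  have dX e : exists c, 'X_e^`M(k) = c%:MP :> {mpoly F[n]}.
    rewrite mderivX mnm1E; case: eqP => [->|_]; last first.
      by exists 0; rewrite scale0r mpolyC0.
    exists 1; rewrite scale1r mpolyC1 -mpolyX0; congr 'X_[_].
    by apply/mnmP => a; rewrite mnmBE mnm0E subnn.
  have [c ec] := dX l; have [e ee] := dX m; exists (c - e).
  by rewrite /zdiff fderiv_poly mderivB ec ee mpolyCB.
have dC (k : 'I_n) (c : F) : fderiv k (c%:MP)%:F = 0 :> {fraction {mpoly F[n]}}.
  by rewrite fderiv_poly mderivC tofrac0.
have dN (k : 'I_n) (y : {fraction {mpoly F[n]}}) :
    fderiv k (- y) = - fderiv k y :> {fraction {mpoly F[n]}}.
  by apply/eqP; rewrite -addr_eq0 -fderivD addNr d0.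
move/OTpredP; elim=> {x} [c|l m _|l m lm|f g _ hf _ hg|f g _ hf _ hg].
- by rewrite !dC.
- by have [c ->] := dz j l m; have [e ->] := dz i l m; rewrite !dC.
- set z := zdiff F l m.
  have z0 : z != 0.
    by apply: zdiff_neq0; apply: contraTneq lm => ->; rewrite ltnn.
  have dV k : fderiv k z^-1 = - (fderiv k z * (z^-1 * z^-1)).
    have : fderiv k z * z^-1 + z * fderiv k z^-1 = 0.
      by rewrite -fderivM mulfV // -tofrac1 -mpolyC1 dC.
    move/eqP; rewrite addrC addr_eq0 => /eqP e; apply: (mulfI z0).
    by rewrite e mulrN mulrCA [z * _]mulrA mulfV // mul1r.
  have [c ec] := dz j l m; have [e ee] := dz i l m.
  have dCM (k : 'I_n) (a : F) y : fderiv k ((a%:MP)%:F * y) = (a%:MP)%:F * fderiv k y.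
    by rewrite fderivM dC mul0r add0r.
  rewrite !dV ec ee !dN !dCM !(fderivM _ z^-1) !dV ec ee.
  by congr (- _); apply: deriv_inv_id.
- by rewrite !fderivD hf hg.
rewrite (fderivM j) (fderivM i f) !fderivD (fderivM i f) (fderivM j f).
by rewrite (fderivM i (fderiv j f)) (fderivM j (fderiv i f)) hf hg; ring.
Qed.

Lemma rderiv_comm i j f : rderiv i (rderiv j f) = rderiv j (rderiv i f).
Proof. by apply: val_inj; rewrite /= fderiv_comm ?rvalP. Qed.

Lemma rderivM i f g : rderiv i (f * g) = rderiv i f * g + f * rderiv i g.
Proof. by apply: val_inj; rewrite /= fderivM. Qed.

Lemma rderivD i f g : rderiv i (f + g) = rderiv i f + rderiv i g.
Proof. by apply: val_inj; rewrite /= fderivD. Qed.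

Lemma rderiv_const i c : rderiv i (@rconst F n c) = 0.
Proof. by apply: val_inj; rewrite /= fderiv_poly mderivC tofrac0. Qed.

Lemma rderiv_is_linear i : linear (@rderiv F n i).
Proof.
by move=> c f g; rewrite rderivD rderivM rderiv_const mul0r add0r.
Qed.
HB.instance Definition _ i :=
  GRing.isLinear.Build F (rfun F n) (rfun F n) _ (@rderiv F n i)
    (rderiv_is_linear i).

Lemma rscaleE c f : c *: f = rconst n c * f. Proof. by []. Qed.

Lemma rconst1 : @rconst F n 1 = 1.
Proof. by apply: val_inj; rewrite /= mpolyC1 tofrac1. Qed.

Lemma rderiv_z i j k :
  rderiv i (rz F j k) = rconst n ((i == j)%:R - (i == k)%:R).
Proof.
apply: val_inj; rewrite /= fderiv_poly mderivB mpolyCB.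
have dX l : 'X_l^`M(i) = ((i == l)%:R)%:MP :> {mpoly F[n]}.
  rewrite mderivX mnm1E eq_sym; case: eqP => [->|_]; last first.
    by rewrite scale0r mpolyC0.
  rewrite scale1r mpolyC1 -mpolyX0; congr 'X_[_].
  by apply/mnmP => a; rewrite mnmBE mnm0E subnn.
by rewrite !dX.
Qed.

Lemma rzV i j : i != j -> rz F i j * rzinv F i j = 1.
Proof. by move=> ij; apply: val_inj; rewrite /= mulfV // zdiff_neq0. Qed.

Lemma rzN i j : rz F i j = - rz F j i.
Proof. by apply: val_inj; rewrite /= /zdiff -tofracN opprB. Qed.

Lemma rzinvN i j : rzinv F i j = - rzinv F j i.
Proof. by apply: val_inj; rewrite /= /zdiff -opprB tofracN invrN. Qed.

Lemma rzxx i : rz F i i = 0.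
Proof. by apply: val_inj; rewrite /= /zdiff subrr tofrac0. Qed.

Lemma rzD j i k : rz F i j + rz F j k = rz F i k.
Proof. by apply: val_inj; rewrite /= /zdiff -tofracD addrA subrK. Qed.

Lemma rderiv_zinv i j k : j != k ->
  rderiv i (rzinv F j k) = ((i == k)%:R - (i == j)%:R) *: (rzinv F j k * rzinv F j k).
Proof.
move=> jk; have h := rzV jk.
have : rderiv i (rz F j k * rzinv F j k) = 0 by rewrite h -rconst1 rderiv_const.
rewrite rderivM rderiv_z => /eqP; rewrite addr_eq0 => /eqP e.
rewrite -[LHS]mul1r -h -mulrA mulrC -mulrA [rderiv _ _ * _]mulrC.
have -> : rz F j k * rderiv i (rzinv F j k) =
  - (rconst n ((i == j)%:R - (i == k)%:R) * rzinv F j k) by rewrite e opprK.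
rewrite rscaleE -(opprB (i == j)%:R).
have -> (c : F) : rconst n (- c) = - rconst n c.
  by apply: val_inj; rewrite /= mpolyCN tofracN.
by rewrite mulrN mulNr mulrCA.
Qed.

(* The localization of F[z_ij] at the z_ij such that [K i j]. *)
Inductive rgen (K : rel 'I_n) : rfun F n -> Prop :=
  | RGconst c : rgen K (rconst n c)
  | RGz i j : rgen K (rz F i j)
  | RGzinv i j : K i j -> i != j -> rgen K (rzinv F i j)
  | RGadd f g : rgen K f -> rgen K g -> rgen K (f + g)
  | RGmul f g : rgen K f -> rgen K g -> rgen K (f * g).

Definition rdistinct : rel 'I_n := fun i j => i != j.

(** Turns the membership proof carried by an element of [rfun] into an induction principle on [rfun]
    itself. *)
Lemma rgen_all f : rgen rdistinct f.
Proof.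
case: f => f hf; have /OTpredP := hf; move: f hf => x hx h.
suff [g eg hg] : exists2 g : rfun F n, rval g = x & rgen rdistinct g.
  by have -> : Rfun hx = g by apply: val_inj.
elim: h => {x hx} [c|i j ij|i j ij|y z _ [f <- hf] _ [g <- hg]|y z _ [f <- hf] _ [g <- hg]].
- by exists (rconst n c) => //; apply: RGconst.
- by exists (rz F i j) => //; apply: RGz.
- exists (rzinv F i j) => //.
  by apply: RGzinv; rewrite /rdistinct; apply: contraTneq ij => ->; rewrite ltnn.
- by exists (f + g) => //; apply: RGadd.
by exists (f * g) => //; apply: RGmul.
Qed.

Lemma rgen_sub (K L : rel 'I_n) f : subrel K L -> rgen K f -> rgen L f.
Proof.
move=> KL; elim=> *; by [apply: RGconst|apply: RGz|apply: RGzinv; rewrite ?KL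
  |apply: RGadd|apply: RGmul].
Qed.

Variable K : rel 'I_n.

Lemma rgen0 : rgen K 0.
Proof.
have -> : 0 = rconst n 0 :> rfun F n; last exact: RGconst.
by apply: val_inj; rewrite /= mpolyC0 tofrac0.
Qed.

Lemma rgen1 : rgen K 1.
Proof. by rewrite -rconst1; apply: RGconst. Qed.

Lemma rgenN f : rgen K f -> rgen K (- f).
Proof.
move=> hf; have -> : - f = rconst n (-1) * f; last by apply: RGmul => //; apply: RGconst.
by rewrite -rscaleE scaleN1r.
Qed.

Lemma rgenZ c f : rgen K f -> rgen K (c *: f).
Proof. by move=> hf; apply: RGmul => //; apply: RGconst. Qed.

Lemma rgenX f (k : nat) : rgen K f -> rgen K (f ^+ k).
Proof. by move=> hf; elim: k => [|k IH]; [exact: rgen1|rewrite exprS; exact: RGmul]. Qed.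

Lemma rgen_deriv i f : rgen K f -> rgen K (rderiv i f).
Proof.
elim=> {f} [c|j k|j k jk nejk|f g hf Df hg Dg|f g hf Df hg Dg].
- by rewrite rderiv_const; apply: rgen0.
- by rewrite rderiv_z; apply: RGconst.
- by rewrite rderiv_zinv //; apply: rgenZ; apply: RGmul; apply: RGzinv.
- by rewrite rderivD; apply: RGadd.
by rewrite rderivM; apply: RGadd; apply: RGmul.
Qed.

End RationalGenerators.

Arguments rgen {F n} K f.

(** * Substitution of variables in rational functions *)

Section Substitution.
Variables (F : fieldType) (n k : nat) (tau : 'I_n -> 'I_k).
Implicit Types (f : rfun F n) (g : rfun F k).

(** The relation from which [rsubst] picks a value. It is visibly closed under sums and products,
    unlike a choice that defaults to 0. *)
Definition rsubst_rel f g : Prop := exists p q : {mpoly F[n]},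
  [/\ psubst tau q != 0, rval f = p%:F / q%:F
    & rval g = (psubst tau p)%:F / (psubst tau q)%:F].

Lemma rsubst_relE f g : rsubst_rel f g -> rsubst tau f = g.
Proof. by case=> p [q [q0 ef eg]]; apply: rsubstE ef eg. Qed.

Lemma psubst_neq0 (q : {mpoly F[n]}) : psubst tau q != 0 -> q != 0.
Proof. by apply: contra_neq => ->; rewrite /psubst rmorph0. Qed.

Lemma psubstX i : psubst tau 'X_i = 'X_(tau i) :> {mpoly F[k]}.
Proof. by rewrite /psubst comp_mpolyXU -tnth_nth tnth_mktuple. Qed.

Lemma psubst_XB i j :
  psubst tau ('X_i - 'X_j) = 'X_(tau i) - 'X_(tau j) :> {mpoly F[k]}.
Proof. by rewrite -!psubstX /psubst rmorphB. Qed.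

Lemma rsubst_rel_const (c : F) : rsubst_rel (rconst n c) (rconst k c).
Proof.
exists c%:MP, 1; rewrite /psubst rmorph1 oner_neq0 /= tofrac1 !divr1.
by rewrite comp_mpolyC.
Qed.

Lemma rsubst_rel_z i j : rsubst_rel (rz F i j) (rz F (tau i) (tau j)).
Proof.
exists ('X_i - 'X_j), 1; rewrite psubst_XB /psubst rmorph1 oner_neq0 /=.
by rewrite tofrac1 !divr1.
Qed.

Lemma rsubst_rel_zinv i j : tau i != tau j ->
  rsubst_rel (rzinv F i j) (rzinv F (tau i) (tau j)).
Proof.
move=> tij; exists 1, ('X_i - 'X_j).
rewrite psubst_XB /psubst !rmorph1 !div1r; split=> //.
by have := @zdiff_neq0 F k _ _ tij; rewrite tofrac_eq0.
Qed.

Lemma rsubst_rel_add f f' g g' :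
  rsubst_rel f g -> rsubst_rel f' g' -> rsubst_rel (f + f') (g + g').
Proof.
move=> [p [q [q0 ef eg]]] [p' [q' [q0' ef' eg']]].
have := psubst_neq0 q0; have := psubst_neq0 q0' => nq' nq.
exists (p * q' + p' * q), (q * q').
split; first by rewrite /psubst rmorphM mulf_neq0.
  by rewrite /= ef ef' fracD.
by rewrite /= eg eg' fracD // /psubst (rmorphD (comp_mpoly _)) !(rmorphM (comp_mpoly _)).
Qed.

Lemma rsubst_rel_mul f f' g g' :
  rsubst_rel f g -> rsubst_rel f' g' -> rsubst_rel (f * f') (g * g').
Proof.
move=> [p [q [q0 ef eg]]] [p' [q' [q0' ef' eg']]].
exists (p * p'), (q * q').
split; first by rewrite /psubst rmorphM mulf_neq0.
  by rewrite /= ef ef' fracM.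
by rewrite /= eg eg' fracM /psubst !(rmorphM (comp_mpoly _)).
Qed.

(** The z_ij that stay nonzero under [tau]. The localization at them is a domain on which [rsubst]
    is a ring morphism. *)
Definition rkeep : rel 'I_n := fun i j => tau i != tau j.

Lemma rsubst_genP f : rgen rkeep f -> rsubst_rel f (rsubst tau f).
Proof.
move=> h; suff [g hg] : exists g, rsubst_rel f g by rewrite (rsubst_relE hg).
elim: h => {f} [c|i j|i j ij _|f g _ [f' hf] _ [g' hg]|f g _ [f' hf] _ [g' hg]].
- by exists (rconst k c); apply: rsubst_rel_const.
- by exists (rz F (tau i) (tau j)); apply: rsubst_rel_z.
- by exists (rzinv F (tau i) (tau j)); apply: rsubst_rel_zinv.
- by exists (f' + g'); apply: rsubst_rel_add.
by exists (f' * g'); apply: rsubst_rel_mul.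
Qed.

Lemma rsubst_const (c : F) : rsubst tau (rconst n c) = rconst k c.
Proof. exact/rsubst_relE/rsubst_rel_const. Qed.

Lemma rsubst_z i j : rsubst tau (rz F i j) = rz F (tau i) (tau j).
Proof. exact/rsubst_relE/rsubst_rel_z. Qed.

Lemma rsubst_zinv i j : tau i != tau j ->
  rsubst tau (rzinv F i j) = rzinv F (tau i) (tau j).
Proof. by move=> h; apply/rsubst_relE/rsubst_rel_zinv. Qed.

Lemma rsubstD f (g : rfun F n) : rgen rkeep f -> rgen rkeep g ->
  rsubst tau (f + g) = rsubst tau f + rsubst tau g.
Proof.
by move=> hf hg; apply/rsubst_relE/rsubst_rel_add; apply: rsubst_genP.
Qed.

Lemma rsubstM f (g : rfun F n) : rgen rkeep f -> rgen rkeep g ->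
  rsubst tau (f * g) = rsubst tau f * rsubst tau g.
Proof.
by move=> hf hg; apply/rsubst_relE/rsubst_rel_mul; apply: rsubst_genP.
Qed.

Lemma rsubstZ c f : rgen rkeep f -> rsubst tau (c *: f) = c *: rsubst tau f.
Proof. by move=> hf; rewrite rscaleE rsubstM ?rsubst_const //; apply: RGconst. Qed.

Lemma rsubst1 : rsubst tau (1 : rfun F n) = 1.
Proof. by rewrite -rconst1 rsubst_const rconst1. Qed.

Lemma rsubst_gen (K : rel 'I_k) (L : rel 'I_n) f : subrel L rkeep ->
  (forall i j, L i j -> K (tau i) (tau j)) -> rgen L f -> rgen K (rsubst tau f).
Proof.
move=> LK hK; have sub := @rgen_sub _ _ L rkeep ^~ LK.
elim=> {f} [c|i j|i j ij ne|f g hf Hf hg Hg|f g hf Hf hg Hg].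
- by rewrite rsubst_const; apply: RGconst.
- by rewrite rsubst_z; apply: RGz.
- by rewrite rsubst_zinv; [apply: RGzinv; [exact: hK|exact: LK]|exact: LK].
- by rewrite rsubstD; [apply: RGadd|apply: sub..].
by rewrite rsubstM; [apply: RGmul|apply: sub..].
Qed.

(** Chain rule: z_s is substituted for every z_i with tau i = s. *)
Lemma rsubst_deriv s f : rgen rkeep f ->
  rderiv s (rsubst tau f) = \sum_(i | tau i == s) rsubst tau (rderiv i f).
Proof.
have sumE j : \sum_(i | tau i == s) (i == j)%:R = (s == tau j)%:R :> F.
  rewrite big_mkcond (bigD1 j) //= eqxx big1 ?addr0 => [|i /negbTE->].
    by rewrite eq_sym; case: eqP.
  by rewrite if_same.
have h0 : rsubst tau (0 : rfun F n) = 0.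
  by rewrite -(scale0r (1 : rfun F n)) rsubstZ ?scale0r //; apply: rgen1.
elim=> {f} [c|i j|i j ij ne|f g hf Hf hg Hg|f g hf Hf hg Hg].
- rewrite rsubst_const rderiv_const big1 // => i _.
  by rewrite rderiv_const h0.
- rewrite rsubst_z rderiv_z.
  under eq_bigr do rewrite rderiv_z rsubst_const -[rconst _ _]mulr1 -rscaleE.
  by rewrite -scaler_suml sumrB !sumE rscaleE mulr1.
- rewrite rsubst_zinv // rderiv_zinv //.
  have hz : rgen rkeep (rzinv F i j) by apply: RGzinv.
  have E l : rsubst tau (rderiv l (rzinv F i j)) = ((l == j)%:R - (l == i)%:R) *:
      (rzinv F (tau i) (tau j) * rzinv F (tau i) (tau j)).
    by rewrite rderiv_zinv // rsubstZ ?rsubstM ?rsubst_zinv //; apply: RGmul.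
  under eq_bigr do rewrite E.
  by rewrite -scaler_suml sumrB !sumE.
- rewrite rsubstD // rderivD Hf Hg -big_split; apply: eq_bigr => i _ /=.
  by rewrite rderivD rsubstD //; apply: rgen_deriv.
rewrite rsubstM // rderivM Hf Hg mulr_suml mulr_sumr -big_split.
apply: eq_bigr => i _ /=; rewrite rderivM rsubstD ?rsubstM //.
- exact: rgen_deriv.
- exact: rgen_deriv.
- by apply: RGmul => //; apply: rgen_deriv.
by apply: RGmul => //; apply: rgen_deriv.
Qed.

End Substitution.

Arguments rkeep {n k} tau.
Arguments rdistinct {n}.

Lemma rgen_inj (F : fieldType) n k (tau : 'I_n -> 'I_k) (f : rfun F n) :
  injective tau -> rgen (rkeep tau) f.
Proof.
move=> ti; apply: rgen_sub (rgen_all f) => i j.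
by rewrite /rdistinct /rkeep (inj_eq ti).
Qed.

Lemma rsubst_comp (F : fieldType) n m k (tau : 'I_n -> 'I_m) (rho : 'I_m -> 'I_k)
    (f : rfun F n) : rgen (rkeep (rho \o tau)) f ->
  rsubst rho (rsubst tau f) = rsubst (rho \o tau) f.
Proof.
have sub : subrel (rkeep (rho \o tau)) (rkeep tau).
  by move=> i j; apply: contra_neq => /= ->.
have K (g : rfun F n) : rgen (rkeep (rho \o tau)) g -> rgen (rkeep tau) g by apply: rgen_sub.
have L (g : rfun F n) : rgen (rkeep (rho \o tau)) g -> rgen (rkeep rho) (rsubst tau g).
  exact: rsubst_gen.
elim=> {f} [c|i j|i j ij ne|f1 g hf Hf hg Hg|f1 g hf Hf hg Hg].
- by rewrite !rsubst_const.
- by rewrite !rsubst_z.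
- by rewrite !rsubst_zinv //; apply: sub.
- by rewrite (rsubstD (K _ hf) (K _ hg)) (rsubstD (L _ hf) (L _ hg)) (rsubstD hf hg) Hf Hg.
by rewrite (rsubstM (K _ hf) (K _ hg)) (rsubstM (L _ hf) (L _ hg)) (rsubstM hf hg) Hf Hg.
Qed.

Lemma rsubst_id (F : fieldType) n (tau : 'I_n -> 'I_n) (f : rfun F n) :
  tau =1 id -> rsubst tau f = f.
Proof.
move=> /funext ->.
have K (g : rfun F n) : rgen (rkeep id) g by apply: rgen_inj.
elim: (rgen_all f) => {f} [c|i j|i j ij ne|f g _ hf _ hg|f g _ hf _ hg].
- by rewrite rsubst_const.
- by rewrite rsubst_z.
- by rewrite rsubst_zinv.
- by rewrite rsubstD // hf hg.
by rewrite rsubstM // hf hg.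
Qed.

(** Indices start at 0: z_1, z_2 have indices [p0], [p1] for two arguments, and z_1, z_2, z_3 have
    [o0], [o1], [o2] for three. *)
Notation p0 := (@ord0 1).
Notation p1 := (@ord_max 1).
Notation o0 := (@ord0 2).
Notation o1 := (@Ordinal 3 1 isT).
Notation o2 := (@ord_max 2).

Lemma ord2P (P : 'I_2 -> Prop) : P p0 -> P p1 -> forall i, P i.
Proof.
move=> h0 h1 [[|[|//]] hi]; first by have -> : Ordinal hi = p0 by apply: val_inj.
by have -> : Ordinal hi = p1 by apply: val_inj.
Qed.

Lemma ord3P (P : 'I_3 -> Prop) : P o0 -> P o1 -> P o2 -> forall i, P i.
Proof.
move=> h0 h1 h2 [[|[|[|//]]] hi].
- by have -> : Ordinal hi = o0 by apply: val_inj.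
- by have -> : Ordinal hi = o1 by apply: val_inj.
by have -> : Ordinal hi = o2 by apply: val_inj.
Qed.

Section RingIdentities.
Variable R : comNzRingType.
Implicit Types a b c e f g x y w xi yi wi : R.

Lemma derivX_id c a f e : f * (c * (a * e)) = c * (f * a * e).
Proof. by ring. Qed.

Lemma deriv_stable_id k a c f g :
  k * (a * (c * (f * f))) * g = k * (c * (f * (f * a) * g)).
Proof. by ring. Qed.

(** The relation 1/x + 1/w = (x + w)/(x w), with the inverses given by equations so that it applies
    in a ring such as [rfun]. *)
Lemma partial_fractions x y w xi yi wi : x * xi = 1 -> y * yi = 1 -> w * wi = 1 ->
  x + w = y -> xi * wi = (xi + wi) * yi.
Proof.
move=> xV yV wV e; rewrite -[LHS]mulr1 -yV -e.
transitivity ((x * xi) * wi * yi + xi * (w * wi) * yi); first by ring.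
by rewrite xV wV mul1r mulr1 -mulrDl addrC.
Qed.

Lemma partial_fractions_pow a b c xi yi wi :
  xi * wi = (xi + wi) * yi ->
  (xi * a) * b * (wi * c) = (xi * a) * (yi * b) * c + a * (yi * b) * (wi * c).
Proof.
move=> e; transitivity (a * b * c * (xi * wi)); first by ring.
by rewrite e; ring.
Qed.

Lemma merge_id a b c e x : (a + x * b) * (c + x * e) =
  a * c + x * (b * (c + x * e) + a * e).
Proof. by ring. Qed.

End RingIdentities.

Lemma big_ord2_cond (R : Type) (idx : R) (op : Monoid.law idx) (P : pred 'I_2)
    (E : 'I_2 -> R) : \big[op/idx]_(i | P i) E i =
  op (if P p0 then E p0 else idx) (if P p1 then E p1 else idx).
Proof.
rewrite big_mkcond !big_ord_recl big_ord0 Monoid.mulm1.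
by have -> : lift ord0 (ord0 : 'I_1) = p1 by apply: val_inj.
Qed.

Lemma big_ord3_cond (R : Type) (idx : R) (op : Monoid.law idx) (P : pred 'I_3)
    (E : 'I_3 -> R) : \big[op/idx]_(i | P i) E i =
  op (if P o0 then E o0 else idx)
    (op (if P o1 then E o1 else idx) (if P o2 then E o2 else idx)).
Proof.
rewrite big_mkcond !big_ord_recl big_ord0 Monoid.mulm1.
have -> : lift ord0 (ord0 : 'I_2) = o1 by apply: val_inj.
by have -> : lift ord0 (lift ord0 (ord0 : 'I_1)) = o2 by apply: val_inj.
Qed.

Definition rnone {n} : rel 'I_n := fun _ _ => false.

(** * Generation of rational functions by a few inverses *)

Section Generation.
Variables (F : fieldType) (n : nat).
Implicit Types (f g : rfun F n).

Lemma rgen_none (K : rel 'I_n) f : rgen rnone f -> rgen K f.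
Proof. exact: rgen_sub. Qed.

(** Z is a common denominator and W its inverse; the relation Z^k W^k = 1 brings the two terms of a
    sum to the same exponent. *)
Lemma rgen_frac (Z W : rfun F n) : rgen rnone Z -> Z * W = 1 ->
  (forall i j, i != j -> exists2 P, rgen rnone P & rzinv F i j = P * W) ->
  forall f, exists a P, rgen rnone P /\ f = P * W ^+ a.
Proof.
move=> hZ ZW hV f; elim: (rgen_all f) =>
  {f} [c|i j|i j ij _|f g _ [a [P [hP ->]]] _ [b [Q [hQ ->]]]
      |f g _ [a [P [hP ->]]] _ [b [Q [hQ ->]]]].
- by exists 0%N, (rconst n c); rewrite mulr1; split=> //; apply: RGconst.
- by exists 0%N, (rz F i j); rewrite mulr1; split=> //; apply: RGz.
- by have [P hP e] := hV i j ij; exists 1%N, P; rewrite expr1.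
- exists (a + b)%N, (P * Z ^+ b + Q * Z ^+ a); split.
    by apply: RGadd; apply: RGmul => //; apply: rgenX.
  have ZWk k : Z ^+ k * W ^+ k = 1 by rewrite -exprMn ZW expr1n.
  rewrite mulrDl exprD; congr (_ + _).
    by rewrite -mulrA (mulrCA (Z ^+ b)) ZWk mulr1.
  by rewrite -mulrA (mulrA (Z ^+ a)) ZWk mul1r.
exists (a + b)%N, (P * Q); split; first exact: RGmul.
by rewrite exprD mulrACA.
Qed.

Lemma rderivX i f k : rderiv i (f ^+ k.+1) = k.+1%:R *: (f ^+ k * rderiv i f).
Proof.
elim: k => [|k IH]; first by rewrite expr1 scale1r mul1r.
rewrite exprS rderivM IH -[in RHS]addn1 natrD scalerDl scale1r addrC mulrC.
congr (_ + _); last by rewrite mulrC.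
by rewrite mulrC !rscaleE derivX_id -exprS.
Qed.

Variable Q : rfun F n -> Prop.
Hypothesis QD : forall f g, Q f -> Q g -> Q (f + g).
Hypothesis QZ : forall c f, Q f -> Q (c *: f).
Hypothesis Qz : forall i j f, Q f -> Q (rz F i j * f).
Hypothesis Qd : forall i f, Q f -> Q (rderiv i f).

Lemma rgen_stable P f : rgen rnone P -> Q f -> Q (P * f).
Proof.
move=> hP; elim: hP f => {P} [c|i j|i j //|P R _ hP _ hR|P R _ hP _ hR] f hf.
- exact: QZ.
- exact: Qz.
- by rewrite mulrDl; apply: QD; [apply: hP|apply: hR].
by rewrite -mulrA; apply/hP/hR.
Qed.

Hypothesis charF0 : [pchar F] =i pred0.

(** Such an f behaves like the inverse of a linear form: differentiating f^(k+1) g gives (k+1) c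
    f^(k+2) g, and characteristic 0 allows division by (k+1) c. *)
Lemma deriv_stable i c f g k : c != 0 -> rderiv i f = c *: (f * f) ->
  rderiv i g = 0 -> Q (f * g) -> Q (f ^+ k.+1 * g).
Proof.
move=> c0 df dg hf; elim: k => [|k IH]; first by rewrite expr1.
have k0 : k.+1%:R != 0 :> F by rewrite (pcharf0P F).1.
have := QZ (k.+1%:R * c)^-1 (Qd i IH); rewrite rderivM dg mulr0 addr0 rderivX df.
have -> : k.+1%:R *: (f ^+ k * (c *: (f * f))) * g =
    (k.+1%:R * c) *: (f ^+ k.+2 * g).
  by rewrite -scalerA !rscaleE deriv_stable_id -!exprS.
by rewrite scalerA mulVf ?mulf_neq0 // scale1r.
Qed.

End Generation.

Section TwoVariables.
Variable F : fieldType.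
Hypothesis charF0 : [pchar F] =i pred0.

Lemma rfun2_frac (f : rfun F 2) :
  exists a P, rgen rnone P /\ f = P * rzinv F p1 p0 ^+ a.
Proof.
apply: (@rgen_frac _ _ (rz F p1 p0)); [exact: RGz|exact: rzV|move=> i j].
elim/ord2P: i; elim/ord2P: j => // _.
  by exists (-1); [apply: rgenN; apply: rgen1|rewrite mulN1r -rzinvN].
by exists 1; [apply: rgen1|rewrite mul1r].
Qed.

Lemma rfun2_ind (Q : rfun F 2 -> Prop) :
  (forall f g, Q f -> Q g -> Q (f + g)) -> (forall c f, Q f -> Q (c *: f)) ->
  (forall i j f, Q f -> Q (rz F i j * f)) -> (forall i f, Q f -> Q (rderiv i f)) ->
  Q (rzinv F p1 p0) -> forall f, Q f.
Proof.
move=> QD QZ Qz Qd Q1 f; have [a [P [hP ->]]] := rfun2_frac f.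
have Qk k : Q (rzinv F p1 p0 ^+ k.+1).
  rewrite -[_ ^+ _]mulr1.
  apply: (@deriv_stable _ _ Q QZ Qd charF0 p0 1); rewrite ?oner_neq0 ?mulr1 //.
    by rewrite rderiv_zinv //= subr0.
  by rewrite -rconst1 rderiv_const.
(* The pole order is raised by one, since only positive powers of the inverse have been reached. *)
have -> : P * rzinv F p1 p0 ^+ a = P * rz F p1 p0 * rzinv F p1 p0 ^+ a.+1.
  by rewrite exprS -!mulrA (mulrA (rz _ _ _)) rzV // mul1r.
by apply: rgen_stable => //; apply: RGmul => //; apply: RGz.
Qed.

End TwoVariables.

Section ThreeVariables.
Variable F : fieldType.

Local Notation x := (rz F o0 o1).
Local Notation y := (rz F o0 o2).
Local Notation w := (rz F o1 o2).
Local Notation xi := (rzinv F o0 o1).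
Local Notation yi := (rzinv F o0 o2).
Local Notation wi := (rzinv F o1 o2).

Let xV : x * xi = 1. Proof. exact: rzV. Qed.
Let yV : y * yi = 1. Proof. exact: rzV. Qed.
Let wV : w * wi = 1. Proof. exact: rzV. Qed.

Lemma rfun3_frac (f : rfun F 3) :
  exists a P, rgen rnone P /\ f = P * (xi * (yi * wi)) ^+ a.
Proof.
apply: (@rgen_frac _ _ (x * (y * w))).
- by apply: RGmul; [|apply: RGmul]; apply: RGz.
- by rewrite mulrACA xV mul1r mulrACA yV wV mul1r.
have hx : xi = y * w * (xi * (yi * wi)).
  by rewrite mulrCA mulrACA yV wV !mulr1.
have hy : yi = x * w * (xi * (yi * wi)).
  by rewrite mulrACA xV mul1r mulrCA wV mulr1.
have hw : wi = x * y * (xi * (yi * wi)).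
  by rewrite mulrACA xV mul1r mulrA yV mul1r.
move=> i j ij.
wlog : i j ij / (i < j)%N.
  move=> h; case: (ltngtP i j) => [|ji|/val_inj e]; first exact: h.
    have [|P hP e] := h _ _ _ ji; first by rewrite eq_sym.
    by exists (- P); [apply: rgenN|rewrite mulNr -e rzinvN].
  by rewrite e eqxx in ij.
elim/ord3P: i {ij}; elim/ord3P: j => // _.
- by exists (y * w) => //; apply: RGmul; apply: RGz.
- by exists (x * w) => //; apply: RGmul; apply: RGz.
by exists (x * y) => //; apply: RGmul; apply: RGz.
Qed.

(** Partial fractions produce the third product [xi * yi] from the two given ones. Powers of two
    inverses come from their product by differentiating along a variable on which only one of them
    depends. In xi^a yi^b wi^c, partial fractions lower a + c until a or c is 0. *)
Lemma rfun3_ind (Q : rfun F 3 -> Prop) : [pchar F] =i pred0 ->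
  (forall f g, Q f -> Q g -> Q (f + g)) -> (forall c f, Q f -> Q (c *: f)) ->
  (forall i j f, Q f -> Q (rz F i j * f)) -> (forall i f, Q f -> Q (rderiv i f)) ->
  Q (rzinv F o2 o0 * rzinv F o2 o1) -> Q (rzinv F o1 o0 * rzinv F o1 o2) ->
  forall f, Q f.
Proof.
move=> charF0 QD QZ Qz Qd; rewrite (rzinvN F o2 o0) (rzinvN F o2 o1) (rzinvN F o1 o0).
rewrite mulrNN mulNr => Qyw Qxw.
have pf : xi * wi = (xi + wi) * yi.
  exact: partial_fractions xV yV wV (rzD _ _ _ _).
have Qxy : Q (xi * yi).
  have -> : xi * yi = (-1) *: (- (xi * wi)) + (-1) *: (yi * wi).
    by rewrite !scaleN1r opprK pf mulrDl [wi * _]mulrC addrK.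
  by apply: QD; apply: QZ.
have powQ i j f g b c k l : b != 0 -> c != 0 ->
    rderiv i f = b *: (f * f) -> rderiv i g = 0 ->
    rderiv j g = c *: (g * g) -> rderiv j f = 0 ->
    Q (f * g) -> Q (f ^+ k.+1 * g ^+ l.+1).
  move=> b0 c0 df1 dg1 dg2 df2 h.
  apply: (@deriv_stable _ _ Q QZ Qd charF0 i b) => //.
    by rewrite rderivX dg1 mulr0 scaler0.
  rewrite mulrC; apply: (@deriv_stable _ _ Q QZ Qd charF0 j c) => //.
  by rewrite mulrC.
have QS := rgen_stable QD QZ Qz.
have Qxyk k l : Q (xi ^+ k.+1 * yi ^+ l.+1).
  apply: (powQ o1 o2 _ _ 1 1); rewrite ?oner_neq0 ?rderiv_zinv //= ?subr0 //.
    by rewrite ?(subrr, oppr0, scale0r).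
  by rewrite ?(subrr, oppr0, scale0r).
have Qywk k l : Q (yi ^+ k.+1 * wi ^+ l.+1).
  apply: (powQ o0 o1 _ _ (-1) (-1)); rewrite ?oppr_eq0 ?oner_neq0 ?rderiv_zinv //= ?sub0r //.
    by rewrite ?(subrr, oppr0, scale0r).
  by rewrite ?(subrr, oppr0, scale0r).
have Qall N a b c : (a + c <= N)%N -> Q (xi ^+ a * yi ^+ b * wi ^+ c).
  elim: N a b c => [|N IH] [|a] b [|c] // h.
  - have -> : xi ^+ 0 * yi ^+ b * wi ^+ 0 = x * y * (xi ^+ 1 * yi ^+ b.+1).
      by rewrite !expr0 expr1 mulr1 mul1r exprS mulrACA xV mul1r mulrA yV mul1r.
    by apply: QS => //; apply: RGmul; apply: RGz.
  - have -> : xi ^+ 0 * yi ^+ b * wi ^+ 0 = x * y * (xi ^+ 1 * yi ^+ b.+1).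
      by rewrite !expr0 expr1 mulr1 mul1r exprS mulrACA xV mul1r mulrA yV mul1r.
    by apply: QS => //; apply: RGmul; apply: RGz.
  - have -> : xi ^+ 0 * yi ^+ b * wi ^+ c.+1 = y * (yi ^+ b.+1 * wi ^+ c.+1).
      by rewrite expr0 mul1r (exprS yi) !mulrA yV mul1r.
    by apply: QS => //; apply: RGz.
  - have -> : xi ^+ a.+1 * yi ^+ b * wi ^+ 0 = y * (xi ^+ a.+1 * yi ^+ b.+1).
      by rewrite expr0 mulr1 (exprS yi) mulrCA [y * _]mulrA yV mul1r.
    by apply: QS => //; apply: RGz.
  have -> : xi ^+ a.+1 * yi ^+ b * wi ^+ c.+1 =
      xi ^+ a.+1 * yi ^+ b.+1 * wi ^+ c + xi ^+ a * yi ^+ b.+1 * wi ^+ c.+1.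
    by rewrite !exprS; apply: partial_fractions_pow.
  by apply: QD; apply: IH; lia.
move=> f; have [a [P [hP ->]]] := rfun3_frac f.
by rewrite !exprMn (mulrA (xi ^+ a)); apply: QS => //; apply: (Qall (a + a)%N).
Qed.

(** Sets z_2 = z_1 but stays in three variables, so that a polynomial can be compared with its
    restriction to the diagonal. *)
Definition merge01 (i : 'I_3) : 'I_3 := if i == o1 then o0 else i.

(** Division with remainder by z_12: each generator z_ij is congruent modulo z_12 to its substituted
    value. *)
Lemma rgen_merge01 (P : rfun F 3) : rgen rnone P ->
  exists2 P', rgen rnone P' & P = rsubst merge01 P + x * P'.
Proof.
have hz i : exists c, rz F i (merge01 i) = x * rconst 3 c.
  elim/ord3P: i; rewrite /merge01 /=.
  - by exists 0; rewrite rzxx -[rconst _ _]mulr1 -rscaleE scale0r mulr0.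
  - exists (-1); rewrite rzN -[rconst _ _]mulr1 -rscaleE scaleN1r mulrN1.
    by [].
  - by exists 0; rewrite rzxx -[rconst _ _]mulr1 -rscaleE scale0r mulr0.
have K (g : rfun F 3) : rgen rnone g -> rgen (rkeep merge01) g by apply: rgen_none.
elim=> {P} [c|i j|i j //|P R hP [P' hP' eP] hR [R' hR' eR]|P R hP [P' hP' eP] hR [R' hR' eR]].
- by exists 0; [apply: rgen0|rewrite rsubst_const mulr0 addr0].
- have [c ec] := hz i; have [e ee] := hz j.
  exists (rconst 3 c - rconst 3 e).
    by apply: RGadd; [|apply: rgenN]; apply: RGconst.
  rewrite rsubst_z mulrBr -ec -ee (rzN F j).
  by rewrite opprK addrCA !rzD.
- exists (P' + R'); first exact: RGadd.
  by rewrite rsubstD ?mulrDr; [rewrite {1}eP {1}eR addrACA|apply: K..].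
exists (P' * R + rsubst merge01 P * R').
  by apply: RGadd; apply: RGmul => //; apply: rsubst_gen hP.
rewrite rsubstM; [|exact: K..].
rewrite {1}eP; move: eR; set r := rsubst _ R; set p := rsubst _ P => eR.
by rewrite {1 2}eR merge_id.
Qed.

End ThreeVariables.

(** [cl] merges the two inner slots of a composite into the first outer slot, [sh] embeds the inner
    variables, and [reg] is regularity along z_1 = z_2. *)
Notation cl := (@collapse 2 1 : 'I_3 -> 'I_2).
Notation sh := (@lshift 2 1 : 'I_2 -> 'I_3).
Notation reg := (rgen (rkeep cl)).

Lemma lshift12_0 : lshift 1 p0 = o0. Proof. exact: val_inj. Qed.
Lemma lshift12_1 : lshift 1 p1 = o1. Proof. exact: val_inj. Qed.
Lemma rshift21 j : rshift 2 j = o2 :> 'I_3.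
Proof. by apply: val_inj; rewrite /= (ord1 j). Qed.

Lemma cl0 : cl o0 = p0.
Proof. by rewrite -lshift12_0 /collapse (unsplitK (inl p0 : 'I_2 + 'I_1)). Qed.
Lemma cl1 : cl o1 = p0.
Proof. by rewrite -lshift12_1 /collapse (unsplitK (inl p1 : 'I_2 + 'I_1)). Qed.
Lemma cl2 : cl o2 = p1.
Proof.
rewrite -(rshift21 ord0) /collapse (unsplitK (inr ord0 : 'I_2 + 'I_1)).
exact: val_inj.
Qed.
Definition clE := (cl0, cl1, cl2).

(** * Regularity along z_1 = z_2 and the chosen factorization *)

Section Factor.
Variable F : fieldType.

Local Notation xi := (rzinv F o0 o1).
Local Notation yi := (rzinv F o0 o2).
Local Notation wi := (rzinv F o1 o2).

Lemma rsubstX n k (tau : 'I_n -> 'I_k) (f : rfun F n) e : rgen (rkeep tau) f ->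
  rsubst tau (f ^+ e) = rsubst tau f ^+ e.
Proof.
move=> hf; elim: e => [|e IH]; first by rewrite rsubst1.
by rewrite !exprS rsubstM ?IH //; apply: rgenX.
Qed.

Lemma rgen_yw k : rgen (rkeep cl) ((yi * wi) ^+ k).
Proof.
by apply: rgenX; apply: RGmul; apply: RGzinv => //; rewrite /rkeep !clE.
Qed.

Lemma rval_gen n (P : rfun F n) : rgen rnone P -> exists p : {mpoly F[n]}, rval P = p%:F.
Proof.
elim=> {P} [c|i j|i j //|f g _ [p ef] _ [q eg]|f g _ [p ef] _ [q eg]].
- by exists c%:MP.
- by exists ('X_i - 'X_j).
- by exists (p + q); rewrite /= ef eg (tofracD p).
by exists (p * q); rewrite /= ef eg (tofracM p).
Qed.

(** Writing g as p/q and clearing denominators, the diagonal kills the side that contains z_12,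
    while q survives there; so the numerator of P must vanish. *)
Lemma rsubst0_no_pole (P R g : rfun F 3) : rgen rnone P -> rgen rnone R ->
  P = rz F o0 o1 * R * g -> no_pole o0 o1 g -> rsubst merge01 P = 0.
Proof.
move=> hP hR e [p [q [q0 eg]]].
have nq : q != 0 by apply: psubst_neq0 q0.
have K (f : rfun F 3) : rgen rnone f -> rgen (rkeep merge01) f by apply: rgen_none.
have [s [t [t0 es et]]] := rsubst_genP (K _ hP).
have nt : t != 0 by apply: psubst_neq0 t0.
have [r er] := rval_gen hR.
apply: val_inj; rewrite /= et.
suff -> : psubst merge01 s = 0 by rewrite tofrac0 mul0r.
have : s%:F / t%:F = ((('X_o0 - 'X_o1) * r) * p)%:F / q%:F.
  rewrite -es e /= er eg /zdiff (tofracM _ p) (tofracM _ r) mulrA.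
  by [].
move/(frac_eq _ _ nt nq)/(congr1 (psubst merge01)).
have sM (a b : {mpoly F[3]}) : psubst merge01 (a * b) = psubst merge01 a * psubst merge01 b.
  by rewrite /psubst rmorphM.
rewrite !sM psubst_XB subrr !mul0r => /eqP.
by rewrite mulf_eq0 (negbTE q0) orbF => /eqP.
Qed.

(** Lowers the pole order one step at a time: a numerator that vanishes on the diagonal is a
    multiple of z_12. *)
Lemma rgen_no_pole (g : rfun F 3) : no_pole o0 o1 g -> rgen (rkeep cl) g.
Proof.
move=> ng; have [a [P [hP]]] := rfun3_frac g.
(* Only the exponent of 1/z_12 varies in the induction; the other two inverses keep the exponent
   [a]. *)
rewrite exprMn; elim: {1}a P hP => [|e IH] P hP eg.
  rewrite eg expr0 mul1r; apply: RGmul; last exact: rgen_yw.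
  exact: rgen_none.
have [P' hP' eP] := rgen_merge01 hP.
have V : rz F o0 o1 * xi = 1 by apply: rzV.
have Vyw : (rz F o0 o2 * rz F o1 o2) ^+ a * (yi * wi) ^+ a = 1.
  by rewrite -exprMn mulrACA !rzV // mul1r expr1n.
have e0 : rsubst merge01 P = 0.
  apply: (rsubst0_no_pole (R := rz F o0 o1 ^+ e * (rz F o0 o2 * rz F o1 o2) ^+ a) hP _ _ ng).
    by apply: RGmul; apply: rgenX; [|apply: RGmul]; apply: RGz.
  by rewrite mulrA -exprS eg mulrCA mulrACA -exprMn V expr1n mul1r Vyw mulr1.
apply: IH hP' _; rewrite eg eP e0 add0r exprS.
by rewrite -(mulrA xi) mulrACA V mul1r.
Qed.

Lemma factorP (h : rfun F (2 + 1)) :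
  h = rsubst (lshift 1) (factor h).1 * (factor h).2 /\
  rgen (rkeep cl) (factor h).2.
Proof.
rewrite /factor; case: xgetP => [fg _ [e np]|hn].
  split=> //; apply: rgen_no_pole; rewrite -lshift12_0 -lshift12_1; exact: np.
exfalso; have [a [P [hP eh]]] := @rfun3_frac F h.
(* The whole pole along z_1 = z_2 goes into the first factor; this excludes the default value of
   [factor]. *)
apply: (hn (rzinv F p0 p1 ^+ a, P * (yi * wi) ^+ a)); split.
  rewrite /= rsubstX; last exact/rgen_inj/lshift_inj.
  rewrite rsubst_zinv // lshift12_0 lshift12_1 eh exprMn mulrCA.
  by [].
move=> i j ij.
have [-> ->] : i = p0 /\ j = p1 by move: ij; elim/ord2P: i; elim/ord2P: j.
rewrite lshift12_0 lshift12_1.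
have hK : rgen (rkeep merge01) (P * (yi * wi) ^+ a).
  apply: RGmul; first exact: rgen_none.
  by apply: rgenX; apply: RGmul; apply: RGzinv.
have [p [q [q0 e _]]] := rsubst_genP hK.
by exists p, q; split; [exact: q0|exact: e].
Qed.

End Factor.

(** * Composition of chiral maps *)

(** Written as a lookup in a sequence to match the arguments of X in [int_bracket]. *)
Definition pairV {V : zmodType} (u v : V) : 'I_2 -> V := fun i => [:: u; v]`_i.
Definition tripV {V : zmodType} (u v w : V) : 'I_3 -> V := fun i => [:: u; v; w]`_i.

Lemma pairVE (V : zmodType) (v : 'I_2 -> V) : v = pairV (v p0) (v p1).
Proof. by apply: funext; elim/ord2P. Qed.

Lemma tripVE (V : zmodType) (v : 'I_3 -> V) : v = tripV (v o0) (v o1) (v o2).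
Proof. by apply: funext; elim/ord3P. Qed.

Lemma sh_eq i j : (sh i == sh j :> 'I_3) = (i == j).
Proof. exact: (inj_eq (@lshift_inj _ _)). Qed.

Section BinaryChiral.
Variables (F : fieldType) (V : lmodType F) (d : {linear V -> V}).
Variables (X : chmap d 2) (hX : chiral X).
Implicit Types (u v : V) (f : rfun F 2).

Lemma upd_pairV0 u v w : upd (pairV u v) p0 w = pairV w v.
Proof. by apply: funext; elim/ord2P. Qed.

Lemma upd_pairV1 u v w : upd (pairV u v) p1 w = pairV u w.
Proof. by apply: funext; elim/ord2P. Qed.

Lemma chiral2_linl v f : linear (fun u => X (pairV u v) f).
Proof.
move=> c u w; have := chiral_linear hX (pairV 0 v) p0 f c u w.
by rewrite !upd_pairV0.
Qed.

Lemma chiral2_linr u f : linear (fun v => X (pairV u v) f).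
Proof.
move=> c v w; have := chiral_linear hX (pairV u 0) p1 f c v w.
by rewrite !upd_pairV1.
Qed.

Lemma chiral2_dl u v f :
  X (pairV (d u) v) f = X (pairV u v) (rderiv p0 f) - lqX p0 (X (pairV u v) f).
Proof.
have := chiral_sesquilinear hX (pairV u v) p0 f; rewrite upd_pairV0 => <-.
by rewrite addrK.
Qed.

Lemma chiral2_dr u v f :
  X (pairV u (d v)) f = X (pairV u v) (rderiv p1 f) - lqX p1 (X (pairV u v) f).
Proof.
have := chiral_sesquilinear hX (pairV u v) p1 f; rewrite upd_pairV1 => <-.
by rewrite addrK.
Qed.

End BinaryChiral.

(** * Evaluation of a composite on regular functions *)

Section Theta.
Variables (F : fieldType) (V : lmodType F) (d : {linear V -> V}).
Variables (Y : chmap d 2) (hY : chiral Y).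
Local Notation M := (rfun F 3 -> lquot d 3).
Implicit Types (Phi : M) (g : rfun F 3) (u v : V).

Lemma addM Phi Psi g : (Phi + Psi) g = Phi g + Psi g. Proof. by []. Qed.

(** Linearity is claimed on regular functions only, where [rsubst cl] is known to be a ring
    morphism. *)
Definition reg_linear Phi : Prop :=
  forall c f g, reg f -> reg g -> Phi (c *: f + g) = c *: Phi f + Phi g.

Lemma reg_linearD Phi f g : reg_linear Phi -> reg f -> reg g ->
  Phi (f + g) = Phi f + Phi g.
Proof. by move=> h hf hg; have := h 1 f g hf hg; rewrite !scale1r. Qed.

Lemma reg_linear0 Phi : reg_linear Phi -> Phi 0 = 0.
Proof.
move=> h; have r0 : reg (0 : rfun F 3) by apply: rgen0.
by apply: (addrI (Phi 0)); rewrite -(reg_linearD h) // !addr0.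
Qed.

Lemma reg_linearZ Phi c f : reg_linear Phi -> reg f -> Phi (c *: f) = c *: Phi f.
Proof.
move=> h hf; have r0 : reg (0 : rfun F 3) by apply: rgen0.
by have := h c f 0 hf r0; rewrite !addr0 reg_linear0 // addr0.
Qed.

(* Multiplication by [lambda_i - d/dz_i] in [arrow], transported to the
   functions on which the result is evaluated. *)
Definition delta (i : 'I_3) Phi : M := fun g => lqX i (Phi g) - Phi (rderiv i g).

Lemma delta_linear i : linear (delta i).
Proof.
move=> c Phi Psi; apply: funext => g.
rewrite /delta -[LHS]/(lqX i (c *: Phi g + Psi g) - (c *: Phi (rderiv i g) + Psi (rderiv i g))).
by rewrite linearP opprD addrACA -scalerBr.
Qed.

Lemma delta_comm i j Phi : delta i (delta j Phi) = delta j (delta i Phi).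
Proof.
apply: funext => g; rewrite /delta !linearB /= lqX_comm rderiv_comm.
by rewrite addrACA.
Qed.

Lemma reg_linear_delta i Phi : reg_linear Phi -> reg_linear (delta i Phi).
Proof.
move=> h c f g hf hg; rewrite /delta h // (linearP (rderiv i)) /= h; [|exact: rgen_deriv..].
by rewrite linearP opprD addrACA -scalerBr.
Qed.

Definition theta v u : M := fun g => lqpush cl (Y (pairV u v) (rsubst cl g)).

Lemma theta_linear v : linear (theta v).
Proof.
move=> c u w; apply: funext => g; rewrite /theta (chiral2_linl hY).
exact: linearP.
Qed.

Lemma reg_linear_theta v u : reg_linear (theta v u).
Proof.
move=> c f g hf hg; rewrite /theta rsubstD ?rsubstZ ?(chiral_linear_fun hY) //.
  exact: linearP.
exact: rgenZ.
Qed.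

(* If x represents X(v_1, v_2; f), then [Theta v3 x g] is (Y o_1 X)(v_1, v_2, v3; f g). *)
Definition Theta v (x : lpoly V 2) : M :=
  leval (fun i => delta (sh i)) (theta v) x.

Let deltaL (i : 'I_2) : linear (delta (sh i)). Proof. exact: delta_linear. Qed.
Let deltaC (i j : 'I_2) Phi :
  delta (sh i) (delta (sh j) Phi) =
  delta (sh j) (delta (sh i) Phi).
Proof. exact: delta_comm. Qed.

Lemma Theta_is_linear v : linear (Theta v).
Proof. by apply: leval_linear; [exact: deltaL|exact: theta_linear]. Qed.

Lemma Theta_C v u : Theta v (lC 2 u) = theta v u.
Proof. exact: leval_C deltaL (theta_linear v) u. Qed.

Lemma Theta_X v i x : Theta v (lX i x) = delta (sh i) (Theta v x).
Proof. exact: leval_X deltaL deltaC (theta_linear v) i x. Qed.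

Lemma reg_linear_Theta v x : reg_linear (Theta v x).
Proof.
elim/lpoly_indX: x => [x y hx hy|u|i x hx].
- rewrite (linpD (Theta_is_linear v)) => c f g hf hg.
  by rewrite !addM hx // hy // addrACA -scalerDr.
- by rewrite Theta_C; apply: reg_linear_theta.
by rewrite Theta_X; apply: reg_linear_delta.
Qed.

Lemma cl_rderiv (f : rfun F 3) : reg f ->
  rderiv p0 (rsubst cl f) = rsubst cl (rderiv o0 f) + rsubst cl (rderiv o1 f).
Proof.
move=> hf; rewrite rsubst_deriv // big_ord3_cond /=.
by rewrite !clE /= addr0.
Qed.

Lemma cl_rderiv1 (f : rfun F 3) : reg f -> rderiv p1 (rsubst cl f) = rsubst cl (rderiv o2 f).
Proof.
move=> hf; rewrite rsubst_deriv // big_ord3_cond /=.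
by rewrite !clE /= !add0r.
Qed.

Lemma cl_lqX0 (q : lquot d 2) : lqpush cl (lqX p0 q) =
  lqX o0 (lqpush cl q) + lqX o1 (lqpush cl q).
Proof.
rewrite lqpush_X big_ord3_cond /=.
by rewrite !clE /= addr0.
Qed.

Lemma cl_lqX1 (q : lquot d 2) : lqpush cl (lqX p1 q) = lqX o2 (lqpush cl q).
Proof.
rewrite lqpush_X big_ord3_cond /=.
by rewrite !clE /= !add0r.
Qed.

(** On constants this is sesquilinearity of Y in its first slot, whose derivative and whose lambda
    become sums over the two merged indices. The commuting operators [delta] carry it to all
    polynomials. *)
Lemma Theta_d v x g : reg g ->
  Theta v (lmap d x) g = - (delta o0 (Theta v x) g + delta o1 (Theta v x) g).
Proof.
elim/lpoly_indX: x g => [x y hx hy|u|i x hx] g hg.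
- rewrite linearD !(linpD (Theta_is_linear v)) !(linpD (delta_linear _)) /=.
  by rewrite !addM hx // hy // -opprD addrACA.
- rewrite lmap_C !Theta_C {1}/theta (chiral2_dl hY) cl_rderiv //.
  rewrite (linpD (chiral_linear_fun hY _)) linearB linearD /= cl_lqX0.
  by rewrite /delta addrACA -opprD opprB.
rewrite lmap_X !Theta_X {1}/delta hx // hx; last exact: rgen_deriv.
rewrite (delta_comm o0) (delta_comm o1) [in RHS]/delta linearN linearD /=.
by rewrite -opprD [in X in - (X) = _]opprD addrACA.
Qed.

(** By [Theta_d], d acts as minus the sum of the actions of lambda_1 and lambda_2; this is the
    independence from the representative. *)
Lemma Theta_ltot v x g : reg g -> Theta v (ltot d x) g = 0.
Proof.
move=> hg; rewrite /ltot !big_ord_recl big_ord0 addr0.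
have -> : lift ord0 (ord0 : 'I_1) = p1 by apply: val_inj.
rewrite !(linpD (Theta_is_linear v)) !Theta_X lshift12_0 lshift12_1.
by rewrite !addM Theta_d // addNr.
Qed.

Definition ThetaQ v (q : lquot d 2) g : lquot d 3 := Theta v (lrepr q) g.

Lemma ThetaQ_pi v x g : reg g -> ThetaQ v (lpi d x) g = Theta v x g.
Proof.
move=> hg; apply: (lrepr_pi (f := fun x => Theta v x g)) => [y z|y].
  by rewrite (linpB (Theta_is_linear v)).
exact: Theta_ltot.
Qed.

Lemma ThetaQ_linear v g : reg g -> linear (fun q => ThetaQ v q g).
Proof.
move=> hg c q r; rewrite -(lreprK q) -(lreprK r) -linearP !ThetaQ_pi //.
by rewrite (Theta_is_linear v).
Qed.

Lemma ThetaQ_reg_linear v q : reg_linear (ThetaQ v q).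
Proof. exact: reg_linear_Theta. Qed.

Lemma ThetaQ_C v u g : reg g ->
  ThetaQ v (lqC d 2 u) g = lqpush cl (Y (pairV u v) (rsubst cl g)).
Proof. by move=> hg; rewrite ThetaQ_pi // Theta_C. Qed.

Lemma ThetaQ_X v (i : 'I_2) q g : reg g -> ThetaQ v (lqX i q) g =
  lqX (sh i) (ThetaQ v q g) - ThetaQ v q (rderiv (sh i) g).
Proof. by move=> hg; rewrite -{1}(lreprK q) lqX_pi ThetaQ_pi // Theta_X. Qed.

Lemma reg_zM (i j : 'I_3) g : reg g -> reg (rz F i j * g).
Proof. by move=> hg; apply: RGmul => //; apply: RGz. Qed.

Lemma rderiv_zM i j k g : rderiv i (rz F j k * g) =
  ((i == j)%:R - (i == k)%:R) *: g + rz F j k * rderiv i g.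
Proof. by rewrite rderivM rderiv_z. Qed.

(** Both sides vanish on constants, because z_12 collapses to 0. The induction matches the Leibniz
    rule for z_ij with the Weyl relation for lambda_k. *)
Lemma ThetaQ_z v (i j : 'I_2) q g : reg g ->
  ThetaQ v q (rz F (sh i) (sh j) * g) = ThetaQ v (lqderB j i q) g.
Proof.
elim/lquot_indX: q g => [q r hq hr|u|k q hq] g hg.
- rewrite linearD !(linpD (ThetaQ_linear v _)) ?hq ?hr //; exact: reg_zM.
- rewrite lqderB_C (linp0 (ThetaQ_linear v hg)) ThetaQ_C; last exact: reg_zM.
  rewrite rsubstM ?rsubst_z //; last exact: RGz.
  have -> : cl (sh i) = cl (sh j).
    by elim/ord2P: i; elim/ord2P: j; rewrite !(lshift12_0, lshift12_1, clE).
  by rewrite rzxx mul0r (linp0 (chiral_linear_fun hY _)) linear0.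
have hd := rgen_deriv (sh k) hg.
rewrite ThetaQ_X; last exact: reg_zM.
rewrite hq // rderiv_zM ThetaQ_reg_linear ?hq //; last exact: reg_zM.
rewrite lqderB_X (linpB (ThetaQ_linear v hg)) (linpD (ThetaQ_linear v hg)) ThetaQ_X //.
rewrite !sh_eq -!scaler_nat !(linpZ (ThetaQ_linear v hg)).
rewrite opprD addrA addrAC scalerBl opprB -[RHS]addrA; congr (_ + _).
by rewrite ![k == _]eq_sym.
Qed.

(** On constants this is the z_ij-axiom of Y pulled back along [cl]; in the induction both sides
    pick up the same correction, when k = i. *)
Lemma ThetaQ_z2 v (i : 'I_2) q g : reg g ->
  ThetaQ v q (rz F (sh i) o2 * g) = lqderB o2 (sh i) (ThetaQ v q g).
Proof.
elim/lquot_indX: q g => [q r hq hr|u|k q hq] g hg.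
- rewrite !(linpD (ThetaQ_linear v _)) ?hq ?hr ?linearD //; exact: reg_zM.
- rewrite !ThetaQ_C //; last exact: reg_zM.
  rewrite rsubstM ?rsubst_z //; last exact: RGz.
  by rewrite (chiral_mulz hY) lqderB_push.
have hd := rgen_deriv (sh k) hg.
rewrite !ThetaQ_X //; last exact: reg_zM.
rewrite hq // rderiv_zM ThetaQ_reg_linear ?hq //; last exact: reg_zM.
rewrite linearB /= lqderB_X.
have n2 : (sh k == o2) = false.
  by elim/ord2P: k {hq hd}; rewrite !(lshift12_0, lshift12_1).
rewrite [o2 == _]eq_sym n2 subr0 mulr0n addr0 opprD addrA; congr (_ - _ - _).
by rewrite -scaler_nat [sh i == _]eq_sym.
Qed.

Lemma ThetaQ_dv v q g : reg g ->
  ThetaQ (d v) q g + lqX o2 (ThetaQ v q g) = ThetaQ v q (rderiv o2 g).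
Proof.
elim/lquot_indX: q g => [q r hq hr|u|k q hq] g hg.
- have hd := rgen_deriv o2 hg.
  by rewrite !(linpD (ThetaQ_linear _ _)) // linearD addrACA hq // hr.
- have hd := rgen_deriv o2 hg.
  by rewrite !ThetaQ_C // (chiral2_dr hY) linearB /= cl_lqX1 subrK cl_rderiv1.
have hd := rgen_deriv o2 hg; have hd' := rgen_deriv (sh k) hg.
rewrite !ThetaQ_X // linearB /= lqX_comm addrACA -linearD hq //= -opprD hq //.
by rewrite rderiv_comm.
Qed.

Lemma ThetaQ_linv q g : reg g -> linear (fun v => ThetaQ v q g).
Proof.
elim/lquot_indX: q g => [q r hq hr|u|k q hq] g hg c v w.
- by rewrite !(linpD (ThetaQ_linear _ _)) // hq // hr // scalerDr addrACA.
- by rewrite !ThetaQ_C // (chiral2_linr hY); apply: linearP.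
have hd := rgen_deriv (sh k) hg.
by rewrite !ThetaQ_X // hq // hq // linearP opprD addrACA -scalerBr.
Qed.

End Theta.

(** * The arrow operation, transposed to evaluation maps *)

Section Arrow.
Variables (F : fieldType) (V : lmodType F) (d : {linear V -> V}).
Local Notation M := (rfun F 3 -> lquot d 3).
Implicit Types (Phi : M) (g : rfun F 3).

Definition lreg (x : lpoly (rfun F 3) 3) : Prop := forall m, reg (lcoef m x).

Lemma lreg_mon m g : reg g -> lreg (lmon m g).
Proof.
by move=> hg k; rewrite lcoef_mon; case: (m == k); [exact: hg|exact: rgen0].
Qed.

Lemma lregD x y : lreg x -> lreg y -> lreg (x + y).
Proof. by move=> hx hy m; rewrite lcoefD; apply: RGadd. Qed.

Lemma lreg_ind (P : lpoly (rfun F 3) 3 -> Prop) :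
  (forall x y, lreg x -> lreg y -> P x -> P y -> P (x + y)) ->
  (forall m g, reg g -> P (lmon m g)) -> forall x, lreg x -> P x.
Proof.
move=> PD Pm x hx; suff : lreg x /\ P x by case.
have h0 : reg (0 : rfun F 3) by apply: rgen0.
rewrite {-1}(lpolyE x) {1}(lpolyE x) lsum.unlock.
apply: (big_ind (fun y => lreg y /\ P y)) => [|y z [? ?] [? ?]|m _].
- by rewrite -(linear0 (lmon 0%MM)); split; [apply: lreg_mon|apply: Pm].
- by split; [apply: lregD|apply: PD].
by split; [apply: lreg_mon|apply: Pm].
Qed.

Definition arrow_sum Phi (x : lpoly (rfun F 3) 3) : lquot d 3 :=
  lsum (fun k g => lqmulm k (Phi g)) x.

Lemma arrow_sumD Phi x y : reg_linear Phi -> lreg x -> lreg y ->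
  arrow_sum Phi (x + y) = arrow_sum Phi x + arrow_sum Phi y.
Proof.
move=> hP hx hy; have f0 m : lqmulm m (Phi 0) = 0 by rewrite reg_linear0 // linear0.
pose D := fsetU (monalg.msupp x)
  (fsetU (monalg.msupp y) (monalg.msupp (x + y))).
have sx : fsubset (monalg.msupp x) D by rewrite fsubsetUl.
have sy : fsubset (monalg.msupp y) D.
  by rewrite fsubsetU // fsubsetUl orbT.
have sz : fsubset (monalg.msupp (x + y)) D.
  by rewrite fsubsetU // fsubsetUr orbT.
rewrite /arrow_sum (lsumEw f0 sx) (lsumEw f0 sy) (lsumEw f0 sz) -big_split /=.
by apply: eq_bigr => m _; rewrite lcoefD reg_linearD // linearD.
Qed.

Lemma arrow_sum_mon Phi m g : reg_linear Phi ->
  arrow_sum Phi (lmon m g) = lqmulm m (Phi g).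
Proof.
by move=> hP; rewrite /arrow_sum lsum_mon // => k; rewrite reg_linear0 // linear0.
Qed.

Definition arrow_op (i : 'I_3) (x : lpoly (rfun F 3) 3) : lpoly (rfun F 3) 3 :=
  lX i x - lmap (rderiv i) x.

Lemma arrow_op_mon i m g :
  arrow_op i (lmon m g) = lmon (m + U_(i))%MM g + lmon m (- rderiv i g).
Proof. by rewrite /arrow_op lX_mon lmap_mon linearN. Qed.

Lemma arrow_opD i : {morph arrow_op i : x y / x + y}.
Proof. move=> x y; rewrite /arrow_op (linearD (lX i)) [lmap (rderiv i) (x + y)]linearD.
by rewrite /= opprD addrACA. Qed.

Lemma lreg_arrow_op i x : lreg x -> lreg (arrow_op i x).
Proof.
elim/lreg_ind => {x} [x y _ _ hx hy|m g hg].
  by rewrite arrow_opD; apply: lregD.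
rewrite arrow_op_mon; apply: lregD; apply: lreg_mon => //.
by apply: rgenN; apply: rgen_deriv.
Qed.

(** Applying lambda_i - d/dz_i to the argument amounts to applying [delta i] to the map that is
    summed; this turns the recursion in [arrow] into the substitution that defines [Theta]. *)
Lemma arrow_sum_op Phi i x : reg_linear Phi -> lreg x ->
  arrow_sum Phi (arrow_op i x) = arrow_sum (delta i Phi) x.
Proof.
move=> hP; elim/lreg_ind => {x} [x y rx ry hx hy|m g hg].
  rewrite arrow_opD (arrow_sumD hP (lreg_arrow_op i rx) (lreg_arrow_op i ry)).
  by rewrite hx hy (arrow_sumD (reg_linear_delta i hP) rx ry).
have hd : reg (rderiv i g) by apply: rgen_deriv.
have hP' := reg_linear_delta i hP.
rewrite arrow_op_mon arrow_sumD ?arrow_sum_mon //; last 2 first.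
- exact: lreg_mon.
- by apply: lreg_mon; apply: rgenN.
rewrite lqmulmD -scaleN1r reg_linearZ // scaleN1r /delta linearB linearN /=.
by rewrite lqmulm_lqX.
Qed.

Lemma arrow_sum_iter Phi i e x : reg_linear Phi -> lreg x ->
  [/\ lreg (iter e (arrow_op i) x), reg_linear (iter e (delta i) Phi)
    & arrow_sum Phi (iter e (arrow_op i) x) = arrow_sum (iter e (delta i) Phi) x].
Proof.
elim: e Phi => [|e IH] Phi hP hx //=.
have [h1 h2 h3] := IH Phi hP hx; have [_ _ h4] := IH _ (reg_linear_delta i hP) hx.
split; [exact: lreg_arrow_op|exact: reg_linear_delta|].
by rewrite arrow_sum_op // h4 -iterSr.
Qed.

Lemma arrow_sum_foldr Phi (a : 'X_{1..2}) s x : reg_linear Phi -> lreg x ->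
  lreg (foldr (fun i => iter (a i) (arrow_op (sh i))) x s) /\
  arrow_sum Phi (foldr (fun i => iter (a i) (arrow_op (sh i))) x s) =
  arrow_sum (foldr (fun i => iter (a i) (delta (sh i))) Phi s) x.
Proof.
move=> + hx; elim: s Phi => [|i s IH] Phi hP //=.
have [h1 _] := IH Phi hP.
have [h2 h3 h4] := arrow_sum_iter (sh i) (a i) hP h1; split=> //.
rewrite h4; have [_ ->] := IH _ h3; congr (arrow_sum _ _).
(* Transposition reverses the order of the operators; they commute. *)
elim: s {IH h1 h2 h4} => //= j s ->.
elim: (a i) => //= k <-; elim: (a j) => //= l ->.
by rewrite delta_comm.
Qed.

Lemma arrow_sum_arrow Phi (a : 'X_{1..2}) g : reg_linear Phi -> reg g ->
  arrow_sum Phi (arrow a g) =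
  foldr (fun i => iter (a i) (delta (sh i))) Phi (enum 'I_2) g.
Proof.
move=> hP hg; have [_ ->] := arrow_sum_foldr a (enum 'I_2) hP (lreg_mon 0%MM hg).
rewrite arrow_sum_mon ?lqmulm0 //.
elim: (enum 'I_2) => //= i s IH; elim: (a i) => //= k; exact: reg_linear_delta.
Qed.

End Arrow.

Section Composition.
Variables (F : fieldType) (V : lmodType F) (d : {linear V -> V}).
Variables (Y X : chmap d 2) (hY : chiral Y) (hX : chiral X).
Implicit Types (v : 'I_3 -> V) (g h : rfun F 3) (f : rfun F 2).

Local Notation C := (@comp1 F V d 2 1 Y X : chmap d 3).
Local Notation fac h := (@factor F 2 1 h).
Local Notation Xv v f := (X (pairV (v o0) (v o1)) f).

Lemma comp1E v h :
  C v h = ThetaQ Y (v o2) (Xv v (fac h).1) (fac h).2.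
Proof.
have [_ hg] := factorP h; rewrite /comp1; case: (fac h) hg => f g /= hg.
have -> : (fun i => v (sh i)) = pairV (v o0) (v o1).
  by rewrite (pairVE (fun i => _)) lshift12_0 lshift12_1.
rewrite /ThetaQ /Theta /leval !lsum.unlock fct_sumE; apply: eq_bigr => a _.
rewrite -(arrow_sum_arrow a (reg_linear_theta hY (v o2) _) hg) /arrow_sum !lsum.unlock.
apply: eq_bigr => k _; congr (lqmulm k (lqpush cl (Y _ _))).
apply: funext => s; elim/ord2P: s; first by rewrite unlift_none.
have -> : p1 = lift ord0 ord0 by apply: val_inj.
by rewrite liftK rshift21.
Qed.

End Composition.

(** * The composite is well defined and chiral *)

Section CompositionChiral.
Variables (F : fieldType) (V : lmodType F) (d : {linear V -> V}).
Variables (Y X : chmap d 2) (hY : chiral Y) (hX : chiral X).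
Implicit Types (v : 'I_3 -> V) (g h : rfun F 3) (f : rfun F 2).

Local Notation C := (@comp1 F V d 2 1 Y X : chmap d 3).
Local Notation Xv v f := (X (pairV (v o0) (v o1)) f).
Local Notation Th v f g := (ThetaQ Y (v o2) (Xv v f) g).

Let shK f : rgen (rkeep sh) f. Proof. exact/rgen_inj/lshift_inj. Qed.

Lemma reg_sh (P : rfun F 2) : rgen rnone P -> reg (rsubst sh P).
Proof. by move=> hP; apply: rgen_none; apply: rsubst_gen hP. Qed.

(** A polynomial in the inner variables acts on the class of X by its z_ij-axiom, and on the regular
    factor by [ThetaQ_z], with the same result. *)
Lemma ThetaQ_move v (P : rfun F 2) f g : rgen rnone P -> reg g ->
  Th v (P * f) g = Th v f (rsubst sh P * g).
Proof.
move=> hP; elim: hP f g => {P} [c|i j|i j //|P R rP hP rR hR|P R rP hP rR hR] f g hg.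
- rewrite rsubst_const -!rscaleE (linpZ (chiral_linear_fun hX _)).
  by rewrite (linpZ (ThetaQ_linear hY _ hg)) (reg_linearZ _ (ThetaQ_reg_linear hY _ _)).
- by rewrite rsubst_z (ThetaQ_z hY) // (chiral_mulz hX).
- rewrite rsubstD // !mulrDl (linpD (chiral_linear_fun hX _)).
  rewrite (linpD (ThetaQ_linear hY _ hg)) hP // hR //.
  by rewrite (reg_linearD (ThetaQ_reg_linear hY _ _)) //; apply: RGmul => //; apply: reg_sh.
rewrite rsubstM // -!mulrA hP // hR //; first by rewrite mulrCA.
by apply: RGmul => //; apply: reg_sh.
Qed.

(** Both singular factors are polynomials times one power t of 1/z_21. Once the polynomials are
    moved to the regular side, the singular factors are equal, and cancelling the invertible t
    identifies the regular ones. *)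
Lemma ThetaQ_factor v f g f' g' : reg g -> reg g' ->
  rsubst sh f * g = rsubst sh f' * g' -> Th v f g = Th v f' g'.
Proof.
move=> hg hg' e; have [a [P [hP ef]]] := rfun2_frac f.
have [b [Q [hQ ef']]] := rfun2_frac f'.
pose t := rzinv F p1 p0 ^+ (a + b).
pose P' := P * rz F p1 p0 ^+ b; pose Q' := Q * rz F p1 p0 ^+ a.
have zk k : rgen rnone (rz F p1 p0 ^+ k) by apply: rgenX; apply: RGz.
have hP' : rgen rnone P' by apply: RGmul.
have hQ' : rgen rnone Q' by apply: RGmul.
have zV k : rz F p1 p0 ^+ k * rzinv F p1 p0 ^+ k = 1.
  by rewrite -exprMn rzV // expr1n.
have e1 : f = P' * t.
  by rewrite ef /P' /t addnC exprD -mulrA (mulrA (_ ^+ b)) zV mul1r.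
have e2 : f' = Q' * t by rewrite ef' /Q' /t exprD -mulrA (mulrA (_ ^+ a)) zV mul1r.
rewrite e1 e2 !ThetaQ_move //; congr ThetaQ.
have zt : rsubst sh (rz F p1 p0 ^+ (a + b)) * rsubst sh t = 1.
  by rewrite -rsubstM // zV rsubst1.
move: (rsubst sh (rz F p1 p0 ^+ _)) zt => z zt.
have zK (r k : rfun F 3) : z * (r * rsubst sh t * k) = r * k.
  by rewrite -(mulrA r) (mulrCA z) (mulrA z) zt mul1r.
by rewrite -zK -[RHS]zK -!rsubstM // -e1 -e2 e.
Qed.

Lemma comp1_factor v f g : reg g -> C v (rsubst sh f * g) = Th v f g.
Proof.
move=> hg; rewrite comp1E //; have [e hf] := factorP (rsubst sh f * g : rfun F (2 + 1)).
by apply: ThetaQ_factor => //; rewrite -e.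
Qed.

(** Linearity in h needs the same f for two functions. In H the exponent may be enlarged by any b,
    so the two pole orders a and b can be replaced by their sum. *)
Lemma rfun3_common_factor h h' : exists f g g', [/\ reg g, reg g',
  h = rsubst sh f * g & h' = rsubst sh f * g'].
Proof.
have H (k : rfun F 3) : exists a, forall b, exists2 g, reg g &
    k = rsubst sh (rzinv F p0 p1 ^+ (a + b)) * g.
  have [a [P [hP e]]] := rfun3_frac k; exists a => b.
  exists (P * rz F o0 o1 ^+ b * (rzinv F o0 o2 * rzinv F o1 o2) ^+ a).
    apply: RGmul; last exact: rgen_yw.
    by apply: RGmul; [apply: rgen_none|apply: rgenX; apply: RGz].
  rewrite rsubstX // rsubst_zinv // lshift12_0 lshift12_1 exprD e exprMn.
  have V1 : rzinv F o0 o1 ^+ b * rz F o0 o1 ^+ b = 1.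
    by rewrite mulrC -exprMn rzV // expr1n.
  by rewrite -!mulrA (mulrCA (_ ^+ b) P) (mulrA (_ ^+ b) (_ ^+ b)) V1 mul1r mulrCA.
have [a Ha] := H h; have [b Hb] := H h'.
have [g hg e] := Ha b; have [g' hg' e'] := Hb a.
by exists (rzinv F p0 p1 ^+ (a + b)), g, g'; split=> //; rewrite addnC.
Qed.

Lemma rfun3_factor h : exists f g, reg g /\ h = rsubst sh f * g.
Proof. by have [f [g [_ [hg _ e _]]]] := rfun3_common_factor h h; exists f, g. Qed.

Lemma comp1_linear_fun v : linear (C v).
Proof.
move=> c h h'; have [f [g [g' [hg hg' -> ->]]]] := rfun3_common_factor h h'.
have -> : c *: (rsubst sh f * g) + rsubst sh f * g' = rsubst sh f * (c *: g + g').
  by rewrite mulrDr !rscaleE mulrCA.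
rewrite !comp1_factor //; first exact: ThetaQ_reg_linear.
by apply: RGadd => //; apply: rgenZ.
Qed.

(** Y depends on the inner lambdas only through their sum, so a difference of derivatives along them
    acts on the class of X alone. *)
Lemma ThetaQ_derB (w : V) (i j : 'I_2) q g : reg g ->
  lqderB (sh j) (sh i) (ThetaQ Y w q g) = ThetaQ Y w (lqderB j i q) g.
Proof.
elim/lquot_indX: q g => [q r hq hr|u|k q hq] g hg.
- by rewrite linearD !(linpD (ThetaQ_linear hY w hg)) linearD /= hq // hr.
- rewrite lqderB_C (linp0 (ThetaQ_linear hY w hg)) (ThetaQ_C hY) // lqderB_push.
  have -> : cl (sh i) = cl (sh j).
    by elim/ord2P: i; elim/ord2P: j; rewrite !(lshift12_0, lshift12_1, clE).
  by rewrite /lqderB subrr linear0 linear0.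
have hd := rgen_deriv (sh k) hg.
rewrite lqderB_X (linpB (ThetaQ_linear hY w hg)) (linpD (ThetaQ_linear hY w hg)).
rewrite !(ThetaQ_X hY) // linearB /= lqderB_X !sh_eq hq // hq //.
rewrite -!scaler_nat !(linpZ (ThetaQ_linear hY w hg)).
by rewrite [LHS]addrAC; congr (_ - _); rewrite addrAC.
Qed.

Lemma sh_rderiv (i : 'I_2) f : rderiv (sh i) (rsubst sh f) = rsubst sh (rderiv i f).
Proof.
by rewrite rsubst_deriv // (eq_bigl (pred1 i)) ?big_pred1_eq.
Qed.

Lemma sh_rderiv0 f : rderiv o0 (rsubst sh f) = rsubst sh (rderiv p0 f).
Proof. by rewrite -lshift12_0 sh_rderiv. Qed.

Lemma sh_rderiv1 f : rderiv o1 (rsubst sh f) = rsubst sh (rderiv p1 f).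
Proof. by rewrite -lshift12_1 sh_rderiv. Qed.

Lemma sh_rderiv2 f : rderiv o2 (rsubst sh f) = 0.
Proof.
rewrite rsubst_deriv // big1 // => j.
by elim/ord2P: j; rewrite ?lshift12_0 ?lshift12_1.
Qed.

Lemma lqderBN n (i j : 'I_n) (q : lquot d n) : lqderB j i q = - lqderB i j q.
Proof. by rewrite -(lreprK q) !lqderB_pi -(linearN (lpi d)) opprB. Qed.

Lemma lqderBxx n (i : 'I_n) (q : lquot d n) : lqderB i i q = 0.
Proof. by rewrite -(lreprK q) lqderB_pi subrr linear0. Qed.

(** For a fixed factorization, the axioms in slots 1 and 2 come from X and those that involve slot 3
    from Y. *)
Lemma comp1_chiral : chiral C.
Proof.
split.
- move=> v i h c u w; have [f [g [hg ->]]] := rfun3_factor h.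
  rewrite !comp1_factor //; elim/ord3P: i; rewrite /upd /=.
  + by rewrite (chiral2_linl hX) (ThetaQ_linear hY).
  + by rewrite (chiral2_linr hX) (ThetaQ_linear hY).
  exact: ThetaQ_linv.
- exact: comp1_linear_fun.
- move=> v i h; have [f [g [hg ->]]] := rfun3_factor h.
  have hd j := rgen_deriv j hg.
  rewrite rderivM (linpD (comp1_linear_fun v)) !comp1_factor //.
  elim/ord3P: i; rewrite /upd /=.
  + rewrite (chiral2_dl hX) (linpB (ThetaQ_linear hY _ hg)) (ThetaQ_X hY) //.
    rewrite sh_rderiv0 comp1_factor // lshift12_0 opprB -addrA; congr (_ + _).
    by rewrite /lqX subrK.
  + rewrite (chiral2_dr hX) (linpB (ThetaQ_linear hY _ hg)) (ThetaQ_X hY) //.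
    rewrite sh_rderiv1 comp1_factor // lshift12_1 opprB -addrA; congr (_ + _).
    by rewrite /lqX subrK.
  rewrite sh_rderiv2 mul0r (linp0 (comp1_linear_fun v)) add0r.
  exact: ThetaQ_dv.
move=> v i j h.
wlog : i j / (i < j)%N.
  move=> H; case: (ltngtP i j) => [|ji|/val_inj->]; first exact: H.
    by rewrite rzN mulNr (linpN (comp1_linear_fun v)) H // -lqderBN.
  by rewrite rzxx mul0r (linp0 (comp1_linear_fun v)) lqderBxx.
have [f [g [hg ->]]] := rfun3_factor h.
elim/ord3P: i; elim/ord3P: j => // _.
- rewrite -lshift12_0 -lshift12_1 mulrA -rsubst_z -rsubstM // !comp1_factor //.
  by rewrite (chiral_mulz hX) ThetaQ_derB.
- rewrite -lshift12_0 mulrCA !comp1_factor //; last exact: reg_zM.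
  by rewrite (ThetaQ_z2 hY).
rewrite -lshift12_1 mulrCA !comp1_factor //; last exact: reg_zM.
by rewrite (ThetaQ_z2 hY).
Qed.

End CompositionChiral.

(** * The box product of binary chiral maps *)

Section PermutedChiral.
Variables (F : fieldType) (V : lmodType F) (d : {linear V -> V}) (n : nat).

Lemma chiral0 (X : chmap d n) (hX : chiral X) v f i : v i = 0 -> X v f = 0.
Proof.
move=> vi; have := linp0 (chiral_linear hX v i f).
by have -> : upd v i 0 = v by apply: funext => j; rewrite /upd; case: eqP => // ->.
Qed.

Lemma chiralZ (X : chmap d n) c : chiral X -> chiral (fun v f => c *: X v f).
Proof.
move=> hX; split=> [v i f a x y|v a f g|v i f|v i j f].
- by rewrite (chiral_linear hX) scalerDr !scalerA mulrC.
- by rewrite (chiral_linear_fun hX) scalerDr !scalerA mulrC.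
- by rewrite linearZ -scalerDr (chiral_sesquilinear hX).
by rewrite (chiral_mulz hX) linearZ.
Qed.

Lemma chiralD (X Y : chmap d n) : chiral X -> chiral Y ->
  chiral (fun v f => X v f + Y v f).
Proof.
move=> hX hY; split=> [v i f a x y|v a f g|v i f|v i j f].
- by rewrite (chiral_linear hX) (chiral_linear hY) addrACA -scalerDr.
- by rewrite (chiral_linear_fun hX) (chiral_linear_fun hY) addrACA -scalerDr.
- rewrite linearD addrACA /=.
  by rewrite (chiral_sesquilinear hX) (chiral_sesquilinear hY).
by rewrite (chiral_mulz hX) (chiral_mulz hY) linearD.
Qed.

Variables (sigma tau : 'I_n -> 'I_n).
Hypotheses (sK : cancel sigma tau) (tK : cancel tau sigma).

Lemma rsubst_rderiv_bij (f : rfun F n) i :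
  rsubst tau (rderiv i f) = rderiv (tau i) (rsubst tau f).
Proof.
rewrite rsubst_deriv; last exact: rgen_inj (can_inj tK).
rewrite (eq_bigl (pred1 i)) ?big_pred1_eq // => j /=.
exact: (inj_eq (can_inj tK)).
Qed.

Lemma chiral_perm (X : chmap d n) : chiral X ->
  chiral (fun v f => lqpush tau (X (fun s => v (sigma s)) (rsubst tau f))).
Proof.
move=> hX; have K f : rgen (rkeep tau) f by apply/rgen_inj/can_inj/tK.
have updE (v : 'I_n -> V) i x :
    (fun s => upd v i x (sigma s)) = upd (fun s => v (sigma s)) (tau i) x.
  by apply: funext => s; rewrite /upd (can2_eq sK tK).
split=> [v i f a x y|v a f g|v i f|v i j f].
- by rewrite !updE (chiral_linear hX) linearP.
- by rewrite rsubstD ?rsubstZ // ?(chiral_linear_fun hX) ?linearP //; apply: rgenZ.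
- rewrite updE rsubst_rderiv_bij -(chiral_sesquilinear hX) linearD tK /=.
  congr (_ + _); rewrite -/(lqX i _) -/(lqX (tau i) _).
  by rewrite (lqpush_bij _ _ sK) tK.
by rewrite rsubstM // rsubst_z (chiral_mulz hX) lqderB_push.
Qed.

End PermutedChiral.

(** * The symmetric group action on homogeneous arguments *)

Section SymAct.
Variables (F : fieldType) (V : lmodType F) (d : {linear V -> V}) (n : nat).
Variable G : supergrading V.

Lemma parity_proj b v : has_parity G b (G b v).
Proof. by rewrite /has_parity proj_proj eqxx. Qed.

Lemma parity_neq b c v : has_parity G b v -> c != b -> G c v = 0.
Proof. by rewrite /has_parity => <- /negbTE cb; rewrite proj_proj cb. Qed.

(** For any parity vector other than q, some slot receives a component of the wrong parity, hence
    0. *)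
Lemma symact_hom (X : chmap d n) (s : 'S_n) (q : 'I_n -> bool) v f : chiral X ->
  (forall i, has_parity G (q i) (v i)) ->
  symact G s X v f = (-1) ^+ inv_parity q s *:
    lqpush s (X (fun i => v (s^-1%g i)) (rsubst s f)).
Proof.
move=> hX hv; rewrite /symact (bigD1 [ffun i => q i]) //= big1 => [|p hp].
  rewrite addr0; congr (_ ^+ _ *: lqpush _ (X _ _)).
    by apply: eq_bigr => i _; apply: eq_bigr => j _; rewrite !ffunE.
  by apply: funext => i; rewrite ffunE; apply: hv.
have [i hi] : exists i, p i != q i.
  apply/existsP; apply: contraNT hp => /existsPn h; apply/eqP/ffunP => i.
  by rewrite ffunE; apply/eqP; move: (h i); rewrite negbK.
rewrite (chiral0 hX _ (i := s i)) ?linear0 ?scaler0 //=.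
by rewrite permK (parity_neq (hv i)).
Qed.

Lemma symact_linear (X : chmap d n) (s : 'S_n) v i f : chiral X ->
  linear (fun u => symact G s X (upd v i u) f).
Proof.
move=> hX c x y; rewrite /symact scaler_sumr -big_split; apply: eq_bigr => p _ /=.
rewrite scalerA mulrC -scalerA -scalerDr; congr (_ *: _).
have E z : (fun j => G (p (s^-1%g j)) (upd v i z (s^-1%g j))) =
    upd (fun j => G (p (s^-1%g j)) (v (s^-1%g j))) (s i) (G (p i) z).
  apply: funext => j; rewrite /upd (can2_eq (permKV s) (permK s)).
  by case: eqP => // ->; rewrite permK.
by rewrite !E linearP (chiral_linear hX) linearP.
Qed.

End SymAct.

(** [t01] exchanges the two inner arguments of a composite; the identity, [t12] and the 3-cycle
    [c120] are the (2,1)-shuffles. *)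
Definition t01 : 'S_3 := tperm o0 o1.
Definition t12 : 'S_3 := tperm o1 o2.
Definition c120 : 'S_3 := (t01 * tperm o0 o2)%g.

Lemma t01E : (t01 o0 = o1) * (t01 o1 = o0) * (t01 o2 = o2).
Proof. by rewrite /t01 tpermL tpermR tpermD. Qed.
Lemma t12E : (t12 o0 = o0) * (t12 o1 = o2) * (t12 o2 = o1).
Proof. by rewrite /t12 tpermL tpermR tpermD. Qed.
Lemma c120E : (c120 o0 = o1) * (c120 o1 = o2) * (c120 o2 = o0).
Proof. by rewrite /c120 !permM !t01E tpermL tpermR tpermD. Qed.
Lemma c120VE : (c120^-1%g o0 = o2) * (c120^-1%g o1 = o0) * (c120^-1%g o2 = o1).
Proof.
by split; first split; apply: (@perm_inj _ c120); rewrite permKV !c120E.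
Qed.

Lemma t01K : involutive t01. Proof. exact: tpermK. Qed.
Lemma t12K : involutive t12. Proof. exact: tpermK. Qed.
Lemma t12V : (t12^-1)%g = t12. Proof. exact: tpermV. Qed.
Opaque t01 t12 c120.

Lemma shuffle21P (s : 'S_3) :
  @shuffle 2 1 s <-> s = 1%g \/ s = t12 \/ s = c120.
Proof.
split=> [/andP[/forallP/(_ p0)/forallP/(_ p1) /= h _]|h]; last first.
  apply/andP; split; apply/forallP => i; apply/forallP => j; apply/implyP.
    case: h => [->|[->|->]]; elim/ord2P: i; elim/ord2P: j => // _;
      by rewrite lshift12_0 lshift12_1 ?perm1 ?t12E ?c120E.
  by rewrite (ord1 i) (ord1 j).
have {}h : (s o0 < s o1)%N by rewrite -lshift12_0 -lshift12_1.
have n02 : (s o0 != s o2 :> nat) by rewrite (inj_eq val_inj) (inj_eq perm_inj).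
have n12 : (s o1 != s o2 :> nat) by rewrite (inj_eq val_inj) (inj_eq perm_inj).
have [l0 l1 l2] : [/\ (s o0 < 3)%N, (s o1 < 3)%N & (s o2 < 3)%N] by split.
have : (s o0 = 0 :> nat /\ s o1 = 1 :> nat /\ s o2 = 2 :> nat) \/
    (s o0 = 0 :> nat /\ s o1 = 2 :> nat /\ s o2 = 1 :> nat) \/
    (s o0 = 1 :> nat /\ s o1 = 2 :> nat /\ s o2 = 0 :> nat).
  by move: (s o0) (s o1) (s o2) h n02 n12 l0 l1 l2 => [a /= _] [b /= _] [c /= _]; lia.
case=> [[e0 [e1 e2]]|[[e0 [e1 e2]]|[e0 [e1 e2]]]]; [left|right; left|right; right];
  apply/permP; elim/ord3P; apply: val_inj; rewrite ?perm1 ?t12E ?c120E /=; lia.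
Qed.

Lemma sum_shuffle21 (M : zmodType) (E : 'S_3 -> M) :
  \sum_(s : 'S_3 | @shuffle 2 1 s) E s = E 1%g + E t12 + E c120.
Proof.
have sP s : @shuffle 2 1 s = [|| s == 1%g, s == t12 | s == c120].
  apply/idP/or3P => [/shuffle21P[->|[->|->]]|h].
  - exact: Or31.
  - exact: Or32.
  - exact: Or33.
  by apply/shuffle21P; case: h => /eqP->; auto.
have n1 : t12 != 1%g.
  by apply/eqP => /permP/(_ o1); rewrite t12E perm1.
have n2 : c120 != 1%g.
  by apply/eqP => /permP/(_ o1); rewrite c120E perm1.
have n3 : c120 != t12.
  by apply/eqP => /permP/(_ o0); rewrite c120E t12E.
rewrite (eq_bigl _ _ sP) (bigD1 1%g) ?eqxx //= (bigD1 t12) ?n1 ?eqxx ?orbT //=.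
rewrite (bigD1 c120) ?n2 ?n3 ?eqxx ?orbT //= big1 ?addr0 ?addrA // => s.
by case/andP=> /andP[/andP[]] /or3P[] /eqP->; rewrite ?eqxx.
Qed.

Section Box.
Variables (F : fieldType) (V : lmodType F) (d : {linear V -> V}).
Variables (G : supergrading V) (X : chmap d 2) (hX : chiral X).
Implicit Types (v : 'I_3 -> V) (h : rfun F 3) (p : 'I_3 -> bool).

Local Notation C := (@comp1 F V d 2 1 X X : chmap d 3).

(* X box X on homogeneous arguments of parities p, with one term per shuffle. *)
Definition boxp p : chmap d 3 := fun v h =>
  C v h
  + (-1) ^+ (p o1 && p o2) *:
      lqpush t12 (C (fun s => v (t12 s)) (rsubst t12 h))
  + (-1) ^+ ((p o0 && p o1) + (p o0 && p o2)) *: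
      lqpush c120^-1%g (C (fun s => v (c120 s)) (rsubst c120^-1%g h)).

Lemma inv_parity3 (s : 'S_3) p : inv_parity p s =
  ((if (s o1 < s o0)%N then (p o0 && p o1 : nat) else 0)
  + (if (s o2 < s o0)%N then (p o0 && p o2 : nat) else 0)
  + (if (s o2 < s o1)%N then (p o1 && p o2 : nat) else 0))%N.
Proof.
by rewrite /inv_parity !big_ord3_cond /=; lia.
Qed.

(** Reduces the vanishing of X box X to that of [boxp] on homogeneous arguments; [box_hom] serves
    the other direction. *)
Lemma boxE v h : @box F V d G 2 1 X X v h =
  \sum_(p : {ffun 'I_3 -> bool}) boxp p (fun i => G (p i) (v i)) h.
Proof.
rewrite /box /symact exchange_big /=; apply: eq_bigr => p _.
rewrite (sum_shuffle21 (fun s => (-1) ^+ inv_parity p s^-1%g *: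
   lqpush s^-1%g (C (fun i => G (p (s^-1^-1 i)%g) (v (s^-1^-1 i)%g)) (rsubst s^-1%g h)))).
rewrite /boxp !inv_parity3 !invgK invg1 t12V.
rewrite !perm1 /= lqpush_id; last by move=> i; rewrite perm1.
rewrite rsubst_id; last by move=> i; rewrite perm1.
rewrite !t12E !c120VE /= !addn0 expr0 scale1r.
congr (C _ _ + _ + _).
by apply: funext => i; rewrite perm1.
Qed.

Lemma box_hom v h p : (forall i, has_parity G (p i) (v i)) ->
  @box F V d G 2 1 X X v h = boxp p v h.
Proof.
move=> hv; rewrite /box.
under eq_bigr do rewrite (symact_hom _ _ (comp1_chiral hX hX) hv).
rewrite (sum_shuffle21 (fun s => (-1) ^+ inv_parity p s^-1%g *:
   lqpush s^-1%g (C (fun i => v (s^-1^-1 i)%g) (rsubst s^-1%g h)))).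
rewrite /boxp !inv_parity3 !invgK invg1 t12V.
rewrite !perm1 /= lqpush_id; last by move=> i; rewrite perm1.
rewrite rsubst_id; last by move=> i; rewrite perm1.
rewrite !t12E !c120VE /= !addn0 expr0 scale1r.
congr (C _ _ + _ + _).
by apply: funext => i; rewrite perm1.
Qed.

(** The signs are constants once p is fixed, so multilinearity holds even for arguments whose
    parities are not p. *)
Lemma boxp_chiral p : chiral (boxp p).
Proof.
have hC := comp1_chiral hX hX.
apply: chiralD; first apply: chiralD => //.
  by apply: chiralZ; apply: chiral_perm hC; apply: t12K.
by apply: chiralZ; apply: chiral_perm hC; [apply: permK|apply: permKV].
Qed.

Hypothesis X_sym : forall s (v : 'I_2 -> V) f, symact G s X v f = X v f.

Local Notation sw := (tperm p0 p1).

Lemma chiral2_sym (a b : bool) (u v : V) f : has_parity G a u -> has_parity G b v ->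
  X (pairV u v) f = (-1) ^+ (a && b) *: lqpush sw (X (pairV v u) (rsubst sw f)).
Proof.
move=> ha hb; rewrite -(X_sym sw) (symact_hom (q := fun i => [:: a; b]`_i) _ _ hX).
  rewrite tpermV; congr (_ ^+ _ *: lqpush _ (X _ _)).
    by rewrite /inv_parity !big_ord2_cond /= tpermL tpermR /= !addn0.
  by apply: funext; elim/ord2P; rewrite ?tpermL ?tpermR.
by elim/ord2P.
Qed.

End Box.

Opaque comp1.

(** * Symmetry of the box product in its last two arguments *)

Section BoxSymmetry.
Variables (F : fieldType) (V : lmodType F) (d : {linear V -> V}).
Variables (G : supergrading V) (X : chmap d 2) (hX : chiral X).
Hypothesis X_sym : forall s (v : 'I_2 -> V) f, symact G s X v f = X v f.
Implicit Types (v : 'I_3 -> V) (h g : rfun F 3) (p : 'I_3 -> bool).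

Local Notation C := (@comp1 F V d 2 1 X X : chmap d 3).
Local Notation sw := (tperm p0 p1 : 'S_2).

Lemma t01_sh i : t01 (sh i) = sh (sw i).
Proof.
by elim/ord2P: i; rewrite ?(tpermL, tpermR) ?lshift12_0 ?lshift12_1 t01E.
Qed.


Lemma cl_t01 i : cl (t01 i) = cl i.
Proof. by elim/ord3P: i; rewrite t01E !clE. Qed.

Lemma reg_t01 g : reg g -> reg (rsubst t01 g).
Proof.
apply: rsubst_gen => i j; last by rewrite /rkeep !cl_t01.
by move=> h; rewrite /rkeep (inj_eq perm_inj); apply: contra_neq h => ->.
Qed.

Lemma rsubst_perm2 n (s t : 'S_n) (f : rfun F n) :
  rsubst t (rsubst s f) = rsubst (t \o s) f.
Proof. by apply/rsubst_comp/rgen_inj => i j /= /perm_inj/perm_inj. Qed.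

(** The collapse does not distinguish z_1 from z_2, so exchanging them inside the class of X is the
    same as exchanging them outside. *)
Lemma ThetaQ_swap w q g : reg g ->
  ThetaQ X w (lqpush sw q) g = lqpush t01 (ThetaQ X w q (rsubst t01 g)).
Proof.
elim/lquot_indX: q g => [q r hq hr|u|i q hq] g hg; have hg' := reg_t01 hg.
- by rewrite linearD !(linpD (ThetaQ_linear hX w _)) ?hq ?hr ?linearD.
- have e : cl \o t01 = cl by apply: funext; apply: cl_t01.
  rewrite lqpush_C !(ThetaQ_C hX) // lqpush_comp e rsubst_comp e //.
rewrite (lqpush_bij _ _ (tpermK _ _)) !(ThetaQ_X hX) // hq // hq; last exact: rgen_deriv.
rewrite linearB /= (lqpush_bij _ _ t01K) t01_sh; congr (_ - lqpush _ (ThetaQ _ _ _ _)).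
by rewrite (rsubst_rderiv_bij t01K) -t01_sh t01K.
Qed.

Lemma comp1_swap (a b : bool) v h :
  has_parity G a (v o0) -> has_parity G b (v o1) ->
  C v h = (-1) ^+ (a && b) *: lqpush t01 (C (fun s => v (t01 s)) (rsubst t01 h)).
Proof.
move=> ha hb; have [f [g [hg ->]]] := rfun3_factor h.
have e : rsubst t01 (rsubst sh f * g) = rsubst sh (rsubst sw f) * rsubst t01 g.
  rewrite rsubstM; [|exact/rgen_inj/perm_inj..]; congr (_ * _).
  have i1 : injective (t01 \o sh).
    by apply: inj_comp; [apply: perm_inj|apply: lshift_inj].
  have e1 : t01 \o sh = sh \o sw by apply: funext; apply: t01_sh.
  rewrite (rsubst_comp (rgen_inj f i1)); rewrite e1 in i1 *.
  by rewrite (rsubst_comp (rgen_inj f i1)).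
rewrite e !(comp1_factor hX hX) //; last exact: reg_t01.
rewrite !t01E (chiral2_sym hX X_sym f ha hb) (linpZ (ThetaQ_linear hX _ hg)).
by rewrite ThetaQ_swap.
Qed.

(** [t12] exchanges the first two shuffle terms. It fixes the third up to sign, because t12 after
    c120 is c120 after t01 and the inner exchange [t01] is absorbed by [comp1_swap]. *)
Lemma boxp_sym p v h : (forall i, has_parity G (p i) (v i)) ->
  boxp X p v h = (-1) ^+ (p o1 && p o2) *:
    lqpush t12 (boxp X (fun s => p (t12 s)) (fun s => v (t12 s)) (rsubst t12 h)).
Proof.
move=> hv.
have L (c1 c2 : F) (x y z : lquot d 3) : lqpush t12 (x + c1 *: y + c2 *: z) =
    lqpush t12 x + c1 *: lqpush t12 y + c2 *: lqpush t12 z.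
  by rewrite !linearD !linearZ.
have e1 : lqpush t12 (lqpush t12 (C (fun s => v (t12 (t12 s)))
    (rsubst t12 (rsubst t12 h)))) = C v h.
  have -> : (fun s => v (t12 (t12 s))) = v by apply: funext => s; rewrite t12K.
  rewrite lqpush_comp rsubst_perm2 lqpush_id; last exact: t12K.
  by rewrite rsubst_id; last exact: t12K.
have e2 (a : bool) : (-1) ^+ a * (-1) ^+ a = 1 :> F.
  by case: a; rewrite ?mulr1 // mulrNN mulr1.
have e3 : lqpush c120^-1%g (C (fun s => v (c120 s)) (rsubst c120^-1%g h)) =
    (-1) ^+ (p o1 && p o2) *: lqpush t12 (lqpush c120^-1%g
      (C (fun s => v (t12 (c120 s))) (rsubst c120^-1%g (rsubst t12 h)))).
  rewrite (comp1_swap (a := p o1) (b := p o2)); last 2 first.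
  - by rewrite c120E.
  - by rewrite c120E.
  have ec : t12 \o c120 = c120 \o t01.
    by apply: funext; elim/ord3P => /=; rewrite !(t01E, t12E, c120E).
  have ecV : c120^-1%g \o t12 = t01 \o c120^-1%g.
    by apply: funext; elim/ord3P => /=; rewrite !(t01E, t12E, c120VE).
  rewrite (linpZ (@lqpush_is_linear _ _ d _ _ c120^-1%g)).
  apply: (congr1 (GRing.scale _)).
  rewrite !lqpush_comp !rsubst_perm2 ecV; congr (lqpush _ (C _ _)).
  by apply: funext => s; have := congr1 (fun k => k s) ec => /= ->.
rewrite /boxp L [X in _ = _ *: (_ + _ *: X + _)]e1 [X in _ + _ *: X = _]e3.
rewrite t12E.1.1 t12E.1.2 t12E.2 !scalerDr !scalerA.
rewrite [p o2 && p o1]andbC e2 scale1r [C v h + _]addrC.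
by rewrite addnC mulrC.
Qed.

End BoxSymmetry.

(** * Integrals of lambda-brackets *)

Lemma linear_bundle (F : fieldType) (U W : lmodType F) (f : U -> W) :
  linear f -> exists g : {linear U -> W}, f = g.
Proof.
move=> fL; pose m := GRing.isLinear.Build F U W _ f fL.
by pose g : {linear U -> W} := HB.pack f m; exists g.
Qed.

Section Antiderivatives.
Variables (F : fieldType) (charF0 : [pchar F] =i pred0) (V : lmodType F).

Lemma lprim_lder_X n i (x : lpoly V n) : lprim i (lder i (lX i x)) = lX i x.
Proof.
elim/lpoly_ind: x => [x y hx hy|m v]; first by rewrite !linearD /= hx hy.
rewrite lX_mon lder_mon lprim_mon mnmDE mnm1E eqxx addn1.
have -> : (m + U_(i) - U_(i))%MM = m by apply/mnmP => k; rewrite mnmBE mnmDE addnK.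
by rewrite -scaler_nat scalerA mulVf ?scale1r // (pcharf0P F).1.
Qed.

Lemma lprim_X n i k (x : lpoly V n) : k != i -> lprim i (lX k x) = lX k (lprim i x).
Proof.
move=> ki; elim/lpoly_ind: x => [x y hx hy|m v]; first by rewrite !linearD /= hx hy.
rewrite lX_mon !lprim_mon lX_mon mnmDE mnm1E (negbTE ki) addn0.
by rewrite -!addmA (addmC U_(i)%MM).
Qed.

(** Evaluation at lambda_i = 0, the point where the primitives [lprim] are normalized. *)
Definition lzero n (i : 'I_n) (x : lpoly V n) : lpoly V n :=
  leval (fun k y => if k == i then 0 else lX k y) (@lC F V n) x.

Let zL n (i k : 'I_n) : linear (fun y : lpoly V n => if k == i then 0 else lX k y).
Proof.
case: (k == i) => c x y; first by rewrite scaler0 addr0.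
exact: linearP.
Qed.

Let CL n : linear (@lC F V n). Proof. exact: linearP. Qed.

Lemma lzero_is_linear n (i : 'I_n) : linear (lzero i).
Proof. by apply: leval_linear => [k|]; [exact: zL|exact: CL]. Qed.
HB.instance Definition _ n i :=
  GRing.isLinear.Build F (lpoly V n) (lpoly V n) _ (@lzero n i) (@lzero_is_linear n i).

Lemma lzero_C n (i : 'I_n) v : lzero i (lC n v) = lC n v.
Proof. by apply: leval_C => [k|]; [exact: zL|exact: CL]. Qed.

Lemma lzero_X n (i k : 'I_n) (x : lpoly V n) :
  lzero i (lX k x) = if k == i then 0 else lX k (lzero i x).
Proof.
apply: (leval_X (zL i)) => [a b y|]; last exact: CL.
by case: (a == i); case: (b == i); rewrite ?linear0 // lX_comm.
Qed.

Lemma lprim_lder n i (x : lpoly V n) : lprim i (lder i x) = x - lzero i x.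
Proof.
elim/lpoly_indX: x => [x y hx hy|v|k x hx].
- by rewrite !linearD /= hx hy addrACA.
- by rewrite lder_C lzero_C linear0 subrr.
rewrite lzero_X; case: eqP => [->|/eqP ki]; first by rewrite lprim_lder_X subr0.
rewrite lder_X [i == k]eq_sym (negbTE ki) mulr0n addr0 lprim_X // hx.
exact: linearB.
Qed.

Lemma lzero1 (x : lpoly V 1) : lzero ord0 x = lC 1 (lcoef 0%MM x).
Proof.
elim/lpoly_indX: x => [x y hx hy|v|k x hx]; first by rewrite !linearD /= hx hy.
  by rewrite lzero_C lcoef_mon eqxx mulr1n.
rewrite lzero_X (ord1 k) eqxx.
have -> : lcoef 0%MM (lX ord0 x) = 0; last by rewrite linear0.
elim/lpoly_ind: {hx} x => [x y hx hy|m v]; first by rewrite !linearD /= hx hy addr0.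
rewrite lX_mon lcoef_mon; case: eqP => // /mnmP/(_ ord0).
by rewrite mnmDE mnm0E mnm1E eqxx addn1.
Qed.

Lemma lzero_lder n (i j : 'I_n) (x : lpoly V n) : i != j ->
  lzero j (lder i x) = lder i (lzero j x).
Proof.
move=> ij; elim/lpoly_indX: x => [x y hx hy|v|k x hx].
- by rewrite !linearD /= hx hy.
- by rewrite lder_C lzero_C lder_C linear0.
rewrite lder_X linearD linearMn /= !lzero_X; case: eqP => [->|_].
  by rewrite (negbTE ij) addr0 linear0.
by rewrite lder_X hx.
Qed.

Lemma lcoef_lmap n (f : {linear V -> V}) m (x : lpoly V n) :
  lcoef m (lmap f x) = f (lcoef m x).
Proof.
elim/lpoly_ind: x => [x y hx hy|k v]; first by rewrite !linearD /= hx hy.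
by rewrite lmap_mon !lcoef_mon linearMn.
Qed.

Section Lat.
Variables (n : nat) (A : lpoly V n -> lpoly V n) (AL : linear A).

Lemma lat_linear : linear (lat A).
Proof. by apply: leval_linear => [k|]; [exact: AL|exact: CL]. Qed.

Lemma lat_C v : lat A (lC 1 v) = lC n v.
Proof. by apply: leval_C => [k|]; [exact: AL|exact: CL]. Qed.

Lemma lat_X i x : lat A (lX i x) = A (lat A x).
Proof. by apply: (leval_X (fun=> AL)) => [//|]; exact: CL. Qed.

Lemma lint0_lder x : lint0 A (lder ord0 x) = lat A x - lC n (lcoef 0%MM x).
Proof. by rewrite /lint0 lprim_lder (linpB lat_linear) lzero1 lat_C. Qed.

Lemma lat_lmap (f : {linear V -> V}) x :
  (forall y, A (lmap f y) = lmap f (A y)) -> lat A (lmap f x) = lmap f (lat A x).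
Proof.
move=> Af; elim/lpoly_indX: x => [x y hx hy|v|k x hx].
- by rewrite linearD !(linpD lat_linear) linearD /= hx hy.
- by rewrite lmap_C !lat_C lmap_C.
by rewrite lmap_X !lat_X hx Af.
Qed.

End Lat.

Lemma lat_lX_lder n (i : 'I_n) (x : lpoly V 1) : lder i (lat (lX i) x) = lat (lX i) (lder ord0 x).
Proof.
have L : linear (@lX F V n i) by exact: linearP.
elim/lpoly_indX: x => [x y hx hy|v|k x hx].
- by rewrite linearD !(linpD (lat_linear L)) linearD /= hx hy.
- by rewrite (lat_C L) !lder_C (linp0 (lat_linear L)).
rewrite (ord1 k) (lat_X L) !lder_X !eqxx hx (linpD (lat_linear L)) (lat_X L).
by rewrite !mulr1n.
Qed.

Lemma lat_lX_lder_neq n (i j : 'I_n) (x : lpoly V 1) : j != i -> lder j (lat (lX i) x) = 0.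
Proof.
have L : linear (@lX F V n i) by exact: linearP.
move=> ji; elim/lpoly_indX: x => [x y hx hy|v|k x hx].
- by rewrite (linpD (lat_linear L)) linearD /= hx hy addr0.
- by rewrite (lat_C L) lder_C.
by rewrite (lat_X L) lder_X hx (negbTE ji) linear0 addr0.
Qed.

Lemma lat_lX_lzero n (i : 'I_n) (x : lpoly V 1) : lzero i (lat (lX i) x) = lC n (lcoef 0%MM x).
Proof.
have L : linear (@lX F V n i) by exact: linearP.
rewrite -(lat_C L) -lzero1; elim/lpoly_indX: x => [x y hx hy|v|k x hx].
- by rewrite linearD !(linpD (lat_linear L)) linearD /= hx hy.
- by rewrite (lat_C L) !lzero_C (lat_C L).
by rewrite (lat_X L) !lzero_X (ord1 k) !eqxx (linp0 (lat_linear L)).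
Qed.

Lemma lat_lX_lzero_neq n (i j : 'I_n) (x : lpoly V 1) : j != i ->
  lzero j (lat (lX i) x) = lat (lX i) x.
Proof.
have L : linear (@lX F V n i) by exact: linearP.
move=> ji; elim/lpoly_indX: x => [x y hx hy|v|k x hx].
- by rewrite (linpD (lat_linear L)) linearD /= hx hy.
- by rewrite (lat_C L) lzero_C.
by rewrite (lat_X L) lzero_X eq_sym (negbTE ji) hx.
Qed.

Variable I : V -> V -> lpoly V 1.
Hypotheses (Il : forall v, linear (I^~ v)) (Ir : forall u, linear (I u)).

Lemma nop_linearr u : linear (nop I u).
Proof. by move=> c x y; rewrite /nop Ir linearP. Qed.

Lemma lbr_linearr u : linear (lbr I u).
Proof. by move=> c x y; rewrite /lbr Ir linearP. Qed.

(** Let l be the right-hand side, a polynomial in lambda_i and lambda_j. The four terms of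
    [nested_int] are l at (0,0), the increments of l along each axis from (0,0), and the double
    integral of its mixed derivative; they add up to l. *)
Lemma nested_intE (i j : 'I_2) u v w : i != j -> nested_int I i j u v w =
  leval (fun=> lX j) (fun c => lat (lX i) (I u c)) (I v w).
Proof.
move=> ij.
have Li : linear (@lX F V 2 i) by exact: linearP.
have Lj : linear (@lX F V 2 j) by exact: linearP.
pose phi c : lpoly V 2 := lat (lX i) (I u c).
have phiL : linear phi := linear_comp (lat_linear Li) (Ir u).
pose psi c : lpoly V 2 := lat (lX i) (lbr I u c).
have psiL : linear psi := linear_comp (lat_linear Li) (lbr_linearr u).
have ev (f : V -> lpoly V 2) (fL : linear f) := leval_linear (n := 1) (fun=> Lj) fL.
have evX (f : V -> lpoly V 2) (fL : linear f) :=
  leval_X (n := 1) (A := fun=> lX j) (fun=> Lj) (fun _ _ _ => erefl) fL.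
have evC (f : V -> lpoly V 2) (fL : linear f) :=
  leval_C (n := 1) (A := fun=> lX j) (fun=> Lj) fL.
pose lvl (f : V -> lpoly V 2) (x : lpoly V 1) : lpoly V 2 := leval (fun=> lX j) f x.
have D x : lvl psi (lder ord0 x) = lder i (lder j (lvl phi x)).
  rewrite /lvl; elim/lpoly_indX: x => [x y hx hy|c|k x hx].
  - by rewrite linearD !(linpD (ev _ psiL)) (linpD (ev _ phiL)) !linearD /= hx hy.
  - by rewrite lder_C (linp0 (ev _ psiL)) evC // lat_lX_lder_neq 1?eq_sym // linear0.
  rewrite (ord1 k) lder_X eqxx (linpD (ev _ psiL)) !evX // hx lder_X eqxx !mulr1n.
  rewrite linearD /= lder_X (negbTE ij) addr0; congr (_ + _).
  elim/lpoly_indX: {hx} x => [x y hx hy|c|l x hx].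
  - by rewrite (linpD (ev _ psiL)) (linpD (ev _ phiL)) linearD /= hx hy.
  - by rewrite !evC // lat_lX_lder.
  by rewrite !evX // lder_X (negbTE ij) addr0 hx.
have Zj x : lzero j (lvl phi x) = lat (lX i) (I u (lcoef 0%MM x)).
  rewrite -[RHS]/(phi _) -(evC _ phiL) -lzero1 -/(lvl _ _).
  rewrite /lvl; elim/lpoly_indX: x => [x y hx hy|c|k x hx].
  - by rewrite linearD !(linpD (ev _ phiL)) linearD /= hx hy.
  - by rewrite lzero_C evC // lat_lX_lzero_neq // eq_sym.
  by rewrite evX // !lzero_X (ord1 k) !eqxx (linp0 (ev _ phiL)).
have [N eN] : exists N : {linear V -> V}, nop I u = N.
  exact/linear_bundle/nop_linearr.
have Zi x : lzero i (lvl phi x) = lat (lX j) (lmap N x).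
  rewrite /lvl; elim/lpoly_indX: x => [x y hx hy|c|k x hx].
  - by rewrite linearD !(linpD (lat_linear Lj)) !(linpD (ev _ phiL)) linearD /= hx hy.
  - by rewrite evC // lat_lX_lzero lmap_C (lat_C Lj) -eN.
  by rewrite evX // lzero_X lmap_X (lat_X Lj) eq_sym (negbTE ij) hx.
set y := I v w; have ey : lcoef 0%MM y = nop I v w by [].
rewrite /nested_int eN -/(lvl _ _) -/psi /lbr -/y lmap_lder.
rewrite (lint0_lder Lj) (lint0_lder Li) lcoef_lmap -ey.
rewrite D lder_comm lprim_lder.
rewrite lzero_lder // (linearB (lprim i)) /= !lprim_lder Zj Zi lat_lX_lzero.
rewrite -[lcoef 0%MM (I u _)]/(nop I u _) eN.
rewrite -[leval _ _ y]/(lvl phi y).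
move: (lC 2 _) (lat (lX j) _) (lat (lX i) _) (lvl phi y) => a b c l.
rewrite addrC (addrC a) subrK.
by rewrite -[l - b - _]addrA -opprD subrK.
Qed.

Variable d : {linear V -> V}.

Lemma lXX_linear : linear (fun x : lpoly V 2 => lX p0 x + lX p1 x).
Proof. by move=> c x y; rewrite (linearP (lX p0)) (linearP (lX p1)) /= addrACA scalerDr. Qed.

(** The constant terms at the two limits of integration cancel, so a difference of two values of the
    primitive remains. *)
Lemma bracket_intE u v : bracket_int d I u v =
  lat (lX p0) (I u v) - lat (fun x => - lX p1 x - lmap d x) (I u v).
Proof.
have L : linear (@lX F V 2 p0) by exact: linearP.
rewrite /bracket_int (lint0_lder L) (lint0_lder (lXd_linear d p1)).
by rewrite opprB addrA subrK.
Qed.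

(** The normally ordered product restores the constant term that the integral from 0 leaves out. *)
Lemma bracket_nested_intE u v w : bracket_nested_int d I u v w =
  leval (@lX F V 2) (fun a => lat (fun x => lX p0 x + lX p1 x) (I a w))
    (bracket_int d I u v).
Proof.
have LX i : linear (@lX F V 2 i) by exact: linearP.
have XC i j (x : lpoly V 2) : lX i (lX j x) = lX j (lX i x) by exact: lX_comm.
have Nl : linear (nop I ^~ w) by move=> c x y; rewrite /nop Il linearP.
have [N eN] := linear_bundle Nl.
pose phi a : lpoly V 2 := lat (fun x => lX p0 x + lX p1 x) (I a w).
have phiL : linear phi := linear_comp (lat_linear lXX_linear) (Il w).
pose psi a : lpoly V 2 := lint0 (fun x => lX p0 x + lX p1 x) (lbr I a w).
have psiE a : psi a = phi a - lC 2 (N a).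
  by rewrite /psi /lbr (lint0_lder lXX_linear) -eN.
have psiL : linear psi.
  move=> c x y; rewrite !psiE phiL (linearP N) (linearP (@lC F V 2)) /=.
  by rewrite opprD addrACA scalerBr.
rewrite /bracket_nested_int eN -/phi; move: (bracket_int _ _ _ _) => x.
rewrite -[X in _ + X]/(leval (@lX F V 2) psi x).
elim/lpoly_indX: x => [x y hx hy|c|k x hx].
- rewrite linearD (linpD (leval_linear LX psiL)) (linpD (leval_linear LX phiL)).
  by rewrite addrACA hx hy.
- by rewrite lmap_C (leval_C LX psiL) (leval_C LX phiL) psiE addrC subrK.
by rewrite lmap_X (leval_X LX XC psiL) (leval_X LX XC phiL) -linearD hx.
Qed.

End Antiderivatives.

(** * The Jacobi identity *)

Section LevalMorphism.
Variables (F : fieldType) (V M N : lmodType F) (n : nat).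
Variables (A : 'I_n -> M -> M) (phi : V -> M) (B : 'I_n -> N -> N) (f : M -> N).
Hypotheses (AL : forall i, linear (A i)) (phiL : linear phi).
Hypotheses (BL : forall i, linear (B i)) (fL : linear f).
Hypothesis AC : forall i j x, A i (A j x) = A j (A i x).
Hypothesis BC : forall i j x, B i (B j x) = B j (B i x).
Hypothesis fAB : forall i x, f (A i x) = B i (f x).

Lemma leval_morph x : f (leval A phi x) = leval B (fun v => f (phi v)) x.
Proof.
have psiL : linear (fun v => f (phi v)) := linear_comp fL phiL.
apply: (leval_unique BL BC psiL (f := fun x => f (leval A phi x))) => [|v|i y].
- exact: linear_comp fL (leval_linear AL phiL).
- by rewrite (leval_C AL phiL).
by rewrite (leval_X AL AC phiL) fAB.
Qed.

End LevalMorphism.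

Lemma leval_scale (F : fieldType) (V M : lmodType F) (n : nat)
    (A : 'I_n -> M -> M) (phi : V -> M) c (x : lpoly V n) :
  (forall i, linear (A i)) -> leval A (fun v => c *: phi v) x = c *: leval A phi x.
Proof.
move=> AL; rewrite /leval lsum.unlock scaler_sumr; apply: eq_bigr => m _.
by rewrite (linpZ (linear_foldr AL _ _)).
Qed.

Section EvenParity.
Variables (F : fieldType) (V : lmodType F) (G : supergrading V).
Variables (d : {linear V -> V}) (d_even : even_endo G d).

Lemma even_endo_comm b v : G b (d v) = d (G b v).
Proof.
rewrite -{1}(proj_sum G v) !linearD.
have e c : d (G c v) = G c (d (G c v)) by rewrite d_even //; apply: parity_proj.
rewrite (e false) (e true) !proj_proj.
by case: b; rewrite /= ?(add0r, addr0) -e.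
Qed.

Lemma lmap_even_comm n b (x : lpoly V n) : lmap (G b) (lmap d x) = lmap d (lmap (G b) x).
Proof. by apply: lpolyP => m; rewrite !lcoef_lmap even_endo_comm. Qed.

Lemma lmap_parityP n b (x : lpoly V n) :
  lmap (G b) x = x <-> forall m, has_parity G b (lcoef m x).
Proof.
split=> [e m|h]; first by rewrite /has_parity -lcoef_lmap e.
by apply: lpolyP => m; rewrite lcoef_lmap h.
Qed.

Lemma lqnorm_lmap n b (x : lpoly V n.+1) :
  lmap (G b) (lqnorm (lpi d x)) = lqnorm (lpi d (lmap (G b) x)).
Proof.
elim/lpoly_indX: x => [x y hx hy|v|i x hx].
- by rewrite !linearD /= hx hy.
- by rewrite lmap_C -!/(lqC _ _ _) !lqnorm_C lmap_C.
rewrite lmap_X -!lqX_pi; case: (unliftP ord_max i) => [j ->|->].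
  by rewrite !lqnorm_X lmap_X hx.
rewrite !lqnorm_Xmax (linearB (lmap (G b))) (linearN (lmap (G b))).
rewrite (linear_sum (lmap (G b))) /= lmap_even_comm hx; congr (- _ - _).
by apply: eq_bigr => j _; rewrite lmap_X hx.
Qed.

End EvenParity.

Lemma lift_max0 : lift ord_max p0 = o0. Proof. exact: val_inj. Qed.
Lemma lift_max1 : lift ord_max p1 = o1. Proof. exact: val_inj. Qed.

(** * The shuffle terms as integrals of brackets *)

Section JacobiTerms.
Variables (F : fieldType) (V : lmodType F) (d : {linear V -> V}).
Variables (X : chmap d 2) (hX : chiral X).
Implicit Types (u v w a : V) (Q : lpoly V 1).

Local Notation C := (@comp1 F V d 2 1 X X : chmap d 3).

(** The integral bracket before the sign (-1)^p(u), hence bilinear with no reference to parity. *)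
Definition chiral_br u v : lpoly V 1 := lqnorm (X (pairV u v) (rzinv F p1 p0)).

Lemma chiral_br_linl v : linear (chiral_br^~ v).
Proof. by move=> c x y; rewrite /chiral_br (chiral2_linl hX) linearP. Qed.

Lemma chiral_br_linr u : linear (chiral_br u).
Proof. by move=> c x y; rewrite /chiral_br (chiral2_linr hX) linearP. Qed.

Lemma chiral_brK u v : lqlift d (chiral_br u v) = X (pairV u v) (rzinv F p1 p0).
Proof. exact: lqnormK. Qed.

Let lqXL i : linear (@lqX F V d 3 i). Proof. exact: lqmulm_is_linear. Qed.
Let lXL i : linear (@lX F V 2 i). Proof. exact: lX_linear. Qed.
Let liftL n : linear (@lqlift F V d n). Proof. exact: lqlift_is_linear. Qed.

Lemma leval_lift n (r : 'I_n -> 'I_2) (phi : V -> lpoly V 2) (x : lpoly V n) :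
  linear phi ->
  leval (fun i => @lqX F V d 3 (lift ord_max (r i))) (fun a => lqlift d (phi a)) x =
  lqlift d (leval (fun i => lX (r i)) phi x).
Proof.
move=> phiL; symmetry.
apply: (@leval_morph F V (lpoly V 2) (lquot d 3) n (fun i => lX (r i)) phi
  (fun i => @lqX F V d 3 (lift ord_max (r i))) (@lqlift F V d 2)) => //.
- exact: liftL.
- by move=> i j y; apply: lX_comm.
- by move=> i j y; apply: lqX_comm.
by move=> i y; apply: lqlift_X.
Qed.

Lemma push_cl_lift Q : lqpush cl (lqlift d Q) =
  lqlift d (lat (fun x => lX p0 x + lX p1 x) Q).
Proof.
have L : linear (fun x : lpoly V 2 => lX p0 x + lX p1 x) by apply: lXX_linear.
elim/lpoly_indX: Q => [x y hx hy|v|k x hx].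
- by rewrite !(linearD (@lqlift F V d 1)) linearD (linpD (lat_linear L)) linearD /= hx hy.
- by rewrite (lat_C L) !lqlift_C lqpush_C.
rewrite (lat_X L) linearD /= !lqlift_X (ord1 k) lift_max0 lift_max1 -hx.
have -> : lift ord_max (ord0 : 'I_1) = p0 by apply: val_inj.
exact: cl_lqX0.
Qed.

Lemma push_single_lift (rho : 'I_3 -> 'I_2) (k : 'I_2) Q :
  (forall i, (rho i == p0) = (i == lift ord_max k)) ->
  lqpush rho (lqlift d Q) = lqlift d (lat (lX k) Q).
Proof.
move=> hrho; elim/lpoly_indX: Q => [x y hx hy|v|l x hx].
- by rewrite !(linearD (@lqlift F V d 1)) linearD (linpD (lat_linear (lXL k))) linearD /= hx hy.
- by rewrite (lat_C (lXL k)) !lqlift_C lqpush_C.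
rewrite (lat_X (lXL k)) !lqlift_X (ord1 l) -hx.
have -> : lift ord_max (ord0 : 'I_1) = p0 by apply: val_inj.
by rewrite lqpush_X (eq_bigl _ _ hrho) big_pred1_eq.
Qed.

Definition xterm v g a : lquot d 3 := lqpush cl (X (pairV a v) (rsubst cl g)).

Lemma xterm_linear v g : linear (xterm v g).
Proof. by move=> c x y; rewrite /xterm (chiral2_linl hX); apply: lqpush_is_linear. Qed.

(** Since g does not involve z_1, the operator lambda_1 - d/dz_1 reduces to lambda_1. *)
Lemma ThetaQ_lift0 v g Q : reg g -> rderiv o0 g = 0 ->
  ThetaQ X v (lqlift d Q) g = leval (fun=> lqX o0) (xterm v g) Q.
Proof.
move=> hg dg.
apply: (leval_unique (fun=> lqXL o0) (fun _ _ _ => erefl) (xterm_linear v g)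
  (f := fun Q => ThetaQ X v (lqlift d Q) g)) => [c x y|a|k x].
- by rewrite linearP (ThetaQ_linear hX).
- by rewrite lqlift_C (ThetaQ_C hX).
rewrite lqlift_X (ord1 k).
have -> : lift ord_max (ord0 : 'I_1) = p0 by apply: val_inj.
rewrite (ThetaQ_X hX) // lshift12_0 dg.
by rewrite (reg_linear0 (ThetaQ_reg_linear hX _ _)) subr0.
Qed.

(** Since g does not involve z_2, it pays to rewrite lambda_1 as - lambda_2 - d in the class of X:
    then lambda_2 acts without a derivative. *)
Lemma ThetaQ_lift1 v g Q : reg g -> rderiv o1 g = 0 ->
  ThetaQ X v (lqlift d Q) g =
  leval (fun i => lqX (lift ord_max i)) (xterm v g)
    (lat (fun x => - lX p1 x - lmap d x) Q).
Proof.
move=> hg dg.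
have L : linear (fun x : lpoly V 2 => - lX p1 x - lmap d x) by apply: lXd_linear.
have lqXC i j (q : lquot d 3) : lqX (lift ord_max i) (lqX (lift ord_max j) q) =
  lqX (lift ord_max j) (lqX (lift ord_max i) q) by apply: lqX_comm.
have EL := leval_linear (fun i : 'I_2 => lqXL (lift ord_max i)) (xterm_linear v g).
have EC := leval_C (fun i : 'I_2 => lqXL (lift ord_max i)) (xterm_linear v g).
have EX := leval_X (fun i : 'I_2 => lqXL (lift ord_max i)) lqXC (xterm_linear v g).
(* Eliminating lambda_1 brings in d, so the induction must also cover all iterates of [lmap d]. *)
suff H k : ThetaQ X v (lqlift d (iter k (lmap d) Q)) g =
  leval (fun i => lqX (lift ord_max i)) (xterm v g)
    (lat (fun x => - lX p1 x - lmap d x) (iter k (lmap d) Q)) by exact: (H 0%N).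
elim/lpoly_indX: Q k => [x y hx hy|a|i x hx] k.
- have -> : iter k (lmap d) (x + y) = iter k (lmap d) x + iter k (lmap d) y.
    by elim: k => //= k ->; rewrite linearD.
  by rewrite linearD (linpD (ThetaQ_linear hX v hg)) (linpD (lat_linear L)) (linpD EL) hx hy.
- have -> : iter k (lmap d) (lC 1 a) = lC 1 (iter k d a).
    by elim: k => //= k ->; rewrite lmap_C.
  by rewrite lqlift_C (ThetaQ_C hX) // (lat_C L) EC.
have -> : iter k (lmap d) (lX i x) = lX i (iter k (lmap d) x).
  by elim: k => //= k ->; rewrite lmap_X.
have hk1 := hx k.+1; have {}hx := hx k; rewrite /= in hk1.
move: (iter k (lmap d) x) hx hk1 => {x k} x hx hd.
rewrite lqlift_X (ord1 i) (lat_X L).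
have -> : lift ord_max (ord0 : 'I_1) = p0 by apply: val_inj.
have e : lqX p0 (lqlift d x) = - lqX p1 (lqlift d x) - lqlift d (lmap d x).
  rewrite lqlift_d !big_ord_recl big_ord0 addr0 opprK.
  have -> : lift ord0 (ord0 : 'I_1) = p1 by apply: val_inj.
  by rewrite addrC addrK.
rewrite e (linpB (ThetaQ_linear hX v hg)) (linpN (ThetaQ_linear hX v hg)) hd.
rewrite (ThetaQ_X hX) // lshift12_1 dg.
rewrite (reg_linear0 (ThetaQ_reg_linear hX _ _)) subr0 hx.
rewrite (linpB EL) (linpN EL) EX lift_max1 (lat_lmap L) // => y.
by rewrite (linearB (lmap d)) (linearN (lmap d)) /= lmap_X.
Qed.

Lemma leval_lat_lX (phi : V -> lpoly V 2) (k : 'I_2) Q : linear phi ->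
  leval (@lX F V 2) phi (lat (lX k) Q) = leval (fun=> lX k) phi Q.
Proof.
move=> phiL; have XC i j (x : lpoly V 2) : lX i (lX j x) = lX j (lX i x) by exact: lX_comm.
apply: (leval_unique (fun=> lXL k) (fun _ _ _ => erefl) phiL
  (f := fun Q => leval (@lX F V 2) phi (lat (lX k) Q))) => [c x y|a|l x].
- by rewrite (lat_linear (lXL k)) (leval_linear lXL phiL).
- by rewrite (lat_C (lXL k)) (leval_C lXL phiL).
by rewrite (lat_X (lXL k)) (leval_X lXL XC phiL).
Qed.

Local Notation h1 := (rzinv F o2 o0 * rzinv F o2 o1).
Local Notation h2 := (rzinv F o1 o0 * rzinv F o1 o2).

Lemma reg_zinv (i j : 'I_3) : cl i != cl j -> reg (rzinv F i j).
Proof. by move=> h; apply: RGzinv => //; apply: contra_neq h => ->. Qed.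

Lemma comp1_h1 u v w : C (tripV u v w) h1 =
  lqlift d (leval (@lX F V 2)
    (fun a => lat (fun x => lX p0 x + lX p1 x) (chiral_br a w))
    (lat (lX p0) (chiral_br u v) - lat (fun x => - lX p1 x - lmap d x) (chiral_br u v))).
Proof.
have r1 : reg (rzinv F o2 o1) by apply: reg_zinv; rewrite !clE.
have r0 : reg (rzinv F o2 o0) by apply: reg_zinv; rewrite !clE.
have e : h1 = rsubst sh (rzinv F p1 p0) * (rzinv F o2 o1 - rzinv F o2 o0).
  rewrite rsubst_zinv // lshift12_0 lshift12_1 mulrBr.
  have pf := @partial_fractions _ _ _ _ _ _ _ (@rzV F 3 o1 o0 isT)
    (@rzV F 3 o2 o0 isT) (@rzV F 3 o2 o1 isT).
  rewrite pf; last by rewrite addrC rzD.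
  by rewrite mulrDl addrC addKr mulrC.
rewrite e (comp1_factor hX hX); last by apply: RGadd => //; apply: rgenN.
rewrite -scaleN1r (reg_linearD (ThetaQ_reg_linear hX _ _)) //; last exact: rgenZ.
rewrite (reg_linearZ _ (ThetaQ_reg_linear hX _ _)) // scaleN1r.
rewrite -!chiral_brK ThetaQ_lift0 //; last by rewrite rderiv_zinv // subrr scale0r.
rewrite ThetaQ_lift1 //; last by rewrite rderiv_zinv // subrr scale0r.
have xE i : rsubst cl (rzinv F o2 i) = rzinv F p1 p0 -> forall a,
    xterm w (rzinv F o2 i) a = lqlift d (lat (fun x => lX p0 x + lX p1 x) (chiral_br a w)).
  by move=> ei a; rewrite /xterm ei -chiral_brK push_cl_lift.
pose phi a : lpoly V 2 := lat (fun x => lX p0 x + lX p1 x) (chiral_br a w).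
have phiL : linear phi by apply: linear_comp (lat_linear _) (chiral_br_linl w); apply: lXX_linear.
rewrite -[tripV u v w o0]/u -[tripV u v w o1]/v -[tripV u v w o2]/w.
rewrite (eq_leval_coef (B := fun i => lqX (lift ord_max ((fun=> p0) i)))
  (psi := fun a => lqlift d (phi a))); last first.
- by move=> m; apply: xE; rewrite rsubst_zinv !clE.
- by move=> i y; rewrite lift_max0.
rewrite (leval_lift (fun=> p0)) //.
rewrite [X in _ - X](eq_leval_coef (B := fun i => lqX (lift ord_max (id i)))
  (psi := fun a => lqlift d (phi a))) //; last first.
  by move=> m; apply: xE; rewrite rsubst_zinv !clE.
rewrite (leval_lift id) // -leval_lat_lX //.
by rewrite (linpB (leval_linear lXL phiL)) linearB.
Qed.

End JacobiTerms.

Lemma leval_add (F : fieldType) (V M : lmodType F) (n : nat)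
    (A : 'I_n -> M -> M) (phi psi : V -> M) (x : lpoly V n) :
  (forall i, linear (A i)) ->
  leval A (fun v => phi v + psi v) x = leval A phi x + leval A psi x.
Proof.
move=> AL; rewrite /leval lsum.unlock -big_split; apply: eq_bigr => m _ /=.
by rewrite (linpD (linear_foldr AL _ _)).
Qed.

(** Reduces the comparison of three signed terms to three equations between signs, which can be
    checked parity by parity. *)
Lemma signed_combination (F : fieldType) (M : lmodType F) (s e0 e1 e2 c1 c2 : F)
    (x y z : M) : s * e0 = -1 -> c1 = - (s * e1) -> c2 = s * e2 ->
  x + c1 *: y + c2 *: z = s *: (e2 *: z - e1 *: y - e0 *: x).
Proof.
rewrite !scalerBr !scalerA => -> -> ->; rewrite scaleN1r opprK scaleNr.
by rewrite [RHS]addrC -addrA; congr (_ + _); rewrite addrC.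
Qed.

Section MaurerCartan.
Variables (F : fieldType) (charF0 : [pchar F] =i pred0) (V : lmodType F).
Variables (G : supergrading V) (d : {linear V -> V}) (d_even : even_endo G d).
Variables (X : chmap d 2) (hX : chiral X).
Local Notation PiG := (parity_reverse G).
Hypothesis X_sym : forall s (v : 'I_2 -> V) f, symact PiG s X v f = X v f.
Hypothesis X_odd : chparity PiG true X.
Implicit Types (u v w : V).

Local Notation C := (@comp1 F V d 2 1 X X : chmap d 3).
Local Notation sw := (tperm p0 p1 : 'S_2).
Local Notation h1 := (rzinv F o2 o0 * rzinv F o2 o1).
Local Notation h2 := (rzinv F o1 o0 * rzinv F o1 o2).
Local Notation I := (int_bracket G X).

(** In reversed parities 1 + (1 - a) + (1 - b) is 1 - (a + b) modulo 2, so an odd X gives a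
    parity-preserving bracket. *)
Lemma chiral_br_parity (a b : bool) u v : has_parity G a u -> has_parity G b v ->
  lmap (G (a (+) b)) (chiral_br X u v) = chiral_br X u v.
Proof.
move=> hu hv; have := X_odd (p := fun i => [:: ~~ a; ~~ b]`_i) (v := pairV u v) (rzinv F p1 p0).
case=> [|x hx e].
  by elim/ord2P; rewrite /has_parity /= negbK.
rewrite /chiral_br e (lqnorm_lmap d_even); congr (lqnorm (lpi d _)).
apply/lmap_parityP => m; have := hx m.
rewrite !big_ord_recl big_ord0 /has_parity /=.
have -> : ~~ (~~ (~~ a (+) (~~ b (+) false))) = a (+) b by case: (a); case: (b).
by [].
Qed.

Lemma int_bracketE u v : I u v = chiral_br X (G false u) v - chiral_br X (G true u) v.
Proof.
by rewrite /int_bracket big_bool /= expr0 expr1 scale1r scaleN1r addrC !lquot2_lpolyE.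
Qed.

Lemma int_bracket_hom (a : bool) u v : has_parity G a u -> I u v = (-1) ^+ a *: chiral_br X u v.
Proof.
move=> hu; rewrite int_bracketE.
have x0 := linp0 (chiral_br_linl hX v).
case: a hu => hu; rewrite (hu : _ = u) (parity_neq hu) // x0.
  by rewrite sub0r expr1 scaleN1r.
by rewrite subr0 expr0 scale1r.
Qed.

Lemma int_bracket_linl v : linear (I^~ v).
Proof.
move=> c x y; rewrite !int_bracketE !linearP !(chiral_br_linl hX).
by rewrite opprD addrACA -scalerBr.
Qed.

Lemma int_bracket_linr u : linear (I u).
Proof.
by move=> c x y; rewrite !int_bracketE !(chiral_br_linr hX) opprD addrACA -scalerBr.
Qed.

Lemma rsubst_t12_h1 : rsubst t12 h1 = h2.
Proof.
rewrite rsubstM; [|exact/rgen_inj/perm_inj..].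
by rewrite !rsubst_zinv !t12E.
Qed.

Lemma rsubst_t12_h2 : rsubst t12 h2 = h1.
Proof.
rewrite rsubstM; [|exact/rgen_inj/perm_inj..].
by rewrite !rsubst_zinv !t12E.
Qed.

Lemma rsubst_c120_h1 : rsubst c120^-1%g h1 = h2.
Proof.
rewrite rsubstM; [|exact/rgen_inj/perm_inj..].
by rewrite !rsubst_zinv !c120VE // mulrC.
Qed.

(** Serves both nested integrals, with [tau] equal to [t12] or to the inverse of [c120]. The
    symmetry of X moves the inner bracket to the second outer slot, at the cost of the sign; j and k
    are then the variables attached to u and v. *)
Lemma comp1_h2 (tau : 'I_3 -> 'I_3) (j k : 'I_2) pu pv pw u v w :
  (forall q : lquot d 3, lqpush tau (lqX o0 q) = lqX (lift ord_max j) (lqpush tau q)) ->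
  (forall i, (sw (cl (tau i)) == p0) = (i == lift ord_max k)) ->
  has_parity G pu u -> has_parity G pv v -> has_parity G pw w ->
  lqpush tau (C (tripV u w v) h2) = (-1) ^+ (~~ (pu (+) pw) && ~~ pv) *:
    lqlift d (leval (fun=> lX j) (fun a => lat (lX k) (chiral_br X v a)) (chiral_br X u w)).
Proof.
move=> htau hk hu hv hw.
have lqXL i : linear (@lqX F V d 3 i) by apply: lqmulm_is_linear.
have pL : linear (lqpush tau : lquot d 3 -> lquot d 3) by apply: lqpush_is_linear.
have rg : reg (rzinv F o1 o2) by apply: reg_zinv; rewrite !clE.
have -> : h2 = rsubst sh (rzinv F p1 p0) * rzinv F o1 o2.
  by rewrite rsubst_zinv // lshift12_0 lshift12_1.
rewrite (comp1_factor hX hX) // -[tripV u w v o0]/u -[tripV u w v o1]/w.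
rewrite -[tripV u w v o2]/v -chiral_brK (ThetaQ_lift0 hX) //; last first.
  by rewrite rderiv_zinv // subrr scale0r.
rewrite (@leval_morph F V (lquot d 3) (lquot d 3) 1 (fun=> @lqX F V d 3 o0)
  (xterm X v (rzinv F o1 o2)) (fun=> @lqX F V d 3 (lift ord_max j)) (lqpush tau)) //;
  last exact: xterm_linear.
pose phi a : lpoly V 2 := lat (lX k) (chiral_br X v a).
have phiL : linear phi.
  by apply: linear_comp (lat_linear _) (chiral_br_linr hX v); apply: lX_linear.
rewrite (eq_leval_coef (B := fun=> @lqX F V d 3 (lift ord_max j))
  (psi := fun a => (-1) ^+ (~~ (pu (+) pw) && ~~ pv) *: lqlift d (phi a))) //.
  by rewrite leval_scale // (leval_lift d (fun=> j)).
move=> m; have := chiral_br_parity hu hw => /lmap_parityP/(_ m); move: (lcoef m _) => a ha.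
have ha' : has_parity PiG (~~ (pu (+) pw)) a by rewrite /has_parity /= negbK.
have hv' : has_parity PiG (~~ pv) v by rewrite /has_parity /= negbK.
rewrite /xterm rsubst_zinv ?clE // (chiral2_sym hX X_sym _ ha' hv').
rewrite rsubst_zinv ?tpermL ?tpermR // -chiral_brK.
rewrite !(linpZ (@lqpush_is_linear _ _ _ _ _ _)) !lqpush_comp.
by congr (_ *: _); apply: push_single_lift.
Qed.

Definition jacobi_expr pu pv u v w : lpoly V 2 :=
  nested_int I ord0 ord_max u v w
    - (-1) ^+ (pu && pv) *: nested_int I ord_max ord0 v u w
    - bracket_nested_int d I u v w.

(** The shuffle terms of the identity, [t12] and [c120] give, up to sign, the third, second and
    first terms of the Jacobi identity. *)
Lemma boxp_h1 (p : 'I_3 -> bool) (v : 'I_3 -> V) :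
  (forall i, has_parity PiG (p i) (v i)) ->
  boxp X p v h1 = (-1) ^+ (p o1) *:
    lqlift d (jacobi_expr (~~ p o0) (~~ p o1) (v o0) (v o1) (v o2)).
Proof.
move=> hv; have {}hv i : has_parity G (~~ p i) (v i) := hv i.
move: (hv o0) (hv o1) (hv o2); rewrite {hv}/boxp (tripVE v).
move: (p o0) (p o1) (p o2) (v o0) (v o1) (v o2) => {p v} a b c u v w.
rewrite -[tripV u v w o0]/u -[tripV u v w o1]/v -[tripV u v w o2]/w => hu hv hw.
have -> : (fun s => tripV u v w (t12 s)) = tripV u w v.
  by apply: funext; elim/ord3P; rewrite t12E.
have -> : (fun s => tripV u v w (c120 s)) = tripV v w u.
  by apply: funext; elim/ord3P; rewrite c120E.
rewrite rsubst_t12_h1 rsubst_c120_h1 (comp1_h1 hX).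
rewrite (comp1_h2 (j := p0) (k := p1) _ _ hu hv hw); last 2 first.
- by move=> q; rewrite (lqpush_bij _ _ t12K) lift_max0 t12E.
- by elim/ord3P; rewrite t12E clE ?(tpermL, tpermR) lift_max1.
rewrite (comp1_h2 (j := p1) (k := p0) _ _ hv hu hw); last 2 first.
- by move=> q; rewrite (lqpush_bij _ _ (permK c120)) lift_max1 c120E.
- by elim/ord3P; rewrite c120VE clE ?(tpermL, tpermR) lift_max0.
have lXL i : linear (@lX F V 2 i) by apply: lX_linear.
have I_u : I u = (fun x => @GRing.scale F (lpoly V 1) ((-1) ^+ ~~ a) (chiral_br X u x)).
  by apply: funext => c'; apply: int_bracket_hom.
have I_v : I v = (fun x => @GRing.scale F (lpoly V 1) ((-1) ^+ ~~ b) (chiral_br X v x)).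
  by apply: funext => c'; apply: int_bracket_hom.
have nestZ (i j : 'I_2) (e1 e2 : F) (f : V -> lpoly V 1) y : linear f ->
    leval (fun=> lX j) (fun x => lat (lX i) (e1 *: f x)) (e2 *: y) =
    (e1 * e2) *: leval (fun=> lX j) (fun x => lat (lX i) (f x)) y.
  move=> fL; have L : linear (fun x => lat (lX i) (f x)) := linear_comp (lat_linear (lXL i)) fL.
  rewrite mulrC -scalerA -leval_scale // -(linpZ (leval_linear (fun=> lXL j) _)) //.
    by apply: eq_leval_coef => // m; rewrite (linpZ (lat_linear (lXL i))).
  by move=> k x y'; rewrite L scalerDr !scalerA mulrC.
(* The first sign is that of the inner bracket; the second comes from the outer one, whose first
   arguments are the coefficients of the inner, of parity [~~ a (+) ~~ b]. *)
have brZ : bracket_nested_int d I u v w = ((-1) ^+ (~~ a) * (-1) ^+ (~~ a (+) ~~ b)) *: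
    leval (@lX F V 2) (fun x => lat (fun x => lX p0 x + lX p1 x) (chiral_br X x w))
      (lat (lX p0) (chiral_br X u v) - lat (fun x => - lX p1 x - lmap d x) (chiral_br X u v)).
  have LL := lat_linear (@lXX_linear F V); have Ld := lat_linear (lXd_linear d p1).
  have L : linear (fun x => lat (fun x : lpoly V 2 => lX p0 x + lX p1 x) (chiral_br X x w)).
    exact: linear_comp LL (chiral_br_linl hX w).
  rewrite (bracket_nested_intE charF0 int_bracket_linl) (bracket_intE charF0) I_u.
  rewrite (linpZ (lat_linear (lXL p0))) (linpZ Ld) -scalerBr.
  set B := lat (lX p0) (chiral_br X u v) - lat _ (chiral_br X u v).
  have hB : lmap (G (~~ a (+) ~~ b)) B = B.
    rewrite /B (linearB (lmap _)) /= -!lat_lmap ?(chiral_br_parity hu hv) //.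
    - exact: lXd_linear.
    - move=> y; rewrite (linearB (lmap _)) (linearN (lmap _)) /= !lmap_X.
      by rewrite (lmap_even_comm d_even).
    by move=> y; rewrite lmap_X.
  rewrite -scalerA -leval_scale // -(linpZ (leval_linear lXL _)).
    apply: eq_leval_coef => // m; rewrite lcoefZ.
    have hm := (lmap_parityP _ _ _).1 hB m.
    rewrite (int_bracket_hom (a := ~~ a (+) ~~ b)) ?(linpZ LL) //.
    by rewrite /has_parity linearZ /= hm.
  by move=> k x y; rewrite L scalerDr !scalerA mulrC.
rewrite /jacobi_expr brZ !(nested_intE charF0 int_bracket_linr) // I_u I_v.
rewrite !nestZ; [|exact: chiral_br_linr..].
move: (leval _ _ (lat _ _ - _)) (leval _ _ (chiral_br X u w))
  (leval _ _ (chiral_br X v w)) => x y z.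
rewrite !scalerA !(linpB (@lqlift_is_linear _ _ d 2)) !(linpZ (@lqlift_is_linear _ _ d 2)).
by apply: signed_combination; case: (a); case: (b); case: (c); rewrite /=; ring.
Qed.

(** The Jacobi identity allows any w, while [box_hom] needs all three arguments homogeneous. *)
Lemma jacobi_expr_addr pu pv u v w w' :
  jacobi_expr pu pv u v (w + w') = jacobi_expr pu pv u v w + jacobi_expr pu pv u v w'.
Proof.
have lXL i : linear (@lX F V 2 i) by apply: lX_linear.
have LL := lat_linear (@lXX_linear F V).
have nD (i j : 'I_2) (x y : V) : i != j ->
    nested_int I i j x y (w + w') = nested_int I i j x y w + nested_int I i j x y w'.
  move=> ij; rewrite !(nested_intE charF0 int_bracket_linr) //.
  rewrite (linpD (int_bracket_linr y)) (linpD (leval_linear (fun=> lXL j) _)) //.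
  exact: linear_comp (lat_linear (lXL i)) (int_bracket_linr x).
rewrite /jacobi_expr !nD // !(bracket_nested_intE charF0 int_bracket_linl).
have -> : leval (@lX F V 2) (fun x => lat (fun y => lX p0 y + lX p1 y) (I x (w + w')))
      (bracket_int d I u v) =
    leval (@lX F V 2) (fun x => lat (fun y => lX p0 y + lX p1 y) (I x w) +
      lat (fun y => lX p0 y + lX p1 y) (I x w')) (bracket_int d I u v).
  by apply: eq_leval_coef => // m; rewrite (linpD (int_bracket_linr _)) (linpD LL).
rewrite leval_add // scalerDr !opprD.
move: (leval _ _ _) (leval _ _ _) => x y; move: (nested_int _ _ _ _ _ _) => z.
move: (nested_int _ _ _ _ _ _) (_ *: _) (_ *: _) => t r s.
by rewrite (addrACA z) [LHS]addrACA.
Qed.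

Lemma maurer_cartan_jacobi :
  (forall (v : 'I_3 -> V) h, @box F V d PiG 2 1 X X v h = 0) <-> integral_jacobi G d I.
Proof.
split=> [mc a b u v w hu hv|hj].
  suff H c w' : has_parity G c w' -> jacobi_expr a b u v w' = 0.
    rewrite -/(jacobi_expr a b u v w) -(proj_sum G w) jacobi_expr_addr.
    by rewrite !(H _ _ (parity_proj G _ _)) addr0.
  move=> hw; pose p (i : 'I_3) := [:: ~~ a; ~~ b; ~~ c]`_i.
  have hp i : has_parity PiG (p i) (tripV u v w' i).
    by elim/ord3P: i; rewrite /has_parity /= negbK.
  have := mc (tripV u v w') h1; rewrite (box_hom hX _ hp) (boxp_h1 hp) /=.
  move/eqP; rewrite scaler_eq0 signr_eq0 /= !negbK => /eqP e.
  by rewrite -[LHS](@lqliftK F V d 2) e linear0.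
have H1 (p : 'I_3 -> bool) (v : 'I_3 -> V) :
    (forall i, has_parity PiG (p i) (v i)) -> boxp X p v h1 = 0.
  move=> hp; rewrite (boxp_h1 hp); set z := jacobi_expr _ _ _ _ _.
  have -> : z = 0; last by rewrite linear0 scaler0.
  by apply: hj; [exact: hp o0|exact: hp o1].
suff H h (p : 'I_3 -> bool) (v : 'I_3 -> V) :
    (forall i, has_parity PiG (p i) (v i)) -> boxp X p v h = 0.
  move=> v h; rewrite boxE big1 // => p _; apply: H => i.
  exact: (@parity_proj F V PiG).
have hB q := boxp_chiral hX q.
(* The induction predicate quantifies over p and v, since sesquilinearity alters v and the exchange
   [t12] permutes both. *)
move: h p v; apply: (rfun3_ind (Q := fun h => forall (p : 'I_3 -> bool) (v : 'I_3 -> V),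
  (forall i, has_parity PiG (p i) (v i)) -> boxp X p v h = 0) charF0)
  => [f g hf hg|c f hf|i j f hf|i f hf||] p v hp.
- by rewrite (linpD (chiral_linear_fun (hB p) v)) hf // hg // addr0.
- by rewrite (linpZ (chiral_linear_fun (hB p) v)) hf // scaler0.
- by rewrite (chiral_mulz (hB p)) hf // linear0.
- rewrite -(chiral_sesquilinear (hB p)) !hf ?linear0 ?addr0 // => k.
  rewrite /upd; case: eqP => [->|_]; last exact: hp.
  by have := hp i; rewrite /has_parity /= => {2}<-; rewrite (even_endo_comm d_even).
- exact: H1.
by rewrite (boxp_sym hX X_sym _ hp) rsubst_t12_h2 H1 ?linear0 ?scaler0.
Qed.

End MaurerCartan.

(** P may be trivial, for the injectivity of the correspondence, or homogeneity of given parities,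
    for the symmetry of a constructed map; it has to be stable under d because of
    sesquilinearity. *)
Lemma chiral2_ext (F : fieldType) (charF0 : [pchar F] =i pred0) (V : lmodType F)
    (d : {linear V -> V}) (X Y : chmap d 2) (P : ('I_2 -> V) -> Prop) :
  chiral X -> chiral Y -> (forall v i, P v -> P (upd v i (d (v i)))) ->
  (forall v, P v -> X v (rzinv F p1 p0) = Y v (rzinv F p1 p0)) ->
  forall f v, P v -> X v f = Y v f.
Proof.
move=> hX hY hP h1 f.
apply: (rfun2_ind (Q := fun f => forall v, P v -> X v f = Y v f) charF0)
    => [{}f g hf hg|c {}f hf|i j {}f hf|i {}f hf|] v hv.
- by rewrite (linpD (chiral_linear_fun hX v)) (linpD (chiral_linear_fun hY v)) hf ?hg.
- by rewrite (linpZ (chiral_linear_fun hX v)) (linpZ (chiral_linear_fun hY v)) hf.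
- by rewrite (chiral_mulz hX) (chiral_mulz hY) hf.
- by rewrite -(chiral_sesquilinear hX) -(chiral_sesquilinear hY) !hf //; apply: hP.
exact: h1.
Qed.

(** In the normal form, exchanging lambda_1 and lambda_2 is the substitution of - lambda - d for
    lambda that occurs in skew-symmetry. *)
Lemma push_sw_lift (F : fieldType) (V : lmodType F) (d : {linear V -> V})
    (x : lpoly V 1) :
  lqpush (tperm p0 p1) (lqlift d x) =
  lqlift d (lat (fun y => - lX ord0 y - lmap d y) x).
Proof.
have L := lXd_linear d (ord0 : 'I_1).
elim/lpoly_indX: x => [x y hx hy|v|k x hx].
- by rewrite !(linearD (@lqlift F V d 1)) linearD (linpD (lat_linear L)) linearD /= hx hy.
- by rewrite (lat_C L) !lqlift_C lqpush_C.
have e : lift ord_max (ord0 : 'I_1) = p0 by apply: val_inj.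
rewrite (lat_X L) lqlift_X (ord1 k) e (lqpush_bij _ _ (tpermK p0 p1)) tpermL hx.
rewrite (linearB (@lqlift F V d 1)) (linearN (@lqlift F V d 1)) /= lqlift_X e lqlift_d.
rewrite !big_ord_recl big_ord0 addr0 opprK.
have -> : lift ord0 (ord0 : 'I_1) = p1 by apply: val_inj.
by rewrite addKr.
Qed.

Section SignOperator.
Variables (F : fieldType) (V : lmodType F) (G : supergrading V).

Definition parity_sign (u : V) : V := G false u - G true u.

Lemma parity_sign_linear : linear parity_sign.
Proof.
move=> c u v; rewrite /parity_sign (linearP (G false)) (linearP (G true)) /=.
by rewrite opprD addrACA -scalerBr.
Qed.

Lemma parity_sign_hom (a : bool) u : has_parity G a u -> parity_sign u = (-1) ^+ a *: u.
Proof.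
rewrite /parity_sign => hu; case: a hu => hu.
  by rewrite (parity_neq (c := false) hu) // (hu : _ = u) sub0r scaleN1r.
by rewrite (parity_neq (c := true) hu) // (hu : _ = u) subr0 scale1r.
Qed.

Lemma parity_signK : involutive parity_sign.
Proof.
move=> u; have h b : has_parity G b (G b u) by apply: parity_proj.
rewrite {2}/parity_sign (linpB parity_sign_linear).
rewrite (parity_sign_hom (h false)) (parity_sign_hom (h true)).
by rewrite scale1r scaleN1r opprK proj_sum.
Qed.

Lemma parity_sign_d (d : {linear V -> V}) u :
  even_endo G d -> parity_sign (d u) = d (parity_sign u).
Proof. by move=> hd; rewrite /parity_sign !(even_endo_comm hd) linearB. Qed.

End SignOperator.

(** * From a chiral map to a vertex algebra *)

Section FromChiral.
Variables (F : fieldType) (charF0 : [pchar F] =i pred0) (V : lmodType F).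
Variables (G : supergrading V) (d : {linear V -> V}) (d_even : even_endo G d).
Variables (X : chmap d 2) (hX : chiral X).
Local Notation PiG := (parity_reverse G).
Implicit Types (u v w : V).
Local Notation I := (int_bracket G X).

Lemma int_bracket_sign u v : I u v = chiral_br X (parity_sign G u) v.
Proof. by rewrite int_bracketE (linpB (chiral_br_linl hX v)). Qed.

Lemma lift_max00 : lift ord_max (ord0 : 'I_1) = p0. Proof. exact: val_inj. Qed.
Lemma lift00 : lift ord0 (ord0 : 'I_1) = p1. Proof. exact: val_inj. Qed.

Lemma lqlift_d2 (x : lpoly V 1) :
  lqlift d (lmap d x) = - (lqX p0 (lqlift d x) + lqX p1 (lqlift d x)).
Proof. by rewrite lqlift_d !big_ord_recl big_ord0 addr0 lift00. Qed.

Lemma lqlift_inj : injective (@lqlift F V d 1).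
Proof. exact/can_inj/lqliftK. Qed.

(** Since z_21 times 1/z_21 is 1, the lambda-bracket is the value of X at the constant 1; its
    sesquilinearity then reflects that the derivatives of 1 vanish. *)
Lemma lder_chiral_br u v : lqlift d (lder ord0 (chiral_br X u v)) = X (pairV u v) 1.
Proof. by rewrite lqlift_lder lift_max00 chiral_brK -(chiral_mulz hX) rzV. Qed.

Lemma chiral_br_dl u v : lder ord0 (chiral_br X (d u) v) = - lX ord0 (lder ord0 (chiral_br X u v)).
Proof.
apply: lqlift_inj; rewrite linearN /= lqlift_X lift_max00 !lder_chiral_br (chiral2_dl hX).
by rewrite -rconst1 rderiv_const (linp0 (chiral_linear_fun hX _)) sub0r.
Qed.

Lemma chiral_br_dr u v : lder ord0 (chiral_br X u (d v)) =
  lmap d (lder ord0 (chiral_br X u v)) + lX ord0 (lder ord0 (chiral_br X u v)).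
Proof.
apply: lqlift_inj; rewrite linearD /= lqlift_d2 lqlift_X lift_max00 !lder_chiral_br.
rewrite (chiral2_dr hX) -rconst1 rderiv_const (linp0 (chiral_linear_fun hX _)).
by rewrite opprD addrAC addNr.
Qed.

(** The sum of the two partial derivatives kills 1/z_21. *)
Lemma chiral_br_d u v : chiral_br X (d u) v + chiral_br X u (d v) = lmap d (chiral_br X u v).
Proof.
apply: lqlift_inj; rewrite linearD /= lqlift_d2 !chiral_brK (chiral2_dl hX) (chiral2_dr hX).
rewrite addrACA -opprD -(linpD (chiral_linear_fun hX _)) !rderiv_zinv //=.
by rewrite -scalerDl subr0 sub0r subrr scale0r (linp0 (chiral_linear_fun hX _)) add0r.
Qed.

Hypothesis X_sym : forall s (v : 'I_2 -> V) f, symact PiG s X v f = X v f.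
Hypothesis X_odd : chparity PiG true X.

Lemma int_bracket_skew (p q : bool) u v : has_parity G p u -> has_parity G q v ->
  I v u = (-1) ^+ (p && q) *: lat (fun x => - lX ord0 x - lmap d x) (I u v).
Proof.
move=> hu hv.
have L := lXd_linear d (ord0 : 'I_1).
have hu' : has_parity PiG (~~ p) u by rewrite /has_parity /= negbK.
have hv' : has_parity PiG (~~ q) v by rewrite /has_parity /= negbK.
rewrite (int_bracket_hom hX _ hv) (int_bracket_hom hX _ hu) (linpZ (lat_linear L)) scalerA.
apply: lqlift_inj; rewrite !linearZ /= chiral_brK (chiral2_sym hX X_sym _ hv' hu').
(* 1/z_21 changes sign under the exchange; this sign enters the final comparison of parities. *)
rewrite rsubst_zinv ?tpermL ?tpermR // rzinvN (linpN (chiral_linear_fun hX _)) -chiral_brK.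
rewrite linearN /= push_sw_lift -scaleN1r !scalerA; congr (_ *: _).
by case: (p); case: (q); rewrite /=; ring.
Qed.

Lemma int_bracket_vertex : (forall (v : 'I_3 -> V) h, @box F V d PiG 2 1 X X v h = 0) ->
  nonunital_vertex_algebra G d I.
Proof.
move=> mc; split.
- exact: int_bracket_linl.
- exact: int_bracket_linr.
- move=> p q u v m hu hv; rewrite (int_bracket_hom hX _ hu).
  have := (lmap_parityP _ _ _).1 (chiral_br_parity d_even X_odd hu hv) m.
  by rewrite /has_parity lcoefZ linearZ /= => ->.
- by move=> u v; rewrite /lbr !int_bracket_sign parity_sign_d // chiral_br_dl.
- by move=> u v; rewrite /lbr !int_bracket_sign chiral_br_dr.
- move=> u v; rewrite /nop !int_bracket_sign parity_sign_d // -lcoef_lmap -chiral_br_d.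
  exact: linearD.
- exact: int_bracket_skew.
exact/(maurer_cartan_jacobi charF0 d_even hX X_sym X_odd).
Qed.

End FromChiral.

Lemma int_bracket_inj (F : fieldType) (charF0 : [pchar F] =i pred0) (V : lmodType F)
    (G : supergrading V) (d : {linear V -> V}) (X Y : chmap d 2) :
  chiral X -> chiral Y -> int_bracket G X = int_bracket G Y -> X = Y.
Proof.
move=> hX hY e; apply: funext => v; apply: funext => f.
apply: (chiral2_ext (P := fun=> True) charF0 hX hY) => // {f}v _.
rewrite (pairVE v) -(parity_signK G (v p0)) -!chiral_brK -!int_bracket_sign //.
by rewrite e.
Qed.

(** * The chiral map of a bracket *)

Section PolySum.
Variables (F : fieldType) (M : lmodType F).
Implicit Types (e : nat -> M) (P Q : {poly F}).

(** Used with the powers of z_21, where it gives P(z_21), and with the iterates of D = d/dlambda,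
    where it gives P(D). *)
Definition polysum e P : M := \sum_(i < size P) P`_i *: e i.

Lemma polysum_bound e P n : (size P <= n)%N -> polysum e P = \sum_(i < n) P`_i *: e i.
Proof.
move=> hn; rewrite /polysum -(subnKC hn) big_split_ord /= [X in _ + X]big1 ?addr0 // => i _.
by rewrite nth_default ?scale0r // leq_addr.
Qed.

Lemma polysum_linear e : linear (polysum e).
Proof.
move=> c P Q; pose n := maxn (size P) (size Q).
have hn : (size (c *: P + Q)%R <= n)%N.
  apply: leq_trans (size_polyD _ _) _; rewrite geq_max leq_max leq_max.
  by rewrite size_scale_leq leqnn orbT.
rewrite (polysum_bound e hn) (polysum_bound e (leq_maxl _ _ : (size P <= n)%N)).
rewrite (polysum_bound e (leq_maxr _ _ : (size Q <= n)%N)) scaler_sumr -big_split /=.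
by apply: eq_bigr => i _; rewrite coefD coefZ scalerDl scalerA.
Qed.

Lemma polysum_XnC e k : polysum e 'X^k = e k.
Proof.
rewrite /polysum size_polyXn (bigD1 ord_max) //= coefXn eqxx scale1r big1 ?addr0 // => i hi.
rewrite coefXn (_ : (i == k :> nat) = false) ?scale0r //.
by apply: contraNF hi => /eqP h; apply/eqP/val_inj.
Qed.

Lemma polysum_C e c : polysum e c%:P = c *: e 0%N.
Proof. by rewrite -alg_polyC (linpZ (polysum_linear e)) -(expr0 'X) polysum_XnC. Qed.

Lemma polysum_mulX e P : polysum e (P * 'X) = polysum (fun i => e i.+1) P.
Proof.
have h : (size (P * 'X)%R <= (size P).+1)%N.
  by apply: leq_trans (size_polyMleq _ _) _; rewrite size_polyX addn2.
rewrite (polysum_bound e h) big_ord_recl coefMX eqxx scale0r add0r /polysum.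
by apply: eq_bigr => i _; rewrite coefMX.
Qed.

Lemma polysum_mulXn e P k : polysum e (P * 'X^k) = polysum (fun i => e (i + k)%N) P.
Proof.
elim: k e => [|k IH] e; first by rewrite mulr1; apply: eq_bigr => i _; rewrite addn0.
rewrite exprSr mulrA polysum_mulX IH; apply: eq_bigr => i _.
by rewrite addnS.
Qed.

Lemma eq_polysum e e' P : e =1 e' -> polysum e P = polysum e' P.
Proof. by move=> h; apply: eq_bigr => i _; rewrite h. Qed.

Lemma polysum_deriv e P : polysum e P^`() = polysum (fun i => i%:R *: e i.-1) P.
Proof.
elim/poly_ind: P e => [|P c IH] e.
  by rewrite deriv0 !(linp0 (polysum_linear _)).
rewrite derivD derivC addr0 derivM derivX mulr1 !(linpD (polysum_linear _)).
rewrite !polysum_mulX polysum_C scale0r scaler0 addr0 IH /polysum.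
rewrite -big_split; apply: eq_bigr => i _ /=; rewrite -scalerDr; congr (_ *: _).
case: (nat_of_ord i) => [|k] /=; first by rewrite scale0r add0r scale1r.
by rewrite -[X in _ + X]scale1r -scalerDl natr1.
Qed.

End PolySum.

Lemma polysum_morph (F : fieldType) (M N : lmodType F) (f : M -> N) e P :
  linear f -> f (polysum e P) = polysum (fun i => f (e i)) P.
Proof.
by move=> fL; rewrite (linp_sum fL); apply: eq_bigr => i _; rewrite (linpZ fL).
Qed.

Section Evaluation.
Variable F : fieldType.
Local Notation t := (rz F p1 p0).

Definition peval : {poly F} -> rfun F 2 := polysum (fun i => t ^+ i).

Lemma peval_linear : linear peval. Proof. exact: polysum_linear. Qed.

Lemma peval_mulX P : peval (P * 'X) = peval P * t.
Proof.
rewrite /peval polysum_mulX [RHS]mulrC.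
rewrite (polysum_morph (f := fun g => t * g)); last first.
  by move=> c f g; rewrite mulrDr !rscaleE mulrCA.
by apply: eq_polysum => i; rewrite exprS.
Qed.

Lemma peval_mulXn P k : peval (P * 'X^k) = peval P * t ^+ k.
Proof.
elim: k => [|k IH]; first by rewrite !mulr1.
by rewrite exprSr mulrA peval_mulX IH -mulrA -exprSr.
Qed.

Lemma peval_C c : peval c%:P = rconst 2 c.
Proof. by rewrite /peval polysum_C rscaleE mulr1. Qed.

Lemma peval1 : peval 1 = 1.
Proof. by rewrite /peval -(expr0 'X) polysum_XnC. Qed.

Lemma pevalM P Q : peval (P * Q) = peval P * peval Q.
Proof.
elim/poly_ind: P => [|P c IH]; first by rewrite mul0r (linp0 peval_linear) mul0r.
rewrite mulrDl !(linpD peval_linear) mulrDl -mulrA (mulrC 'X) mulrA !peval_mulX IH.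
by rewrite mulrAC mul_polyC (linpZ peval_linear) peval_C rscaleE.
Qed.

Lemma peval_inj : injective peval.
Proof.
suff H P : peval P = 0 -> P = 0.
  move=> P Q e; apply/eqP; rewrite -subr_eq0; apply/eqP/H.
  by rewrite (linpB peval_linear) e subrr.
pose m (P : {poly F}) : {mpoly F[2]} := \sum_(i < size P) P`_i *: ('X_p1 - 'X_p0) ^+ i.
have e : rval (peval P) = (m P)%:F.
  rewrite /peval /polysum /m.
  have -> (s : seq 'I_(size P)) E : rval (\sum_(i <- s) E i) = \sum_(i <- s) rval (E i).
    by elim: s => [|i s IH]; rewrite ?big_nil ?big_cons //= IH.
  rewrite (big_morph (@FracField.tofrac {mpoly F[2]}) (@tofracD _) (@tofrac0 _)).
  apply: eq_bigr => i _; rewrite rscaleE /= -mul_mpolyC tofracM; congr (_ * _).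
  elim: (i : nat) => [|k IH]; first by rewrite !expr0 tofrac1.
  by rewrite !exprS /= IH tofracM.
move=> P0; have {e P0} : m P = 0.
  by apply/eqP; rewrite -tofrac_eq0 -e P0.
(* Setting z_1 = 0 and z_2 = 'X recovers P from P(z_21). *)
pose h (i : 'I_2) : {poly F} := if i == p1 then 'X else 0.
move/(congr1 (mmap polyC h)); rewrite /m rmorph0 rmorph_sum /=.
have E i : mmap polyC h (P`_i *: ('X_p1 - 'X_p0) ^+ i) = P`_i *: 'X^i.
  by rewrite mmapZ rmorphXn rmorphB /= !mmapX !mmap1U /h /= subr0 mul_polyC.
by under eq_bigr do rewrite E; rewrite -[X in X = _](poly_def (size P) (fun i => P`_i)) coefK.
Qed.

Lemma peval_gen f : rgen rnone f -> exists P, f = peval P.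
Proof.
elim=> {f} [c|i j|i j //|f g _ [P ->] _ [Q ->]|f g _ [P ->] _ [Q ->]].
- by exists c%:P; rewrite peval_C.
- have ht : t = peval 'X.
    by rewrite -[X in peval X]mul1r peval_mulX peval1 mul1r.
  elim/ord2P: i; elim/ord2P: j.
  + by exists 0; rewrite rzxx (linp0 peval_linear).
  + by exists (- 'X); rewrite (linpN peval_linear) -ht rzN.
  + by exists 'X.
  by exists 0; rewrite rzxx (linp0 peval_linear).
- by exists (P + Q); rewrite (linpD peval_linear).
by exists (P * Q); rewrite pevalM.
Qed.

Lemma rfun2_repr (f : rfun F 2) : exists Pa : {poly F} * nat,
  f * t ^+ Pa.2.+1 = peval Pa.1.
Proof.
have [a [S [hS ->]]] := rfun2_frac f; have [P eP] := peval_gen hS.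
(* The extra factor 'X brings the denominator to z_21^(a+1), the exponent to which [polar a]
   belongs. *)
exists (P * 'X, a); rewrite /= peval_mulX -eP exprSr mulrA -(mulrA S).
by rewrite -exprMn (mulrC (rzinv _ _ _)) rzV // expr1n mulr1.
Qed.

Lemma peval_deriv0 P : rderiv p0 (peval P) = - peval P^`().
Proof.
elim/poly_ind: P => [|P c IH].
  by rewrite deriv0 (linp0 peval_linear) linear0 oppr0.
rewrite (linpD peval_linear) peval_C peval_mulX linearD /= rderivM rderiv_const addr0.
rewrite derivD derivC addr0 derivM derivX mulr1 (linpD peval_linear) peval_mulX IH.
rewrite rderiv_z /= sub0r.
have -> : rconst 2 (-1) = -1 :> rfun F 2 by rewrite -[LHS]mulr1 -rscaleE scaleN1r.
by rewrite opprD mulrN1 mulNr.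
Qed.

(** Functions of z_12 alone are invariant under translation. *)
Lemma rderiv2 (f : rfun F 2) : rderiv p1 f = - rderiv p0 f.
Proof.
elim: (rgen_all f) => {f} [c|i j|i j _ ij|f g _ hf _ hg|f g _ hf _ hg].
- by rewrite !rderiv_const oppr0.
- have NC c : - rconst 2 c = rconst 2 (- c) :> rfun F 2.
    by rewrite -[rconst 2 c]mulr1 -rscaleE -scaleNr rscaleE mulr1.
  by rewrite !rderiv_z NC; congr rconst; elim/ord2P: i; elim/ord2P: j => /=; ring.
- rewrite !rderiv_zinv // -scaleNr; congr (_ *: _).
  by elim/ord2P: i ij; elim/ord2P: j => //= _; ring.
- by rewrite !rderivD hf hg opprD.
by rewrite !rderivM hf hg opprD mulNr mulrN.
Qed.

End Evaluation.

(** * Construction of a chiral map from its value at 1/z_21 *)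

Section FromBracket.
Variables (F : fieldType) (charF0 : [pchar F] =i pred0) (V : lmodType F).
Variables (d : {linear V -> V}) (K : V -> V -> lpoly V 1).
Local Notation t := (rz F p1 p0).
Local Notation D := (@lder F V 1 ord0).
Local Notation L := (@lX F V 1 ord0).
Hypotheses (Kl : forall v, linear (K^~ v)) (Kr : forall u, linear (K u)).
Hypothesis Kdl : forall u v, D (K (d u) v) = - L (D (K u v)).
Hypothesis Kd : forall u v, K (d u) v + K u (d v) = lmap d (K u v).
Implicit Types (u : V) (P : {poly F}) (a : nat).

(* The value at [z_21 ^ - (a + 1)] of the chiral map whose value at [1 / z_21] is K. *)
Fixpoint polar a (u v : V) : lpoly V 1 :=
  if a is b.+1 then b.+1%:R^-1 *: (polar b (d u) v + L (polar b u v)) else K u v.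

Let nat0 a : a.+1%:R != 0 :> F. Proof. by rewrite (pcharf0P F).1. Qed.

Lemma polarS a u v : polar a (d u) v + L (polar a u v) = a.+1%:R *: polar a.+1 u v.
Proof. by rewrite /= scalerA mulfV // scale1r. Qed.

Lemma polar_linl a v : linear (polar a ^~ v).
Proof.
elim: a => [|a IH] c x y /=; first exact: Kl.
rewrite linearP !IH (linearP L) /= addrACA -(scalerDr c) [LHS]scalerDr.
by rewrite !scalerA (mulrC c).
Qed.

Lemma polar_linr a u : linear (polar a u).
Proof.
elim: a u => [|a IH] u c x y /=; first exact: Kr.
rewrite !IH (linearP L) /= addrACA -(scalerDr c) [LHS]scalerDr.
by rewrite !scalerA (mulrC c).
Qed.

(** From [D, T] = 1 and T D K = 0 one gets D T^(a+1) K = (a+1) T^a K; the division by factorials in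
    [polar] absorbs the coefficient. *)
Lemma lder_polar a u v : D (polar a.+1 u v) = polar a u v.
Proof.
elim: a u v => [|a IH] u v.
  by rewrite /= invr1 scale1r linearD /= Kdl lder_X eqxx mulr1n addKr.
apply: (scalerI (nat0 a.+1)); rewrite -linearZ -polarS linearD /= lder_X eqxx mulr1n.
rewrite -![_ *: _ : lpoly V 1]/(polar a.+1 _ _) !IH addrA polarS.
by rewrite -[X in _ + X]scale1r -scalerDl natr1.
Qed.

Lemma polar_d a u v : polar a (d u) v + polar a u (d v) = lmap d (polar a u v).
Proof.
elim: a u v => [|a IH] u v; first exact: Kd.
rewrite /= -scalerDr (linpZ (@lmap_linear F V 1 V d)) (linpD (@lmap_linear F V 1 V d)).
rewrite lmap_X -!IH (linearD L) /=.
by congr (_ *: _); rewrite addrACA.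
Qed.

Definition pder P (y : lpoly V 1) : lpoly V 1 := polysum (fun i => iter i D y) P.

Lemma iterD_linear i : linear (iter i D).
Proof. by elim: i => [|i IH] c x y //=; rewrite IH linearP. Qed.

Lemma pder_linear P : linear (pder P).
Proof.
move=> c x y; rewrite /pder /polysum scaler_sumr -big_split; apply: eq_bigr => i _ /=.
by rewrite iterD_linear scalerDr !scalerA mulrC.
Qed.

Lemma pder_mulXn P k y : pder (P * 'X^k) y = pder P (iter k D y).
Proof. by rewrite /pder polysum_mulXn; apply: eq_polysum => i; rewrite iterD. Qed.

Lemma pder_mulX P y : pder (P * 'X) y = pder P (D y).
Proof. exact: (pder_mulXn P 1). Qed.

Lemma lder_pder P y : D (pder P y) = pder P (D y).
Proof.
rewrite /pder (polysum_morph (f := D)); last exact: lder_is_linear.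
by apply: eq_polysum => i; rewrite -iterS iterSr.
Qed.

(** The Weyl relation extended from D to P(D), whose commutator with lambda is P'(D). *)
Lemma pder_lX P y : pder P (L y) = L (pder P y) + pder P^`() y.
Proof.
rewrite /pder polysum_deriv (polysum_morph (f := L)); last exact: lX_linear.
rewrite /polysum -big_split; apply: eq_bigr => i _ /=; rewrite -scalerDr; congr (_ *: _).
elim: (nat_of_ord i) => [|k IH] /=; first by rewrite scale0r addr0.
rewrite IH linearD linearZ /= lder_X eqxx mulr1n -addrA; congr (_ + _).
case: k {IH} => [|k] /=; first by rewrite scale0r addr0 scale1r.
by rewrite -[X in X + _]scale1r -scalerDl [1 + _]addrC natr1.
Qed.

Lemma pder_lmap (f : {linear V -> V}) P y : pder P (lmap f y) = lmap f (pder P y).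
Proof.
rewrite /pder (polysum_morph (f := lmap f)); last exact: lmap_linear.
apply: eq_polysum => i; elim: i => //= i ->; exact: esym (lmap_lder _ _ _).
Qed.

Definition laurent_repr (f : rfun F 2) : {poly F} * nat := projT1 (cid (rfun2_repr f)).

Definition chiral_of : chmap d 2 := fun v f =>
  lqlift d (pder (laurent_repr f).1 (polar (laurent_repr f).2 (v p0) (v p1))).

Lemma iterD_polar k a u v : iter k D (polar (k + a) u v) = polar a u v.
Proof. by elim: k => [//|k IH]; rewrite iterSr addSn lder_polar. Qed.

(** Independence from the chosen representation: if P/z_21^(a+1) = Q/z_21^(b+1), then P z_21^b = Q
    z_21^a, and by [lder_polar] extra powers of D lower the index of [polar] to compensate. *)
Lemma chiral_ofE (v : 'I_2 -> V) f P a : f * t ^+ a.+1 = peval P ->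
  chiral_of v f = lqlift d (pder P (polar a (v p0) (v p1))).
Proof.
move=> eP; rewrite /chiral_of /laurent_repr; case: cid => -[Q b] /= eQ; congr lqlift.
have e : Q * 'X^a = P * 'X^b.
  apply: peval_inj; rewrite !peval_mulXn -eP -eQ -!mulrA -!exprD.
  by rewrite addSn addSn addnC.
rewrite -(iterD_polar a b) -pder_mulXn e addnC pder_mulXn iterD_polar.
by [].
Qed.

Lemma rfun2_peval f : exists P a, f * t ^+ a.+1 = peval P.
Proof. by have [[P a] e] := rfun2_repr f; exists P, a. Qed.

Lemma peval_scale (f : rfun F 2) P a b : f * t ^+ a.+1 = peval P ->
  f * t ^+ (a + b).+1 = peval (P * 'X^b).
Proof. by move=> e; rewrite peval_mulXn -e -mulrA -exprD addSn. Qed.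

Lemma chiral_of_linear (v : 'I_2 -> V) : linear (chiral_of v).
Proof.
move=> c f g; have [P [a eP]] := rfun2_peval f; have [Q [b eQ]] := rfun2_peval g.
have {}eP := peval_scale b eP; have {}eQ := peval_scale a eQ.
rewrite (addnC b) in eQ.
have e : (c *: f + g) * t ^+ (a + b).+1 = peval (c *: (P * 'X^b) + Q * 'X^a).
  rewrite (peval_linear c) -eP -eQ mulrDl; congr (_ + _).
  by rewrite !rscaleE mulrA.
rewrite (chiral_ofE v eP) (chiral_ofE v eQ) (chiral_ofE v e) -linearP; congr lqlift.
exact: polysum_linear.
Qed.

Lemma chiral_of_chiral : chiral chiral_of.
Proof.
have S0 (v : 'I_2 -> V) f :
    chiral_of (upd v p0 (d (v p0))) f + lqX p0 (chiral_of v f) = chiral_of v (rderiv p0 f).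
  have [P [a e]] := rfun2_peval f.
  (* Quotient rule for P(z_21)/z_21^(a+1), with d z_21/dz_1 = -1. *)
  have e' : rderiv p0 f * t ^+ a.+2 = peval (a.+1%:R *: P - P^`() * 'X).
    have : rderiv p0 (f * t ^+ a.+1) = rderiv p0 (peval P) by rewrite e.
    rewrite peval_deriv0 rderivM rderivX rderiv_z /= sub0r.
    have -> : rconst 2 (-1) = -1 :> rfun F 2 by rewrite -[LHS]mulr1 -rscaleE scaleN1r.
    move=> /(canRL (addrK _)) h.
    rewrite exprSr mulrA h (linpB (@peval_linear F)) (linpZ (@peval_linear F)) peval_mulX -e.
    rewrite mulrBl mulNr [in RHS]addrC; congr (_ + _); rewrite mulrN1 scalerN mulrN mulNr opprK.
    by rewrite !rscaleE exprSr mulrCA -!mulrA.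
  rewrite (chiral_ofE _ e) (chiral_ofE _ e) (chiral_ofE _ e') /upd /=.
  rewrite -lift_max00 -lqlift_X -linearD; congr lqlift.
  rewrite /pder (linpB (polysum_linear _)) (linpZ (polysum_linear _)) -!/(pder _ _).
  rewrite pder_mulX lder_polar -(linpZ (pder_linear P)) -polarS (linpD (pder_linear P)).
  by rewrite pder_lX -addrA addrK.
have Z (v : 'I_2 -> V) f : chiral_of v (t * f) = lqderB p0 p1 (chiral_of v f).
  have [P [a e]] := rfun2_peval f.
  have e' : t * f * t ^+ a.+1 = peval (P * 'X) by rewrite peval_mulX -e -mulrA mulrC.
  by rewrite (chiral_ofE _ e) (chiral_ofE _ e') pder_mulX -lder_pder lqlift_lder lift_max00.
split.
- move=> v i f c x y; rewrite /chiral_of -linearP; congr lqlift; rewrite -pder_linear; congr pder.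
  by elim/ord2P: i; rewrite /upd /=; [apply: polar_linl|apply: polar_linr].
- exact: chiral_of_linear.
- move=> v i f; elim/ord2P: i; first exact: S0.
  (* The second slot follows from the first: d/dz_2 is - d/dz_1, and d is a derivation of
     [polar]. *)
  rewrite rderiv2 (linpN (chiral_of_linear v)) -S0.
  have [P [a e]] := rfun2_peval f; rewrite !(chiral_ofE _ e) /upd /=.
  have h : polar a (v p0) (d (v p1)) = lmap d (polar a (v p0) (v p1)) - polar a (d (v p0)) (v p1).
    by rewrite -polar_d addrAC subrr add0r.
  rewrite h (linpB (pder_linear P)) pder_lmap linearB /= lqlift_d2 -/(lqX p1 _).
  by rewrite opprD [LHS]addrAC subrK -opprD; congr (- _); apply: addrC.
move=> v i j f; elim/ord2P: i; elim/ord2P: j.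
- by rewrite rzxx mul0r (linp0 (chiral_of_linear v)) lqderBxx.
- by rewrite rzN mulNr (linpN (chiral_of_linear v)) Z -lqderBN.
- exact: Z.
by rewrite rzxx mul0r (linp0 (chiral_of_linear v)) lqderBxx.
Qed.

Lemma chiral_of_zinv (v : 'I_2 -> V) : chiral_of v (rzinv F p1 p0) = lqlift d (K (v p0) (v p1)).
Proof.
rewrite (@chiral_ofE v _ 1 0); last first.
  by rewrite expr1 mulrC rzV // peval1.
by rewrite /pder -(expr0 'X) polysum_XnC.
Qed.

End FromBracket.

(** Combines an identity between lambda-brackets and one between normally ordered products into one
    between integral brackets. *)
Lemma lpoly1_eq (F : fieldType) (charF0 : [pchar F] =i pred0) (V : lmodType F)
    (x y : lpoly V 1) :
  lder ord0 x = lder ord0 y -> lcoef 0%MM x = lcoef 0%MM y -> x = y.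
Proof.
move=> hd h0; have := lprim_lder charF0 ord0 x; rewrite hd lprim_lder // !lzero1 h0.
by move/addIr.
Qed.

(** [lqparity] asks for a homogeneous representative: y itself, read in one more variable, is
    one. *)
Lemma lqlift_parity (F : fieldType) (V : lmodType F) (G : supergrading V)
    (d : {linear V -> V}) n b (y : lpoly V n) :
  lmap (G b) y = y -> lqparity G b (lqlift d y).
Proof.
pose x := leval (fun i => @lX F V n.+1 (lift ord_max i)) (@lC F V n.+1) y.
have XL i : linear (@lX F V n.+1 (lift ord_max i)) by exact: linearP.
have XC (i j : 'I_n.+1.-1) (z : lpoly V n.+1) :
  lX (lift ord_max i) (lX (lift ord_max j) z) = lX (lift ord_max j) (lX (lift ord_max i) z).
  by exact: lX_comm.
have CL : linear (@lC F V n.+1) by exact: linearP.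
move=> hy; exists x; last first.
  rewrite /lqlift /x; symmetry; apply: leval_morph => //.
  - by move=> i; apply: lqmulm_is_linear.
  - exact: lpi_is_linear.
  - by move=> i j z; apply: lqX_comm.
  by move=> i z; rewrite lqX_pi.
apply/lmap_parityP; rewrite /x -[in RHS]hy => {x hy}.
elim/lpoly_indX: y => [x y hx hy|v|i x hx].
- by rewrite linearD !(linpD (leval_linear XL CL)) linearD /= hx hy.
- by rewrite lmap_C !(leval_C XL CL) lmap_C.
by rewrite lmap_X !(leval_X XL XC CL) lmap_X hx.
Qed.

Lemma bilinear_hom_ext (F : fieldType) (V M : lmodType F) (G : supergrading V)
    (Z : ('I_2 -> V) -> M) :
  (forall v i, linear (fun u => Z (upd v i u))) ->
  (forall (p : 'I_2 -> bool) v, (forall i, has_parity G (p i) (v i)) -> Z v = 0) ->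
  forall v, Z v = 0.
Proof.
move=> ZL Z0 v; rewrite (pairVE v).
have Zl w : linear (fun u => Z (pairV u w)).
  by move=> c x y; have := ZL (pairV 0 w) p0 c x y; rewrite !upd_pairV0.
have Zr u : linear (fun w => Z (pairV u w)).
  by move=> c x y; have := ZL (pairV u 0) p1 c x y; rewrite !upd_pairV1.
have H a b u w : Z (pairV (G a u) (G b w)) = 0.
  by apply: (Z0 (fun i => [:: a; b]`_i)); elim/ord2P; apply: parity_proj.
rewrite -(proj_sum G (v p0)) -(proj_sum G (v p1)).
by rewrite (linpD (Zl _)) !(linpD (Zr _)) !H !addr0.
Qed.

Lemma perm2P (s : 'S_2) : s = 1%g \/ s = tperm p0 p1.
Proof.
have h i : s i != p0 -> s i = p1 by move: (s i); elim/ord2P.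
have n01 : s p0 != s p1 by rewrite (inj_eq perm_inj).
have [e|e] := eqVneq (s p0) p0; [left|right]; apply/permP; elim/ord2P.
- by rewrite perm1.
- by rewrite perm1; apply: h; rewrite -e eq_sym.
- by rewrite tpermL; apply: h.
rewrite tpermR; apply/eqP; apply: contraNT n01 => /h ->; apply/eqP; exact: h.
Qed.

(** * From a vertex algebra to a chiral map *)

Section FromVertexAlgebra.
Variables (F : fieldType) (charF0 : [pchar F] =i pred0) (V : lmodType F).
Variables (G : supergrading V) (d : {linear V -> V}) (d_even : even_endo G d).
Variables (I : V -> V -> lpoly V 1) (HI : nonunital_vertex_algebra G d I).
Local Notation PiG := (parity_reverse G).
Local Notation sw := (tperm p0 p1 : 'S_2).
Implicit Types (u w : V).

Definition signed_br u w : lpoly V 1 := I (parity_sign G u) w.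

Lemma signed_br_linl w : linear (signed_br^~ w).
Proof. exact: linear_comp (nuva_linearl HI w) (parity_sign_linear G). Qed.

Lemma signed_br_linr u : linear (signed_br u).
Proof. exact: nuva_linearr HI _. Qed.

Lemma signed_br_dl u w : lder ord0 (signed_br (d u) w) = - lX ord0 (lder ord0 (signed_br u w)).
Proof. by rewrite /signed_br parity_sign_d //; apply: nuva_dl HI _ _. Qed.

Lemma signed_br_d u w : signed_br (d u) w + signed_br u (d w) = lmap d (signed_br u w).
Proof.
rewrite /signed_br parity_sign_d //; move: (parity_sign G u) => {}u; apply: lpoly1_eq => //.
  rewrite linearD /= -lmap_lder.
  have := nuva_dl HI u w; have := nuva_dr HI u w; rewrite /lbr => -> ->.
  by rewrite addrCA addNr addr0.
by rewrite linearD lcoef_lmap /=; have := nuva_dnop HI u w; rewrite /nop => ->.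
Qed.

Lemma signed_br_hom (a : bool) u w : has_parity G a u -> signed_br u w = (-1) ^+ a *: I u w.
Proof. by move=> hu; rewrite /signed_br (parity_sign_hom hu) (linpZ (nuva_linearl HI w)). Qed.

Local Notation X := (chiral_of d signed_br).

Let hX : chiral X.
Proof. exact (chiral_of_chiral charF0 signed_br_linl signed_br_linr signed_br_dl signed_br_d). Qed.

Lemma polar_parity k (a b : bool) u w : has_parity G a u -> has_parity G b w ->
  lmap (G (a (+) b)) (polar d signed_br k u w) = polar d signed_br k u w.
Proof.
elim: k u w => [|k IH] u w hu hw /=.
  rewrite (signed_br_hom w hu) linearZ /=; congr (_ *: _).
  by apply/lmap_parityP => m; apply: nuva_even HI _ _ _ _ m hu hw.
rewrite linearZ linearD /= lmap_X !IH //.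
exact: d_even.
Qed.

Lemma chiral_of_odd : chparity PiG true X.
Proof.
move=> p v f hv; apply: lqlift_parity; rewrite -pder_lmap; congr pder.
rewrite !big_ord_recl big_ord0 lift00 /=.
have -> : ~~ (~~ (p p0 (+) (p p1 (+) false))) = ~~ p p0 (+) ~~ p p1.
  by case: (p p0); case: (p p1).
by apply: polar_parity; apply: hv.
Qed.

(** Multilinearity reduces to homogeneous arguments. There both sides are chiral, so they need
    comparison only at 1/z_21, where the claim is skew-symmetry of the bracket. *)
Lemma chiral_of_sym s v f : symact PiG s X v f = X v f.
Proof.
apply/eqP; rewrite -subr_eq0; apply/eqP.
apply: (bilinear_hom_ext (G := PiG) (Z := fun v => symact PiG s X v f - X v f))
    => [{}v i c x y|p {}v hv].
  by rewrite (symact_linear _ _ _ _ _ hX) (chiral_linear hX) opprD addrACA -scalerBr.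
rewrite (symact_hom _ _ hX hv); apply/eqP; rewrite subr_eq0; apply/eqP.
case: (perm2P s) => {s}->.
  rewrite /inv_parity !big_ord2_cond /= !perm1 /= expr0 scale1r invg1.
  rewrite lqpush_id; last by move=> i; rewrite perm1.
  rewrite rsubst_id; last by move=> i; rewrite perm1.
  by congr (X _ _); apply: funext => i; rewrite perm1.
have -> : inv_parity p sw = p p0 && p p1.
  by rewrite /inv_parity !big_ord2_cond /= tpermL tpermR /= !addn0.
rewrite tpermV; symmetry; move: f v hv.
apply: (chiral2_ext (P := fun v => forall i, has_parity PiG (p i) (v i)) charF0 hX
  (Y := fun v f => (-1) ^+ (p p0 && p p1) *: lqpush sw (X (fun i => v (sw i)) (rsubst sw f)))).
- by apply: chiralZ; apply: chiral_perm hX; apply: tpermK.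
- move=> v i hv k; rewrite /upd; case: eqP => [->|_]; last exact: hv.
  exact/d_even/(hv i).
move=> v hv; rewrite rsubst_zinv ?tpermL ?tpermR // (rzinvN F p0).
rewrite (linpN (chiral_linear_fun hX _)) !(chiral_of_zinv charF0 signed_br_dl) /=.
rewrite tpermL tpermR linearN /=.
rewrite push_sw_lift -(linpN (@lqlift_is_linear _ _ d 1)) -linearZ; congr lqlift.
have L := lXd_linear d (ord0 : 'I_1).
rewrite (signed_br_hom _ (hv p0)) (signed_br_hom _ (hv p1)) (linpZ (lat_linear L)).
rewrite (nuva_skew HI (hv p1) (hv p0)) -scaleN1r !scalerA; congr (_ *: _).
by case: (p p0); case: (p p1); rewrite /=; ring.
Qed.

Lemma int_bracket_chiral_of : int_bracket G X = I.
Proof.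
apply: funext => u; apply: funext => w; rewrite (int_bracket_sign G hX) /chiral_br.
by rewrite (chiral_of_zinv charF0 signed_br_dl) lqliftK /signed_br /= parity_signK.
Qed.

End FromVertexAlgebra.

Theorem theorem6p12 (F : fieldType) (charF0 : [pchar F]%R =i pred0)
    (V : lmodType F) (G : supergrading V) (d : {linear V -> V})
    (d_even : even_endo G d) :
  let PiG := parity_reverse G in
  let oddW1 := [set X : chmap d 2 | Wch PiG X /\ chparity PiG true X]%classic in
  let MC X := forall v h, box PiG X X v h = 0%R in
  (forall X, oddW1 X -> (MC X <-> integral_jacobi G d (int_bracket G X))) /\
  set_bij [set X | oddW1 X /\ MC X]%classic
          [set I | nonunital_vertex_algebra G d I]%classic
          (int_bracket G).
Proof.
move=> PiG oddW1 MC; have MCP X : oddW1 X -> (MC X <-> integral_jacobi G d (int_bracket G X)).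
  by case=> -[hX X_sym] X_odd; apply: maurer_cartan_jacobi.
split=> //; split.
- by move=> X [[[hX X_sym] X_odd] mc]; apply: int_bracket_vertex.
- move=> X Y; rewrite !in_setE => -[[[hX _] _] _] [[[hY _] _] _].
  exact: int_bracket_inj.
move=> I HI; exists (chiral_of d (signed_br G I)); last exact: int_bracket_chiral_of.
have hX : oddW1 (chiral_of d (signed_br G I)).
  split; last exact: chiral_of_odd.
  split; last exact: chiral_of_sym.
  exact (chiral_of_chiral charF0 (signed_br_linl HI) (signed_br_linr HI)
    (signed_br_dl d_even HI) (signed_br_d charF0 d_even HI)).
(* The equivalence just proved turns the Jacobi axiom of I into X box X = 0. *)
split=> //; apply/(MCP _ hX); rewrite int_bracket_chiral_of //.
exact: nuva_jacobi HI.
Qed.
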